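(* Suppose that $\nabla L(\boldsymbol\beta^*|\boldsymbol X,\boldsymbol Y)$ can be written in the form $$\nabla L(\boldsymbol\beta^*|\boldsymbol X,\boldsymbol Y)=\frac1n\sum_{i=1}^n\boldsymbol W_i,$$ with $\boldsymbol W_i=(W_{i1},\ldots,W_{ip})'=f(\boldsymbol x_i,y_i)\in\mathbb{R}^p$, $i\in[n]$, being independent random vectors. Assume that $\mathbb{E}W_{ij}=0$ for each $i\in[n]$, $j\in[p]$, that $\frac1n\sum_{i=1}^n\mathbb{E}W_{ij}^2=\theta^2<\infty$ for each $j\in[p]$, and that $\sup_{i\in[n],j\in[p]}\mathbb{E}e^{t_1|W_{ij}|}<\infty$ for some $0<t_1<\infty$. Let $c>1$, $\alpha\in(0,1)$ and $$\widehat\lambda_1=\frac{c\,\theta}{\sqrt n}\,\Phi^{-1}\Big(1-\frac{\alpha}{2p}\Big).$$ Then $$\mathbb{P}\left(c\,\|\nabla L(\boldsymbol\beta^*|\boldsymbol X,\boldsymbol Y)\|_\infty\le\widehat\lambda_1\right)\ \ge\ 1-\alpha\left(1+O\Big(\frac{(\log p)^{5/2}}{\sqrt n}\Big)\right).$$ Furthermore, when $n,p\to\infty$ obeying $p\le e^{o(n^{1/5})}$, $$\mathbb{P}\left(c\,\|\nabla L(\boldsymbol\beta^*|\boldsymbol X,\boldsymbol Y)\|_\infty\le\widehat\lambda_1\right)\ \ge\ 1-\alpha(1+o(1)).$$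
   Context: Setting (generalized linear model). $(\boldsymbol x_1,y_1),\ldots,(\boldsymbol x_n,y_n)$ are independent pairs of observed data, realizations of random vectors $(\boldsymbol X_i,Y_i)$ with covariates in $\mathbb{R}^p$ and responses in $\mathbb{R}$, satisfying $Y_i|\boldsymbol X_i=\boldsymbol x_i\sim F$ with $g(\mathbb{E}(Y_i|\boldsymbol X_i=\boldsymbol x_i))=\boldsymbol x_i'\boldsymbol\beta^*$, where $F$ is a distribution in the exponential family, $g$ a real-valued link function and $\boldsymbol\beta^*\in\mathbb{R}^p$ an unknown parameter vector. The covariates $\boldsymbol x_i=(x_{i1},\ldots,x_{ip})'$ are normalized so that $\frac1n\sum_i x_{ij}=0$ and $\frac1n\sum_i x_{ij}^2=1$ for all $j\in[p]$. $\boldsymbol X=(\boldsymbol x_1,\ldots,\boldsymbol x_n)'\in\mathbb{R}^{n\times p}$, $\boldsymbol Y=(y_1,\ldots,y_n)'\in\mathbb{R}^n$. $L(\boldsymbol\beta|\boldsymbol X,\boldsymbol Y)$ is a function convex in $\boldsymbol\beta\in\mathbb{R}^p$ (the loss in the problem of minimizing $L(\boldsymbol\beta|\boldsymbol X,\boldsymbol Y)+\lambda\|\boldsymbol\beta\|_1$ over $\boldsymbol\beta$), and $\nabla$ is the gradient in $\boldsymbol\beta$. $f$ is a function determined by the model. Notation. $[n]=\{1,\ldots,n\}$; $A'$ is the transpose of $A$; $\|\boldsymbol v\|_\infty=\max_j|v_j|$; $\Phi$ is the standard normal cumulative distribution function and $\Phi^{-1}$ its inverse. $b_n=O(a_n)$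 means $b_n\le K a_n$ for a positive constant $K$; $b_n=o(a_n)$ means $b_n/a_n\to0$ as $n\to\infty$. In the asymptotics, $\theta$, $t_1$, $c$, $\alpha$ and the bound on the exponential moments are fixed, not depending on $n,p$.
   Formalization: The first bound is stated for p ≥ 2 only: at p = 1 we have log p = 0, so it would claim probability at least 1 − α for every n, which is false (logistic regression, n = 2, x = (1, −1), β* = 0, α = 0.4 gives 1/2); θ is taken to be nonnegative. *)

(* Defs.v *)
From HB Require Import structures.
From mathcomp Require Import all_boot all_order all_algebra.
From mathcomp Require Import all_classical all_reals all_analysis.

Set Implicit Arguments.
Unset Strict Implicit.
Unset Printing Implicit Defensive.

Import Order.TTheory GRing.Theory Num.Theory.
Import numFieldNormedType.Exports.

Local Open Scope classical_set_scope.
Local Open Scope ring_scope.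

(* Borel sigma-algebra on real matrices, so that random vectors in R^p are
   library random variables with values in 'rV[R]_p. *)
HB.instance Definition _ (R : realType) (m n : nat) :=
  @isMeasurable.Build (sigma_display (@open 'M[R]_(m, n))) 'M[R]_(m, n)
    <<s (@open 'M[R]_(m, n)) >>
    (@sigma_algebra0 _ setT _) (@sigma_algebraC _ _)
    (@sigma_algebra_bigcup _ setT _).

Definition dotrv (R : pzSemiRingType) (p : nat) (u v : 'rV[R]_p) : R :=
  \sum_(j < p) u 0 j * v 0 j.

Definition gradient (R : realType) (p : nat) (h : 'rV[R]_p -> R)
    (b : 'rV[R]_p) : 'rV[R]_p :=
  \row_(j < p) 'D_(delta_mx 0 j) (h : 'rV[R]_p -> R^o) b.

Definition Phi (R : realType) (x : R) : R :=
  fine (normal_prob 0 1 `]-oo, x]%classic).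

Definition Phi_inv (R : realType) : R -> R :=
  'pinv_(fun=> 0) [set: R] (@Phi R).

Definition mutually_independent d (Omega : measurableType d) (R : realType)
    (P : probability Omega R) (I : finType) d' (T : measurableType d')
    (Z : I -> Omega -> T) : Prop :=
  forall (J : {set I}) (B : I -> set T), (forall i, measurable (B i)) ->
    P (\bigcap_(i in [set` J]) (Z i @^-1` B i)) =
    (\prod_(i in J) P (Z i @^-1` B i))%E.

(* kappa is a regular version of the conditional law of Y given X. *)
Definition conditional_law d (Omega : measurableType d) (R : realType)
    (P : probability Omega R) d1 (T1 : measurableType d1)
    d2 (T2 : measurableType d2) (X : Omega -> T1) (Y : Omega -> T2)
    (kappa : R.-pker T1 ~> T2) : Prop :=
  forall (A : set T1) (B : set T2), measurable A -> measurable B ->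
    P (X @^-1` A `&` Y @^-1` B) =
    (\int[P]_(w in X @^-1` A) kappa (X w) B)%E.

(* A k-parameter exponential family: the laws with density
   h(y) exp(<eta, T(y)> - A) with respect to mu.  The normalising constant A
   is determined by eta.  A fixed dispersion parameter is absorbed in T, h. *)
Record exponential_family (R : realType) := ExponentialFamily {
  ef_dim : nat ;
  ef_base : {sigma_finite_measure set R -> \bar R} ;
  ef_carrier : {mfun R >-> R} ;
  ef_carrier_ge0 : forall y, 0 <= ef_carrier y ;
  ef_stat : {mfun R >-> 'rV[R]_ef_dim} }.

Definition in_exponential_family (R : realType) (E : exponential_family R)
    (F : set R -> \bar R) : Prop :=
  exists (eta : 'rV[R]_(ef_dim E)) (A : R), forall B : set R, measurable B ->
    F B = (\int[ef_base E]_(y in B)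
             (ef_carrier E y * expR (dotrv eta (ef_stat E y) - A))%:E)%E.

(* Centred and scaled design, each row being one covariate vector. *)
Definition normalized_design (R : realType) (n p : nat)
    (X : 'M[R]_(n, p)) : Prop :=
  forall j, n%:R^-1 * \sum_(i < n) X i j = 0 /\
            n%:R^-1 * \sum_(i < n) X i j ^+ 2 = 1.

(* Since the pairs are independent, exact normalization makes the covariates
   almost surely constant: this is the fixed design, or equivalently the model
   conditioned on X_i = x_i for all i. *)
Record glm (R : realType) (n p : nat) := Glm {
  glm_disp : measure_display ;
  glm_space : measurableType glm_disp ;
  glm_prob : probability glm_space R ;
  glm_x : 'I_n -> {RV glm_prob >-> 'rV[R]_p} ;
  glm_y : 'I_n -> {RV glm_prob >-> R} ;
  glm_beta : 'rV[R]_p ;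
  glm_link : R -> R ;
  glm_family : exponential_family R ;
  glm_law : 'I_n -> R.-pker 'rV[R]_p ~> R ;
  glm_loss : 'M[R]_(n, p) -> 'cV[R]_n -> 'rV[R]_p -> R ;
  glm_design := fun w : glm_space => \matrix_(i < n, j < p) glm_x i w 0 j ;
  glm_response := fun w : glm_space => \col_(i < n) glm_y i w ;
  glm_indep : mutually_independent glm_prob
    (fun i w => (glm_x i w, glm_y i w)) ;
  glm_conditional : forall i,
    conditional_law glm_prob (glm_x i) (glm_y i) (glm_law i) ;
  glm_in_family : forall i, {ae glm_prob, forall w,
    in_exponential_family glm_family (glm_law i (glm_x i w))} ;
  glm_mean : forall i, {ae glm_prob, forall w,
    (glm_law i (glm_x i w)).-integrable [set: R] (fun y => y%:E) /\
    glm_link (\int[glm_law i (glm_x i w)]_y y)%R =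
      dotrv (glm_x i w) glm_beta} ;
  glm_normalized : {ae glm_prob, forall w,
    normalized_design (glm_design w)} ;
  glm_convex : forall w, convex_function [set: convex_lmodType 'rV[R]_p]
    (glm_loss (glm_design w) (glm_response w)) }.

Arguments glm_design {R n p} g w.
Arguments glm_response {R n p} g w.

Section score.
Variables (R : realType) (n p : nat) (G : glm R n p).

Definition observed_loss (w : glm_space G) : 'rV[R]_p -> R :=
  glm_loss G (glm_design G w) (glm_response G w).

Definition score (w : glm_space G) : 'rV[R]_p :=
  gradient (observed_loss w) (glm_beta G).

Definition score_term (f : 'rV[R]_p -> R -> 'rV[R]_p) (i : 'I_n)
    (w : glm_space G) : 'rV[R]_p :=
  f (glm_x G i w) (glm_y G i w).

(* M bounds the exponential moments sup_{i,j} E exp(t1 |W_ij|). *)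
Record score_assumptions (theta t1 M : R)
    (f : 'rV[R]_p -> R -> 'rV[R]_p) : Prop := ScoreAssumptions {
  score_differentiable : forall w,
    differentiable (observed_loss w : 'rV[R]_p -> R^o) (glm_beta G) ;
  score_mean_form : forall w,
    score w = n%:R^-1 *: \sum_(i < n) score_term f i w ;
  score_measurable : forall i, measurable_fun setT (score_term f i) ;
  score_indep : mutually_independent (glm_prob G) (score_term f) ;
  score_centered : forall i j,
    ('E_(glm_prob G)[fun w => score_term f i w 0%R j] = 0)%E ;
  score_variance : forall j,
    ((n%:R^-1)%:E *
     \sum_(i < n) 'E_(glm_prob G)[fun w => (score_term f i w 0 j ^+ 2)%R] =
     (theta ^+ 2)%:E)%E ;
  score_exp_moment : forall i j,
    ('E_(glm_prob G)[fun w => expR (t1 * `|score_term f i w 0 j|)%R]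
     <= M%:E)%E }.

(* The norm of 'rV[R]_p is the maximum norm. *)
Definition score_event (c lambda : R) : set (glm_space G) :=
  [set w | c * `|score w| <= lambda].

End score.

Arguments observed_loss {R n p} G w.
Arguments score {R n p} G w.
Arguments score_term {R n p} G f i w.
Arguments score_event {R n p} G c lambda.

Definition lambda1 (R : realType) (c theta alpha : R) (n p : nat) : R :=
  c * theta / Num.sqrt n%:R * Phi_inv (1 - alpha / (2 * p%:R)).

(* Main.v *)
From HB Require Import structures.
Require Import Defs.
From mathcomp Require Import all_boot all_order all_algebra.
From mathcomp Require Import all_classical all_reals all_analysis.
From mathcomp Require Import measurable_realfun ring lra.

Set Implicit Arguments.
Unset Strict Implicit.
Unset Printing Implicit Defensive.

Import Order.TTheory GRing.Theory Num.Theory.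
Import numFieldNormedType.Exports.

Local Open Scope classical_set_scope.
Local Open Scope ring_scope.

(* A union bound over the 2p one-sided events reduces the claim to Cramer's
   moderate deviation inequality for a sum S of n independent centred variables:
   with z = Phi^-1(1 - alpha / 2p) = O(sqrt (log p)),
     P(S > theta z sqrt n) <= (1 - Phi(z)) (1 + O((1 + z)^3 / sqrt n)).
   Under the law Q with density proportional to exp(h S), h = z / (theta sqrt n),
   the variable V = S / (theta sqrt n) - z is nearly standard normal, and
     P(S > theta z sqrt n) <= e^(-z^2/2 + o(1)) E_Q[e^(-z V) 1_(V > 0)],
   while a standard normal V gives e^(z^2/2) (1 - Phi(z)) for the expectation.
   So an error O((1 + z)^2 / sqrt n) in that normal approximation suffices, since
   e^(z^2/2) (1 - Phi(z)) is of order 1 / (1 + z) by the Mills ratio bounds. It is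
   obtained by Stein's method for a continuous majorant of e^(-z v) 1_(v > 0), with
   an exponential tail of scale 1 / sqrt n on v < 0. *)

(** * The Gaussian tail *)

(** The test function has slope of order [sqrt n] just left of 0, so a plain Lipschitz estimate in
    Stein's method would leave an error of order 1. But the steep part carries a factor
    exp(-|V|/delta), with delta = K / sqrt n, so what counts is the mass of V in windows of width
    delta. That mass is bounded by the same Stein argument applied to exp(-|v - a|/delta): its
    supremum over a reappears on the right with a factor 4 D^2 / K, which a large K absorbs. The
    exponential moment of order t1 is spent in three portions: a quarter for the tilt, a quarter for
    exponential weights in the Stein remainders, a half for powers up to 3. All constants are
    explicit in theta, t1, M (and alpha, for the quantile), so they do not depend on n, p or the
    model. The smallness conditions on z / sqrt n cost nothing: where they fail, the claimed lower
    bound on the probability is not positive. The case theta = 0 escapes the normalization of S and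
    is treated apart. *)

Section gauss.
Context {R : realType}.
Local Notation mu := (@lebesgue_measure R).
Local Notation phi := (normal_pdf (0 : R) 1).

Definition gauss_tail (x : R) : R := (\int[mu]_(t in `]x, +oo[) phi t)%R.

Lemma normal_pdf01E (x : R) : phi x = normal_peak 1 * expR (- (x ^+ 2 / 2)).
Proof.
rewrite normal_pdfE ?oner_neq0// /normal_fun subr0 expr1n mulNr.
by rewrite -mulr_natr mul1r.
Qed.

Lemma normal_peak1_gt0 : 0 < normal_peak (1 : R).
Proof. by rewrite normal_peak_gt0 ?oner_neq0. Qed.

Lemma normal_pdf01_gt0 (x : R) : 0 < phi x.
Proof. by rewrite normal_pdf01E mulr_gt0 ?normal_peak1_gt0 ?expR_gt0. Qed.

Lemma normal_pdf01N (x : R) : phi (- x) = phi x.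
Proof. by rewrite !normal_pdf01E sqrrN. Qed.

Lemma normal_peak1_le1 : normal_peak (1 : R) <= 1.
Proof.
rewrite /normal_peak expr1n mul1r invf_le1; last by rewrite sqrtr_gt0 mulrn_wgt0// pi_gt0.
rewrite -[leLHS]sqrtr1 ler_wsqrtr//.
by rewrite mulr2n; have := pi_ge2 R; set q := pi; lra.
Qed.

Lemma is_derive_normal_pdf01 (x : R) : is_derive x 1 phi (- x * phi x).
Proof.
have -> : (phi : R -> R) =
    (fun y => normal_peak 1 * expR (- (y ^+ 2 / 2)) : R).
  by apply/funext => y; rewrite normal_pdf01E.
apply: is_derive_eq; rewrite /GRing.scale/=; lra.
Qed.

Lemma continuous_normal_pdf01 : continuous phi.
Proof. by apply: continuous_normal_pdf; rewrite oner_neq0. Qed.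

Lemma measurable_EFin_funTS (f : R -> R) (A : set R) : measurable_fun setT f ->
  measurable_fun A (fun t : measurableTypeR R => (f t)%:E).
Proof. by move=> mf; apply: measurable_funTS; apply/measurable_EFinP. Qed.

Lemma integrable_normal_pdf01 (A : set R) : measurable A ->
  mu.-integrable A (EFin \o phi).
Proof.
move=> mA; apply: (@integrableS _ _ _ _ setT) => //.
exact: integrable_normal_pdf.
Qed.

Lemma gauss_tailE (x : R) :
  (gauss_tail x)%:E = (\int[mu]_(t in `]x, +oo[) (phi t)%:E)%E.
Proof.
rewrite /gauss_tail /Rintegral fineK//.
exact/integrable_fin_num/integrable_normal_pdf01.
Qed.

Lemma gauss_tail_ge0 x : 0 <= gauss_tail x.
Proof. by apply: Rintegral_ge0 => t _; rewrite normal_pdf_ge0. Qed.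

Lemma gauss_tail_cE (x : R) :
  (gauss_tail x)%:E = (\int[mu]_(t in `[x, +oo[) (phi t)%:E)%E.
Proof.
rewrite gauss_tailE integral_itv_obnd_cbnd//.
by apply: measurable_EFin_funTS; exact: measurable_normal_pdf.
Qed.

Lemma gauss_tail_lower (x : R) :
  (gauss_tail x)%:E = (\int[mu]_(t in `]-oo, (- x)%R]) (phi t)%:E)%E.
Proof.
rewrite gauss_tail_cE ge0_integration_by_substitutionNy.
- by apply: eq_integral => t _ /=; rewrite normal_pdf01N.
- by apply: continuous_subspaceT; exact: continuous_normal_pdf01.
- by move=> t _; rewrite normal_pdf_ge0.
Qed.

Lemma gauss_tailN (x : R) : gauss_tail (- x) = 1 - gauss_tail x.
Proof.
apply: EFin_inj; rewrite EFinB gauss_tail_lower opprK gauss_tailE.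
apply/eqP; rewrite eq_sym -(integral_normal_pdf 0 1) sube_eq//; last 2 first.
- exact/integrable_fin_num/integrable_normal_pdf01.
- by rewrite fin_num_adde_defr//; exact/integrable_fin_num/integrable_normal_pdf01.
rewrite -ge0_integral_setU//=.
- by rewrite -setCitvl setUv.
- by apply: measurable_EFin_funTS; exact: measurable_normal_pdf.
- by move=> t _; rewrite lee_fin normal_pdf_ge0.
- by rewrite -setCitvl; apply/disj_setPCl.
Qed.

Lemma Phi_gauss_tail (x : R) : Phi x = gauss_tail (- x).
Proof. by apply: EFin_inj; rewrite gauss_tail_lower opprK /Phi fineK// fin_num_measure. Qed.

Lemma gauss_tail_le1 x : gauss_tail x <= 1.
Proof. by have := gauss_tail_ge0 (- x); rewrite gauss_tailN; lra. Qed.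

Lemma gauss_tail0 : gauss_tail 0 = 1 / 2.
Proof. by have := gauss_tailN 0; rewrite oppr0; lra. Qed.

Lemma gauss_tail_nonincr : {homo gauss_tail : x y / x <= y >-> y <= x}.
Proof.
move=> x y xy; rewrite -lee_fin !gauss_tailE; apply: ge0_subset_integral => //=.
- by apply: measurable_EFin_funTS; exact: measurable_normal_pdf.
- by move=> t _; rewrite lee_fin normal_pdf_ge0.
- by apply: subset_itvr; rewrite bnd_simp.
Qed.

Lemma normal_pdf01_cvg0 : phi x @[x --> +oo] --> (0 : R).
Proof.
apply: (@squeeze_cvgr _ _ _ _ (fun=> 0) (fun x => expR 1 * expR (- x))).
- near=> x; rewrite normal_pdf_ge0 normal_pdf01E -expRD/=.
  rewrite -[leRHS]mul1r ler_pM ?expR_ge0 ?normal_peak1_le1//.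
    by rewrite ltW ?normal_peak1_gt0.
  by rewrite ler_expR; have := sqr_ge0 (x - 1); lra.
- exact: cvg_cst.
- rewrite -[X in _ --> X](mulr0 (expR 1)); apply: cvgM; first exact: cvg_cst.
  exact: cvgr_expR.
Unshelve. all: by end_near. Qed.

(** [- phi] is a primitive of [t * phi t], so the integral of the latter over [[x, +oo[] is exactly
    [phi x], and [x <= t] on that half-line. *)
Lemma mills_mul x : 0 <= x -> x * gauss_tail x <= phi x.
Proof.
move=> x0.
have H : (\int[mu]_(t in `[x, +oo[) (t * phi t)%:E = 0%:E - (- phi x)%:E)%E.
  apply: (@ge0_continuous_FTC2y R (fun t => t * phi t) (fun t => - phi t)).
  - by move=> t xt; rewrite mulr_ge0 ?normal_pdf_ge0// (le_trans x0).
  - apply: continuous_subspaceT => t.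
    by apply: cvgM; [exact: cvg_id|exact: continuous_normal_pdf01].
  - by rewrite -[X in _ --> X]oppr0; apply: cvgN; exact: normal_pdf01_cvg0.
  - move=> t _; have [? _] := is_derive_normal_pdf01 t; exact: derivableN.
  - apply: cvgN; apply: cvg_at_right_filter; exact: continuous_normal_pdf01.
  - move=> t _; rewrite derive1E; have [? d] := is_derive_normal_pdf01 t.
    by rewrite deriveN// d mulNr opprK.
rewrite -lee_fin (_ : (phi x)%:E = 0%:E - (- phi x)%:E)%E; last first.
  by rewrite -EFinB sub0r opprK.
rewrite -H EFinM gauss_tail_cE -ge0_integralZl//=; last 2 first.
- by apply: measurable_EFin_funTS; exact: measurable_normal_pdf.
- by move=> t _; rewrite lee_fin normal_pdf_ge0.
apply: ge0_le_integral => //=.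
- by move=> t _; rewrite -EFinM lee_fin mulr_ge0 ?normal_pdf_ge0.
- by apply: measurable_EFin_funTS; apply: measurable_funM => //; exact: measurable_normal_pdf.
- by apply: measurable_EFin_funTS; apply: measurable_funM => //; exact: measurable_normal_pdf.
- move=> t; rewrite in_itv/= andbT => xt; rewrite -EFinM lee_fin.
  by rewrite ler_wpM2r ?normal_pdf_ge0.
Qed.

(** For [1 <= x] this is the Mills bound. For [x < 1] the tail is at most 1, and the constant makes
    the right side equal to exp(1 - x^2/2), which is at least 1. *)
Lemma gauss_tail_le_pdf x : 0 <= x -> gauss_tail x <= expR 1 / normal_peak 1 * phi x.
Proof.
move=> x0; have p0 := normal_peak1_gt0; have ph := normal_pdf01_gt0 x.
have [x1|x1] := leP 1 x.
  apply: (@le_trans _ _ (phi x)).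
    apply: le_trans (mills_mul x0); rewrite -[leLHS]mul1r ler_wpM2r//.
    exact: gauss_tail_ge0.
  rewrite ler_peMl// ?normal_pdf_ge0// ler_pdivlMr// mul1r.
  by rewrite (le_trans normal_peak1_le1)// -expR0 ler_expR.
apply: le_trans (gauss_tail_le1 x) _.
rewrite normal_pdf01E mulrA divfK ?gt_eqF// -expRD -[leLHS]expR0 ler_expR.
nra.
Qed.

(* The interval [z, z + 1/(1+z)] has length 1/(1+z) and the density loses at
   most a factor exp(-3/2) on it. *)
Lemma normal_pdf_le_gauss_tail z : 0 <= z ->
  phi z <= expR (3 / 2) * (1 + z) * gauss_tail z.
Proof.
move=> z0; pose d := (1 + z)^-1.
have z1 : 0 < 1 + z by lra.
have d0 : 0 < d by rewrite invr_gt0.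
have d1 : d * (1 + z) = 1 by rewrite mulVf ?gt_eqF.
have phz : phi (z + d) * expR (3 / 2) >= phi z.
  rewrite !normal_pdf01E -[leRHS]mulrA -expRD ler_wpM2l ?(ltW normal_peak1_gt0)//.
  by rewrite ler_expR; nra.
suff H : phi (z + d) * d <= gauss_tail z.
  apply: le_trans phz _; rewrite mulrC -mulrA ler_wpM2l ?expR_ge0//.
  by rewrite -ler_pdivrMl// mulrC.
rewrite -lee_fin gauss_tailE.
apply: (@le_trans _ _ (\int[mu]_(t in `]z, (z + d)%R]) (phi t)%:E)%E).
  rewrite EFinM (_ : d%:E = mu `]z, (z + d)]%classic); last first.
    by rewrite lebesgue_measure_itv/= lte_fin ltrDl d0 -EFinB addrC addKr.
  rewrite -integral_cst//; apply: ge0_le_integral => //=.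
  - by move=> t _; rewrite lee_fin normal_pdf_ge0.
  - by apply: measurable_EFin_funTS; exact: measurable_normal_pdf.
  - move=> t; rewrite in_itv/= => /andP[zt td]; rewrite lee_fin.
    rewrite !normal_pdf01E ler_wpM2l ?(ltW normal_peak1_gt0)//.
    by rewrite ler_expR; nra.
apply: ge0_subset_integral => //=.
- by apply: measurable_EFin_funTS; exact: measurable_normal_pdf.
- by move=> t _; rewrite lee_fin normal_pdf_ge0.
- by apply: subset_itvl; rewrite bnd_simp.
Qed.

(** Completing the square, exp(-z t) phi(t) = exp(z^2/2) phi(z + t), and a translation by z gives
    the tail. This is the main term of the tilted expectation. *)
Lemma gauss_laplace z :
  (\int[mu]_(t in `[0%R, +oo[) (expR (- (z * t)) * phi t)%:E =
   (expR (z ^+ 2 / 2) * gauss_tail z)%:E)%E.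
Proof.
have D1 (t : R) : is_derive t 1 (fun t : R => z + t) 1.
  by apply: (is_derive_eq (is_deriveD (is_derive_cst z t 1) (is_derive_id t 1))); rewrite add0r.
have DE : (fun t : R => z + t)^`()%classic = cst 1.
  by apply/funext => t; rewrite derive1E; have [_ ->] := D1 t.
have /= H := @increasing_ge0_integration_by_substitutiony R (fun t => z + t) phi 0.
rewrite EFinM gauss_tail_cE; move: H; rewrite addr0 => ->; last 8 first.
- by move=> x y _ _ xy; rewrite ltrD2l.
- by rewrite DE => t _; exact: cvg_cst.
- by rewrite DE; exact: is_cvg_cst.
- by rewrite DE; exact: is_cvg_cst.
- split.
    by move=> t _; have [] := D1 t.
  apply: cvg_at_right_filter; apply: cvgD; [exact: cvg_cst|exact: cvg_id].
- exact: cvg_addrl.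
- by apply: continuous_subspaceT; exact: continuous_normal_pdf01.
- by move=> t _; rewrite normal_pdf_ge0.
rewrite -ge0_integralZl//=; last 2 first.
- apply: measurable_EFin_funTS.
  rewrite DE; apply: measurable_funM => //.
  apply: measurableT_comp; first exact: measurable_normal_pdf.
  exact: measurable_funD.
- by move=> t _; rewrite lee_fin fctE DE mulr1 normal_pdf_ge0.
apply: eq_integral => t _; rewrite fctE DE mulr1 -EFinM; congr EFin.
rewrite /= !normal_pdf01E mulrCA -expRD mulrCA -expRD; congr (_ * expR _).
lra.
Qed.

Lemma integral_expR_right (a d : R) : 0 < d ->
  (\int[mu]_(t in `[a, +oo[) (expR (- ((t - a) / d)))%:E = d%:E)%E.
Proof.
move=> d0.
have D (t : R) : is_derive t 1 (fun t : R => - d * expR (- ((t - a) / d))) (expR (- ((t - a) / d))).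
  apply: is_derive_eq; rewrite /GRing.scale/=; field; lra.
rewrite (@ge0_continuous_FTC2y R _ (fun t => - d * expR (- ((t - a) / d))) a 0).
- by rewrite subrr mul0r oppr0 expR0 mulr1 -EFinB sub0r opprK.
- by move=> t _; exact: expR_ge0.
- apply: continuous_subspaceT => t; apply/differentiable_continuous/derivable1_diffP.
  apply: ex_derive.
- rewrite -[X in _ --> X](mulr0 (- d)); apply: cvgM; first exact: cvg_cst.
  apply: (cvg_comp (fun t => (t - a) / d) (fun t : R => expR (- t))); last exact: cvgr_expR.
  apply/gt0_cvgMly; first by rewrite invr_gt0.
  exact: cvg_addrr.
- by move=> t _; have [] := D t.
- apply: cvg_at_right_filter; have [/derivable1_diffP da _] := D a.
  exact: (differentiable_continuous da).
- by move=> t _; rewrite derive1E; have [_ ->] := D t.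
Qed.

Lemma integral_expR_left (a d : R) : 0 < d ->
  (\int[mu]_(t in `]-oo, a]) (expR ((t - a) / d))%:E = d%:E)%E.
Proof.
move=> d0; rewrite -{1}(opprK a) ge0_integration_by_substitutionNy.
- rewrite -[RHS](integral_expR_right (- a) d0); apply: eq_integral => t _ /=.
  by congr (expR _)%:E; rewrite -mulNr; congr (_ / _); ring.
- apply: continuous_subspaceT => t; apply/differentiable_continuous/derivable1_diffP.
  apply: ex_derive.
- by move=> t _; exact: expR_ge0.
Qed.

Lemma measurable_expR_dist (a d : R) :
  measurable_fun setT (fun t : R => expR (- (`|t - a| / d))).
Proof.
apply: measurableT_comp => //; apply: measurableT_comp => //.
apply: measurable_funM => //; apply: measurableT_comp => //.
exact: measurable_funB.
Qed.

Lemma normal_pdf01_le1 t : phi t <= 1.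
Proof.
by rewrite (le_trans _ normal_peak1_le1)// normal_pdf_ub// oner_neq0.
Qed.

Lemma measurable_EFin_mul_pdf (k : R -> R) (A : set R) : measurable_fun setT k ->
  measurable_fun A (fun t : measurableTypeR R => (k t * phi t)%:E).
Proof.
move=> mk; apply: measurable_EFin_funTS; apply: measurable_funM => //.
exact: measurable_normal_pdf.
Qed.

Lemma integral_split0 (k : R -> R) a : measurable_fun setT k ->
  (forall t, 0 <= k t) ->
  (\int[mu]_t (k t * phi t)%:E = \int[mu]_(t in `]-oo, a]) (k t * phi t)%:E
     + \int[mu]_(t in `[a, +oo[) (k t * phi t)%:E)%E.
Proof.
move=> mk k0.
rewrite -[X in (_ + X)%E]integral_itv_obnd_cbnd; last exact: measurable_EFin_mul_pdf.
rewrite -ge0_integral_setU//=.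
- by rewrite -setCitvl setUv.
- exact: measurable_EFin_mul_pdf.
- by move=> t _; rewrite lee_fin mulr_ge0 ?normal_pdf_ge0.
- by rewrite -setCitvl; apply/disj_setPCl.
Qed.

(** Since [phi <= 1], an exponential tail of scale d has Gaussian mass at most its Lebesgue mass d.
    Smoothing an indicator at scale d thus costs at most d. *)
Lemma integral_pdf_left (k : R -> R) (a d : R) : 0 < d -> measurable_fun setT k ->
  (forall t, 0 <= k t) -> (forall t, t <= a -> k t <= expR ((t - a) / d)) ->
  (\int[mu]_(t in `]-oo, a]) (k t * phi t)%:E <= d%:E)%E.
Proof.
move=> d0 mk k0 kE; rewrite -(integral_expR_left a d0).
apply: ge0_le_integral => //=.
- by move=> t _; rewrite lee_fin mulr_ge0 ?normal_pdf_ge0.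
- exact: measurable_EFin_mul_pdf.
- apply: measurable_EFin_funTS; apply: measurableT_comp => //.
  by apply: measurable_funM => //; exact: measurable_funB.
- move=> t; rewrite in_itv/= => ta; rewrite lee_fin -[leRHS]mulr1.
  by rewrite ler_pM ?normal_pdf_ge0 ?normal_pdf01_le1 ?kE.
Qed.

Lemma integral_pdf_right (k : R -> R) (a d : R) : 0 < d -> measurable_fun setT k ->
  (forall t, 0 <= k t) -> (forall t, a <= t -> k t <= expR (- ((t - a) / d))) ->
  (\int[mu]_(t in `[a, +oo[) (k t * phi t)%:E <= d%:E)%E.
Proof.
move=> d0 mk k0 kE; rewrite -(integral_expR_right a d0).
apply: ge0_le_integral => //=.
- by move=> t _; rewrite lee_fin mulr_ge0 ?normal_pdf_ge0.
- exact: measurable_EFin_mul_pdf.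
- apply: measurable_EFin_funTS; apply: measurableT_comp => //.
  apply: measurableT_comp => //.
  by apply: measurable_funM => //; exact: measurable_funB.
- move=> t; rewrite in_itv/= andbT => ta; rewrite lee_fin -[leRHS]mulr1.
  by rewrite ler_pM ?normal_pdf_ge0 ?normal_pdf01_le1 ?kE.
Qed.

Definition gauss_mean (k : R -> R) : R := (\int[mu]_t (k t * phi t))%R.

Section bounded.
Variable k : R -> R.
Hypothesis ck : continuous k.
Hypothesis k01 : forall t, 0 <= k t <= 1.

Lemma integrable_bounded_pdf (A : set R) : measurable A ->
  mu.-integrable A (fun t => (k t * phi t)%:E).
Proof.
move=> mA; apply: (@le_integrable _ _ _ mu A mA _ (EFin \o phi)); last exact: integrable_normal_pdf01.
  by apply: measurable_EFin_mul_pdf; exact: continuous_measurable_fun.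
move=> t _; have /andP[k0 k1] := k01 t.
rewrite lee_fin normrM (ger0_norm k0) ler_piMl//.
Qed.

Lemma gauss_meanE :
  (gauss_mean k)%:E = (\int[mu]_t (k t * phi t)%:E)%E.
Proof.
rewrite /gauss_mean /Rintegral fineK//.
exact/integrable_fin_num/integrable_bounded_pdf.
Qed.

Lemma gauss_mean01 : 0 <= gauss_mean k <= 1.
Proof.
rewrite -!lee_fin gauss_meanE; apply/andP; split.
  apply: integral_ge0 => t _; have /andP[k0 _] := k01 t.
  by rewrite lee_fin mulr_ge0 ?normal_pdf_ge0.
rewrite -(integral_normal_pdf 0 1); apply: ge0_le_integral => //=.
- move=> t _; have /andP[k0 _] := k01 t.
  by rewrite lee_fin mulr_ge0 ?normal_pdf_ge0.
- by apply: measurable_EFin_mul_pdf; exact: continuous_measurable_fun.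
- by apply: measurable_EFin_funTS; exact: measurable_normal_pdf.
- move=> t _; have /andP[k0 k1] := k01 t.
  by rewrite lee_fin ler_piMl ?normal_pdf_ge0.
Qed.
End bounded.

Lemma gauss_mean_expR_dist (a d : R) : 0 < d ->
  gauss_mean (fun t => expR (- (`|t - a| / d))) <= d *+ 2.
Proof.
move=> d0; have mk := measurable_expR_dist a d.
have k0 t : 0 <= expR (- (`|t - a| / d)) by exact: expR_ge0.
have k01 t : 0 <= expR (- (`|t - a| / d)) <= 1.
  by rewrite k0/= -expR0 ler_expR oppr_le0 divr_ge0// ltW.
rewrite -lee_fin gauss_meanE//; last first.
  move=> t; apply: (cvg_comp _ expR); last exact: continuous_expR.
  apply: cvgN; apply: cvgM; last exact: cvg_cst.
  by apply: cvg_norm; apply: cvgB; [exact: cvg_id|exact: cvg_cst].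
rewrite (integral_split0 a mk k0) mulr2n EFinD leeD//.
- apply: integral_pdf_left => // t ta.
  by rewrite ler_expR -mulNr ler0_norm ?opprK// subr_le0.
- apply: integral_pdf_right => // t ta.
  by rewrite ler_expR ger0_norm// subr_ge0.
Qed.

(** Positive and negative parts sit in one exponent: continuity at 0 is automatic, and the function
    is a product of two one-sided exponentials, which is how its modulus is estimated. *)
Definition laplace_test (z d t : R) : R :=
  expR (- (z * Num.max t 0 + Num.max (- t) 0 / d)).

Lemma continuous_laplace_test z d : continuous (laplace_test z d).
Proof.
move=> t; apply: (cvg_comp _ expR); last exact: continuous_expR.
have cm (f : R -> R) : {for t, continuous f} -> {for t, continuous (fun t => Num.max (f t) 0)}.
  move=> cf; apply: (@continuous_max _ _ f (fun=> 0)) => //; exact: cvg_cst.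
apply: cvgN; apply: cvgD; apply: cvgM; try exact: cvg_cst.
- exact: (cm id).
- apply: (cm -%R); exact: cvgN.
Qed.

Lemma laplace_test_ge0 z d t : 0 <= t -> laplace_test z d t = expR (- (z * t)).
Proof.
move=> t0; rewrite /laplace_test (max_idPl t0) (max_idPr _) ?oppr_le0//.
by rewrite mul0r addr0.
Qed.

Lemma laplace_test_le0 z d t : t <= 0 -> laplace_test z d t = expR (t / d).
Proof.
move=> t0; rewrite /laplace_test (max_idPr t0) (max_idPl _) ?oppr_ge0//.
by rewrite mulr0 add0r mulNr opprK.
Qed.

Lemma laplace_test01 z d t : 0 <= z -> 0 < d -> 0 <= laplace_test z d t <= 1.
Proof.
move=> z0 d0; rewrite expR_ge0/= -expR0 ler_expR oppr_le0 addr_ge0//.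
  by rewrite mulr_ge0// le_max lexx orbT.
by rewrite divr_ge0 ?(ltW d0)// le_max lexx orbT.
Qed.

Lemma gauss_mean_laplace_test z d : 0 <= z -> 0 < d ->
  gauss_mean (laplace_test z d) <= expR (z ^+ 2 / 2) * gauss_tail z + d.
Proof.
move=> z0 d0; have k01 t := laplace_test01 t z0 d0.
have ck := @continuous_laplace_test z d.
have mk : measurable_fun setT (laplace_test z d) by exact: continuous_measurable_fun.
rewrite -lee_fin gauss_meanE// (integral_split0 0 mk) => [|t]; last first.
  exact: expR_ge0.
rewrite [leRHS]EFinD -(gauss_laplace z).
rewrite [leLHS]addeC; apply: leeD.
  rewrite le_eqVlt; apply/orP; left; apply/eqP; apply: eq_integral => t.
  by rewrite inE/= in_itv/= andbT => t0; rewrite laplace_test_ge0.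
apply: integral_pdf_left => // t; first exact: expR_ge0.
by move=> t0; rewrite laplace_test_le0// subr0.
Qed.

End gauss.


(** * Bounded solutions of Stein's equation *)

Section stein_equation.
Context {R : realType}.
Local Notation mu := (@lebesgue_measure R).
Local Notation phi := (normal_pdf (0 : R) 1).
Variable k : R -> R.
Hypothesis ck : continuous k.
Hypothesis k01 : forall t, 0 <= k t <= 1.

Let g (t : R) : R := (k t - gauss_mean k) * phi t.

Let g_le t : `|g t| <= phi t.
Proof.
rewrite /g normrM (ger0_norm (normal_pdf_ge0 _ _ _)) ler_piMl ?normal_pdf_ge0//.
have := k01 t; have := gauss_mean01 ck k01; rewrite ler_norml; lra.
Qed.

Let cg : continuous g.
Proof.
move=> t; apply: cvgM; last exact: continuous_normal_pdf01.
by apply: cvgB; [exact: ck|exact: cvg_cst].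
Qed.

Let ig (A : set R) : measurable A -> mu.-integrable A (EFin \o g).
Proof.
move=> mA; apply: (@le_integrable _ _ _ mu A mA _ (EFin \o phi)).
- by apply: measurable_EFin_funTS; exact: continuous_measurable_fun.
- by move=> t _; rewrite /= lee_fin (ger0_norm (normal_pdf_ge0 _ _ _)).
- exact: integrable_normal_pdf01.
Qed.

Let G (x : R) : R := (\int[mu]_(t in `]-oo, x]) g t)%R.

(** Centring [k] by its Gaussian mean gives [g] total integral 0, so [G] can be estimated from
    either end of the line, whichever has the smaller Gaussian tail. *)
Let GE x : G x = - (\int[mu]_(t in `]x, +oo[) g t)%R.
Proof.
apply/eqP; rewrite -addr_eq0; apply/eqP.
rewrite -Rintegral_setU//=; last 2 first.
- by apply: ig; apply: measurableU.
- by rewrite -setCitvl; apply/disj_setPCl.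
rewrite -setCitvl setUv /g.
rewrite (_ : (fun t => _) = fun t => k t * phi t - gauss_mean k * phi t); last first.
  by apply/funext => t; rewrite mulrBl.
have ip : mu.-integrable setT (EFin \o phi) by exact: integrable_normal_pdf01.
rewrite RintegralB//; last 2 first.
- exact: integrable_bounded_pdf.
- exact: (integrableZl _ _ ip).
rewrite RintegralZl// -/(gauss_mean k) [X in _ * X](_ : _ = 1) ?mulr1 ?subrr//.
by rewrite /Rintegral integral_normal_pdf.
Qed.

Let norm_G_right x : `|G x| <= gauss_tail x.
Proof.
rewrite GE normrN; apply: le_trans; first by apply: le_normr_Rintegral => //; exact: ig.
apply: le_Rintegral => //.
- exact: (integrable_norm (ig _)).
- exact: integrable_normal_pdf01.
Qed.

Let norm_G_left x : `|G x| <= gauss_tail (- x).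
Proof.
apply: le_trans; first by apply: le_normr_Rintegral => //; exact: ig.
apply: (@le_trans _ _ (\int[mu]_(t in `]-oo, x]) phi t)%R).
  apply: le_Rintegral => //.
  - exact: (integrable_norm (ig _)).
  - exact: integrable_normal_pdf01.
by rewrite le_eqVlt; apply/orP; left; apply/eqP; rewrite /Rintegral -[RHS]/(fine (_%:E)) gauss_tail_lower opprK.
Qed.

Definition stein_const : R := expR 1 / normal_peak 1 + 1.

Lemma stein_const_ge1 : 1 <= stein_const.
Proof. by rewrite /stein_const lerDr divr_ge0 ?expR_ge0// ltW ?normal_peak1_gt0. Qed.

Let norm_G x : `|G x| <= stein_const * phi x.
Proof.
apply: (@le_trans _ _ (expR 1 / normal_peak 1 * phi x)); last first.
  by rewrite ler_wpM2r ?normal_pdf_ge0// /stein_const lerDl.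
have [x0|x0] := leP 0 x.
  exact: le_trans (norm_G_right x) (gauss_tail_le_pdf x0).
apply: le_trans (norm_G_left x) _; rewrite -(normal_pdf01N x).
by apply: gauss_tail_le_pdf; rewrite oppr_ge0 ltW.
Qed.

Let norm_xG x : `|x * G x| <= phi x.
Proof.
rewrite normrM; have [x0|x0] := leP 0 x.
  rewrite ger0_norm//; apply: le_trans (mills_mul x0).
  by rewrite ler_wpM2l// norm_G_right.
have Nx0 : 0 <= - x by rewrite oppr_ge0 ltW.
rewrite ltr0_norm// -(normal_pdf01N x); apply: le_trans (mills_mul Nx0).
by rewrite ler_wpM2l// norm_G_left.
Qed.

Let dG (x : R) : is_derive x 1 G (g x).
Proof.
have xu : x < x + 1 by rewrite ltrDl.
have iu : mu.-integrable [set` `]-oo, x + 1]] (EFin \o g) by exact: ig.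
have [|dGx GxE] := continuous_FTC1 xu iu _ (@cg x); first by rewrite ltNyr.
by apply: DeriveDef; [exact: dGx|rewrite -derive1E; exact: GxE].
Qed.

(** The solution is [G / phi], with [G] the primitive of [(k - gauss_mean k) * phi] that vanishes at
    minus infinity. Both bounds are Mills ratios: the tail over [phi] bounds [f], and [x] times the
    tail over [phi] bounds [x * f x] by 1. The bound on the derivative is then read off the
    equation. *)
Lemma stein_solution : exists f : R -> R,
  [/\ forall x : R, is_derive x 1 f (x * f x + k x - gauss_mean k),
      forall x, `|f x| <= stein_const
    & forall x, `|x * f x + k x - gauss_mean k| <= stein_const + 1].
Proof.
have ph0 (x : R) := normal_pdf01_gt0 x.
have fb x : `|x * (G x / phi x)| <= 1.
  rewrite mulrA normrM normfV (gtr0_norm (ph0 _)) ler_pdivrMr// mul1r.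
  exact: norm_xG.
exists (fun x => G x / phi x); split.
- move=> x.
  have dp := is_derive_normal_pdf01 x.
  have dV : is_derive x 1 (fun x => (phi x)^-1) (- (phi x) ^- 2 * (- x * phi x)).
    exact: (is_deriveV (lt0r_neq0 (ph0 x))).
  apply: (is_derive_eq (is_deriveM (dG x) dV)).
  by rewrite /GRing.scale/= /g; have := ph0 x; set p := phi x => p0; field; lra.
- move=> x; rewrite normrM normfV (gtr0_norm (ph0 _)) ler_pdivrMr//.
- move=> x; have := fb x; have := k01 x; have := gauss_mean01 ck k01.
  have := stein_const_ge1; rewrite !ler_norml; lra.
Qed.

End stein_equation.

(** * Independence and change of measure *)

Section independence.
Import HBNNSimple.
Context d (T : measurableType d) (R : realType) (P : probability T R).

Definition independent2 (X Y : T -> R) : Prop :=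
  forall A B : set R, measurable A -> measurable B ->
    P (X @^-1` A `&` Y @^-1` B) = (P (X @^-1` A) * P (Y @^-1` B))%E.

Definition mfun_of (dT : measure_display) (T' : measurableType dT) (X : T -> T')
    (mX : measurable_fun setT X) : {mfun T >-> T'} :=
  HB.pack X (isMeasurableFun.Build _ _ _ _ X mX).

(** The joint law agrees with the product of the marginals on rectangles, and a product measure is
    determined by these. *)
Lemma independent2_joint (X Y : T -> R) (mX : measurable_fun setT X)
    (mY : measurable_fun setT Y) : independent2 X Y ->
  forall D : set (R * R), measurable D ->
    P ((fun w => (X w, Y w)) @^-1` D) =
    (distribution P (mfun_of mX) \x distribution P (mfun_of mY))%E D.
Proof.
move=> XY D mD.
have mZ : measurable_fun setT (fun w => (X w, Y w)) by exact: measurable_fun_pair.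
by rewrite (product_measure_unique (m' := distribution P (mfun_of mZ))).
Qed.

(* Both sides are finite measures in D, with the same values on rectangles. *)
Lemma independent2_event (X Y : T -> R) (mX : measurable_fun setT X)
    (mY : measurable_fun setT Y) (C : set T) (mC : measurable C) :
  independent2 X Y ->
  (forall A B : set R, measurable A -> measurable B ->
    P (X @^-1` A `&` Y @^-1` B `&` C) =
    (P (X @^-1` A) * P (Y @^-1` B) * P C)%E) ->
  forall D : set (R * R), measurable D ->
    P ((fun w => (X w, Y w)) @^-1` D `&` C) =
    (P ((fun w => (X w, Y w)) @^-1` D) * P C)%E.
Proof.
move=> XY XYC D mD.
have mZ : measurable_fun setT (fun w => (X w, Y w)) by exact: measurable_fun_pair.
have PC0 : 0 <= fine (P C) by rewrite fine_ge0.
have PCE : (fine (P C))%:E = P C by rewrite fineK// fin_num_measure.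
pose m2 := mscale (NngNum PC0) (distribution P (mfun_of mY)).
have m2E B : m2 B = (P (Y @^-1` B) * P C)%E by rewrite /m2 /mscale/= PCE muleC.
have E2 D' : mscale (NngNum PC0) (distribution P (mfun_of mZ)) D' =
    (P ((fun w => (X w, Y w)) @^-1` D') * P C)%E.
  by rewrite /mscale/= PCE muleC.
have H1 := @product_measure_unique _ _ _ _ R (distribution P (mfun_of mX)) m2
  (pushforward (mrestr P mC) (mfun_of mZ)).
have H2 := @product_measure_unique _ _ _ _ R (distribution P (mfun_of mX)) m2
  (mscale (NngNum PC0) (distribution P (mfun_of mZ))).
transitivity (pushforward (mrestr P mC) (mfun_of mZ) D); first by [].
rewrite -H1//; last first.
  move=> A B mA mB; apply: (etrans (XYC A B mA mB)).
  by rewrite -muleA; congr (_ * _)%E; exact: (esym (m2E B)).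
rewrite H2//; last first.
  move=> A B mA mB.
  transitivity (P (X @^-1` A `&` Y @^-1` B) * P C)%E; first exact: E2.
  by rewrite XY// -muleA; congr (_ * _)%E; exact: (esym (m2E B)).
exact: E2.
Qed.

(** Everything is transported to the plane, where the joint law is a product measure: Tonelli gives
    the integrability of the product, Fubini its value. *)
Lemma independent2_Rintegral (X Y : T -> R) (a b : R -> R) :
  measurable_fun setT X -> measurable_fun setT Y -> independent2 X Y ->
  measurable_fun setT a -> measurable_fun setT b ->
  P.-integrable setT (EFin \o (a \o X)) -> P.-integrable setT (EFin \o (b \o Y)) ->
  P.-integrable setT (EFin \o (fun w => a (X w) * b (Y w))) /\
  (\int[P]_w (a (X w) * b (Y w)) = (\int[P]_w a (X w)) * (\int[P]_w b (Y w)))%R.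
Proof.
move=> mX mY XY ma mb iX iY.
have mZ : measurable_fun setT (fun w => (X w, Y w)) by exact: measurable_fun_pair.
pose X' := mfun_of mX; pose Y' := mfun_of mY; pose Z' := mfun_of mZ.
pose F (z : R * R) : \bar R := (a z.1 * b z.2)%:E.
have mF : measurable_fun setT F.
  apply/measurable_EFinP; apply: measurable_funM; apply: measurableT_comp => //.
have ZE : forall D, measurable D -> 
   (distribution P X' \x distribution P Y')%E D = distribution P Z' D.
  by move=> D mD; rewrite -independent2_joint.
have iaX : (distribution P X').-integrable setT (EFin \o a).
  apply: integrable_pushforward => //; exact/measurable_EFinP.
have ibY : (distribution P Y').-integrable setT (EFin \o b).
  apply: integrable_pushforward => //; exact/measurable_EFinP.
have iF : (distribution P X' \x distribution P Y')%E.-integrable setT F.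
  apply/integrable12ltyP => //.
  rewrite [ltLHS](_ : _ = \int[distribution P X']_x (`|(a x)%:E| * \int[distribution P Y']_y `|(b y)%:E|))%E.
    rewrite ge0_integralZr//; first last.
    - by apply: integral_ge0 => *; exact: abse_ge0.
    - by apply: measurableT_comp => //; exact/measurable_EFinP.
    apply: lte_mul_pinfty => //.
    - by apply: integral_ge0 => *; exact: abse_ge0.
    - by apply: integrable_fin_num => //; exact: (integrable_abse iaX).
    - exact: (integrableP _ _ _ ibY).2.
  apply: eq_integral => x _; rewrite -ge0_integralZl//.
  - by apply: eq_integral => y _; rewrite -abseM.
  - by apply: measurableT_comp => //; exact/measurable_EFinP.
have iFZ : P.-integrable setT (EFin \o (fun w => a (X w) * b (Y w))).
  apply/integrableP; split.
    by apply/measurable_EFinP/measurable_funM; apply: measurableT_comp.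
  have /integrableP[_] := iF.
  rewrite (eq_measure_integral (distribution P Z')) => [|D mD _]; last exact: ZE.
  by rewrite ge0_integral_distribution//; exact: measurableT_comp.
split=> //.
have EF : (\int[distribution P X' \x distribution P Y']_z F z = \int[distribution P Z']_z F z)%E.
  by apply: eq_measure_integral => D mD _; exact: ZE.
rewrite /Rintegral.
rewrite -(_ : (\int[distribution P Z']_z F z)%E = \int[P]_w (a (X w) * b (Y w))%:E)%E; last first.
  by rewrite integral_distribution.
rewrite -EF.
rewrite -integral12_prod_meas1//.
transitivity (fine (\int[distribution P X']_x ((a x)%:E * \int[distribution P Y']_y (b y)%:E)))%E.
  congr fine; apply: eq_integral => x _; rewrite -integralZl//.
rewrite (_ : (\int[P]_w (b (Y w))%:E)%E = \int[distribution P Y']_y (b y)%:E)%E; last first.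
  by rewrite integral_distribution//; exact/measurable_EFinP.
rewrite (_ : (\int[P]_w (a (X w))%:E)%E = \int[distribution P X']_y (a y)%:E)%E; last first.
  by rewrite integral_distribution//; exact/measurable_EFinP.
have [r rE] : exists r : R, (\int[distribution P Y']_y (b y)%:E)%E = r%:E.
  by exists (fine (\int[distribution P Y']_y (b y)%:E)%E); rewrite fineK//; exact: (integrable_fin_num measurableT ibY).
rewrite rE integralZr// fineM//; exact: integrable_fin_num.
Qed.

(** The formula is checked on simple functions and passes to the limit by monotone convergence,
    hence the restriction to nonnegative [f]; [density_Ex] extends it to signed functions. *)
Lemma density_probability (rho : T -> R) : measurable_fun setT rho ->
  (forall w, 0 <= rho w) -> (\int[P]_w (rho w)%:E = 1)%E ->
  exists Q : probability T R, forall f : T -> \bar R, measurable_fun setT f ->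
    (forall w, 0 <= f w)%E -> (\int[Q]_w f w = \int[P]_w (f w * (rho w)%:E))%E.
Proof.
move=> mrho rho0 rho1.
pose q (A : set T) := (\int[P]_(w in A) (rho w)%:E)%E.
have q0 : q set0 = 0%E by rewrite /q integral_set0.
have qge0 A : (0 <= q A)%E.
  by apply: integral_ge0 => w _; rewrite lee_fin.
have irho : P.-integrable setT (fun w => (rho w)%:E).
  apply/integrableP; split; first exact/measurable_EFinP.
  under eq_integral do rewrite gee0_abs ?lee_fin//.
  by rewrite rho1 ltry.
have qsa : semi_sigma_additive q.
  move=> /= A mA tA mUA.
  rewrite /q/= integral_bigcup//=; last first.
    by apply: (integrableS _ _ (subsetT _)).
  apply: is_cvg_ereal_nneg_natsum_cond => n _ _.
  by apply: integral_ge0 => /= x ?; rewrite lee_fin.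
pose Q0 : {measure set T -> \bar R} := HB.pack q (isMeasure.Build _ _ _ q q0 qge0 qsa).
pose Q : probability T R := HB.pack (Measure.sort Q0) (Measure_isProbability.Build _ _ _ Q0 rho1).
exists Q => f mf f0.
have QE A : measurable A -> Q A = (\int[P]_(w in A) (rho w)%:E)%E by [].
clearbody Q; clear Q0 qsa qge0 q0 q.
pose h := nnsfun_approx measurableT mf.
have -> : (\int[Q]_x f x =
    lim (\int[Q]_x (EFin \o h n) x @[n --> \oo]))%E.
  have fE x : setT x -> f x = lim ((EFin \o h n) x @[n --> \oo]).
    by move=> Ex; apply/esym/cvg_lim => //; exact: cvg_nnsfun_approx.
  under eq_integral => x /[!inE] /fE -> //.
  apply: monotone_convergence => //.
  - by move=> n; apply/measurable_EFinP.
  - by move=> n x Ex //=; rewrite lee_fin.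
  - by move=> x Ex a b ab; rewrite lee_fin; exact/lefP/nd_nnsfun_approx.
have mrhoE : measurable_fun setT (EFin \o rho) by exact/measurable_EFinP.
have -> : (\int[P]_x (f x * (rho x)%:E) =
    lim (\int[P]_x ((EFin \o h n) \* (EFin \o rho)) x @[n --> \oo]))%E.
  have fg x : setT x -> (f x * (rho x)%:E)%E = lim (((EFin \o h n) \* (EFin \o rho))%E x @[n --> \oo]).
    move=> Ex; apply/esym/cvg_lim => //; apply: cvgeZr => //.
    exact: cvg_nnsfun_approx.
  under eq_integral => x /[!inE] /fg -> //.
  apply: monotone_convergence => [//| | |].
  - move=> n; apply/emeasurable_funM => //.
    exact/measurable_EFinP.
  - by move=> n x Ex /=; rewrite mule_ge0 ?lee_fin.
  - by move=> x Ex a b ab/=; rewrite lee_wpmul2r ?lee_fin//; exact/lefP/nd_nnsfun_approx.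
suff suf n : (\int[P]_x ((EFin \o h n) x * (EFin \o rho) x) =
    \int[Q]_x (EFin \o h n) x)%E.
  by under [in RHS]eq_fun do rewrite suf.
transitivity (\int[Q]_x
   (\sum_(y \in range (h n)) (y * \1_(h n @^-1` [set y]) x)%:E))%E; last first.
  by apply: eq_integral => t tE; rewrite /= fimfunE -fsumEFin.
have indich m r : measurable_fun setT (fun x => (r * \1_(h m @^-1` [set r]) x)%:E).
  by apply: (measurable_comp measurableT) => //; exact: measurable_funM.
rewrite ge0_integral_fsum//; last by move=> m y Ey; exact: nnfun_muleindic_ge0.
transitivity (\int[P]_x (\sum_(y \in range (h n))
    (y * \1_(h n @^-1` [set y]) x)%:E * (rho x)%:E))%E.
  under [RHS]eq_integral => x xE.
    rewrite -ge0_mule_fsuml => [|y]; last exact: nnfun_muleindic_ge0.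
    rewrite fsumEFin // -(fimfunE _ x); over.
  by [].
rewrite ge0_integral_fsum//; last 2 first.
  - by move=> y; apply: emeasurable_funM.
  - by move=> m y Ey; rewrite mule_ge0 ?nnfun_muleindic_ge0 ?lee_fin.
apply: eq_fsbigr => r rhn.
under [RHS]eq_integral do rewrite EFinM.
rewrite integralZl_indic_nnsfun => //.
under eq_integral do rewrite EFinM -muleA.
rewrite ge0_integralZl//.
- under eq_integral do rewrite muleC.
  rewrite (eq_integral ((EFin \o rho) \_ (h n @^-1` [set r]))); last first.
    by move=> x xE; rewrite epatch_indic.
  congr (_ * _)%E; rewrite -integral_mkcondr setTI.
  by transitivity (Q (h n @^-1` [set r])); [rewrite QE|rewrite integral_indic// setIT].
- by apply: emeasurable_funM => //; exact/measurable_EFinP.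
- by move=> t Et; rewrite mule_ge0 ?lee_fin.
- by move: rhn; rewrite inE => -[t _ <-]; rewrite lee_fin.
Qed.

Section mutual.
Variables (n : nat) (X : 'I_n -> T -> R).
Hypothesis mX : forall i, measurable_fun setT (X i).
Hypothesis indX : mutually_independent P X.

(** Induction on [s]. The head [i] is first moved into the intersection, as one more constraint
    added to [J]; the induction hypothesis then makes the remaining sum, [X i] and the event over
    [J] jointly independent on rectangles. [independent2_event] extends this from rectangles to the
    planar set where the two coordinates add up to an element of [A]. *)
Lemma independent_sum_event (s : seq 'I_n) (J : {set 'I_n}) (B : 'I_n -> set R)
    (A : set R) : uniq s -> (forall i, i \in s -> i \notin J) -> (forall i, measurable (B i)) ->
    measurable A ->
  P ((fun w => \sum_(i <- s) X i w) @^-1` A `&`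
     \bigcap_(i in [set` J]) (X i @^-1` B i)) =
  (P ((fun w => (\sum_(i <- s) X i w)%R) @^-1` A) *
   P (\bigcap_(i in [set` J]) (X i @^-1` B i)))%E.
Proof.
elim: s J B A => [|i s IH] J B A.
  move=> _ _ mB mA.
  have [A0|A0] := pselect (A 0).
    have -> : (fun w : T => \sum_(i <- [::]) X i w) @^-1` A = setT.
      by apply/seteqP; split => // w _ /=; rewrite big_nil.
    by rewrite setTI probability_setT mul1e.
  have -> : (fun w : T => \sum_(i <- [::]) X i w) @^-1` A = set0.
    by apply/seteqP; split => // w /=; rewrite big_nil.
  by rewrite set0I measure0 mul0e.
rewrite /= => /andP[i_s us] isJ mB mA.
have iJ : i \notin J by rewrite isJ// mem_head.
have sJ j : j \in s -> j \notin J by move=> js; rewrite isJ// inE js orbT.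
set C := \bigcap_(i in [set` J]) _.
have mXB j D : measurable D -> measurable (X j @^-1` D).
  by move=> mD; rewrite -[X in measurable X]setTI; exact: mX.
have bigcapU1 (Bi : set R) :
    \bigcap_(j in [set` i |: J]) (X j @^-1` (if j == i then Bi else B j)) =
    X i @^-1` Bi `&` C.
  apply/seteqP; split => w.
    move=> H; split.
      by have := H i; rewrite /= !inE eqxx/=; exact.
    move=> j /= jJ; have := H j; rewrite /= !inE jJ orbT.
    have -> : (j == i) = false by apply: contraNF iJ => /eqP <-.
    exact.
  move=> [Hi HC] j /=; rewrite !inE; have [->|ji] := eqVneq j i; first by [].
  by move=> jJ; exact: HC.
have mC : measurable C by apply: fin_bigcap_measurable => // j _; exact: mXB.
have sJ' j : j \in s -> j \notin i |: J.
  move=> js; rewrite !inE negb_or sJ// andbT.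
  by apply: contraNneq i_s => <-.
have mS : measurable_fun setT (fun w => \sum_(i <- s) X i w) by exact: measurable_sum.
have mBi (Bi : set R) : measurable Bi -> forall j, measurable (if j == i then Bi else B j).
  by move=> mBi j; case: ifP.
have PiC Bi : measurable Bi -> P (X i @^-1` Bi `&` C) = (P (X i @^-1` Bi) * P C)%E.
  move=> mBi'; rewrite -bigcapU1 indX//; last exact: mBi.
  rewrite big_setU1//= eqxx; congr (_ * _)%E.
  rewrite indX//; apply: eq_bigr => j jJ.
  by have -> : (j == i) = false by apply: contraNF iJ => /eqP <-.
have IHi A' Bi : measurable A' -> measurable Bi ->
    P ((fun w => \sum_(i <- s) X i w) @^-1` A' `&` X i @^-1` Bi `&` C) =
    (P ((fun w => (\sum_(i <- s) X i w)%R) @^-1` A') * P (X i @^-1` Bi) * P C)%E.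
  by move=> mA' mBi'; rewrite -setIA -bigcapU1 IH//; [rewrite bigcapU1 PiC// muleA|exact: mBi].
have ind : independent2 (fun w => \sum_(i <- s) X i w) (X i).
  move=> A' Bi mA' mBi'.
  have := IH [set i]%SET (fun=> Bi) A' us; rewrite (_ : [set` [set i]%SET] = [set i]); last first.
    by apply/seteqP; split => j /=; rewrite inE => /eqP.
  rewrite !bigcap_set1; apply => //.
  by move=> j js; rewrite inE; apply: contraNneq i_s => <-.
have mD : measurable [set z : R * R | A (z.1 + z.2)].
  have mp : measurable_fun setT (fun z : R * R => z.1 + z.2).
    by apply: measurable_funD; [exact: measurable_fst|exact: measurable_snd].
  by rewrite -[X in measurable X]setTI; exact: (mp).
have := independent2_event mS (mX i) mC ind IHi mD.
rewrite (_ : (fun w => _) @^-1` _ = (fun w => \sum_(i <- i :: s) X i w) @^-1` A)//.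
by apply/seteqP; split => w /=; rewrite big_cons addrC.
Qed.

Lemma independent2_leave_one_out (i : 'I_n) :
  independent2 (X i) (fun w => \sum_(j < n) X j w - X i w).
Proof.
move=> A B mA mB.
have H := @independent_sum_event [seq j <- enum 'I_n | j != i] [set i]%SET (fun=> A) B.
have SE : (fun w => \sum_(j < n) X j w - X i w) =
    (fun w => \sum_(j <- [seq j <- enum 'I_n | j != i]) X j w).
  apply/funext => w; rewrite big_filter big_enum_cond/= (bigD1 i)//=.
  by rewrite addrAC subrr add0r.
rewrite SE setIC muleC.
move: H; rewrite (_ : [set` [set i]%SET] = [set i]); last first.
  by apply/seteqP; split => j /=; rewrite inE => /eqP.
rewrite !bigcap_set1; apply => //.
- by rewrite filter_uniq// enum_uniq.
- by move=> j; rewrite mem_filter inE => /andP[].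
Qed.

(** The conditions on [a] are those of an exponential x -> exp(h x): this is the factorization of
    the moment generating function of a sum, with integrability carried through the induction. *)
Lemma independent_prod_Rintegral (a : R -> R) : measurable_fun setT a ->
  (forall x y, a (x + y) = a x * a y) -> a 0 = 1 ->
  (forall i, P.-integrable setT (EFin \o (a \o X i))) ->
  forall s : seq 'I_n, uniq s ->
  P.-integrable setT (EFin \o (fun w => a (\sum_(i <- s) X i w))) /\
  (\int[P]_w a (\sum_(i <- s) X i w) = \prod_(i <- s) \int[P]_w a (X i w))%R.
Proof.
move=> ma aD a0 iX; elim => [_|i s IH /= /andP[i_s us]].
  rewrite big_nil; split.
    under eq_fun do rewrite big_nil a0.
    exact: finite_measure_integrable_cst.
  under eq_Rintegral do rewrite big_nil a0.
  by rewrite /Rintegral integral_cst//= probability_setT mule1.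
have [iS ES] := IH us.
have mS : measurable_fun setT (fun w => \sum_(i <- s) X i w) by exact: measurable_sum.
have ind : independent2 (X i) (fun w => \sum_(i <- s) X i w).
  move=> A B mA mB; rewrite setIC muleC.
  have := @independent_sum_event s [set i]%SET (fun=> A) B us.
  rewrite (_ : [set` [set i]%SET] = [set i]); last first.
    by apply/seteqP; split => j /=; rewrite inE => /eqP.
  rewrite !bigcap_set1; apply => //.
  by move=> j js; rewrite inE; apply: contraNneq i_s => <-.
have [iP EP] := independent2_Rintegral (mX i) mS ind ma ma (iX i) iS.
rewrite big_cons -ES -EP; split.
  by under eq_fun do rewrite big_cons aD.
by apply: eq_Rintegral => w _; rewrite big_cons aD.
Qed.

End mutual.
End independence.

(** * Integrability and real-valued expectation *)

Section expectation.
Context d (T : measurableType d) (R : realType) (P : probability T R).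
Implicit Types f g : T -> R.

Definition L1 f : Prop := P.-integrable setT (EFin \o f).
(** Real-valued, so that estimates close by real arithmetic. An infinite integral is sent to 0 by
    [fine], which is why the rules below carry [L1] hypotheses. *)
Definition Ex f : R := (\int[P]_w f w)%R.

Lemma L1_le f g : measurable_fun setT f -> (forall w, `|f w| <= g w) -> L1 g -> L1 f.
Proof.
move=> mf fg; apply: le_integrable => //; first exact/measurable_EFinP.
by move=> w _ /=; rewrite lee_fin; apply: le_trans (fg w) _; exact: ler_norm.
Qed.

Lemma L1_cst (c : R) : L1 (fun=> c).
Proof. exact: finite_measure_integrable_cst. Qed.

Lemma L1_bounded f (c : R) : measurable_fun setT f -> (forall w, `|f w| <= c) -> L1 f.
Proof. by move=> mf fc; apply: (L1_le mf fc); exact: L1_cst. Qed.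

Lemma L1D f g : L1 f -> L1 g -> L1 (fun w => f w + g w).
Proof. by move=> lf lg; exact: (integrableD measurableT lf lg). Qed.

Lemma L1B f g : L1 f -> L1 g -> L1 (fun w => f w - g w).
Proof. by move=> lf lg; exact: (integrableB measurableT lf lg). Qed.

Lemma L1Z (c : R) f : L1 f -> L1 (fun w => c * f w).
Proof. by move=> lf; exact: (integrableZl measurableT c lf). Qed.

Lemma L1_norm f : L1 f -> L1 (fun w => `|f w|).
Proof. by move=> lf; exact: (integrable_norm lf). Qed.

Lemma L1_sum (I : Type) (s : seq I) (F : I -> T -> R) : (forall i, L1 (F i)) ->
  L1 (fun w => \sum_(i <- s) F i w).
Proof.
move=> lF; elim: s => [|i s IH].
  by under eq_fun do rewrite big_nil; exact: L1_cst.
by under eq_fun do rewrite big_cons; exact: L1D.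
Qed.

Lemma ExD f g : L1 f -> L1 g -> Ex (fun w => f w + g w) = Ex f + Ex g.
Proof. by move=> lf lg; exact: RintegralD. Qed.

Lemma ExB f g : L1 f -> L1 g -> Ex (fun w => f w - g w) = Ex f - Ex g.
Proof. by move=> lf lg; exact: RintegralB. Qed.

Lemma ExZ (c : R) f : L1 f -> Ex (fun w => c * f w) = c * Ex f.
Proof. by move=> lf; exact: RintegralZl. Qed.

Lemma Ex_cst (c : R) : Ex (fun=> c) = c.
Proof. by rewrite /Ex /Rintegral integral_cst//= probability_setT mule1. Qed.

Lemma Ex_sum (I : Type) (s : seq I) (F : I -> T -> R) : (forall i, L1 (F i)) ->
  Ex (fun w => \sum_(i <- s) F i w) = \sum_(i <- s) Ex (F i).
Proof.
move=> lF; elim: s => [|i s IH].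
  by under [X in Ex X]eq_fun do rewrite big_nil; rewrite Ex_cst big_nil.
under [X in Ex X]eq_fun do rewrite big_cons.
by rewrite ExD//; [rewrite IH big_cons|exact: L1_sum].
Qed.

Lemma le_Ex f g : L1 f -> L1 g -> (forall w, f w <= g w) -> Ex f <= Ex g.
Proof. by move=> lf lg fg; apply: le_Rintegral => // w _; exact: fg. Qed.

Lemma Ex_ge0 f : (forall w, 0 <= f w) -> 0 <= Ex f.
Proof. by move=> f0; apply: Rintegral_ge0 => w _; exact: f0. Qed.

Lemma Ex_norm_le f g : L1 f -> L1 g -> (forall w, `|f w| <= g w) -> `|Ex f| <= Ex g.
Proof.
move=> lf lg fg; apply: (@le_trans _ _ (Ex (fun w => `|f w|))).
  exact: le_normr_Rintegral.
by apply: le_Ex => //; exact: L1_norm.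
Qed.

Lemma Ex_le_cst f (c : R) : L1 f -> (forall w, f w <= c) -> Ex f <= c.
Proof. by move=> lf fc; rewrite -[leRHS](Ex_cst c); apply: le_Ex => //; exact: L1_cst. Qed.

Lemma independent2_Ex (X Y : T -> R) (a b : R -> R) :
  measurable_fun setT X -> measurable_fun setT Y -> independent2 P X Y ->
  measurable_fun setT a -> measurable_fun setT b ->
  L1 (fun w => a (X w)) -> L1 (fun w => b (Y w)) ->
  L1 (fun w => a (X w) * b (Y w)) /\
  Ex (fun w => a (X w) * b (Y w)) = Ex (fun w => a (X w)) * Ex (fun w => b (Y w)).
Proof. exact: independent2_Rintegral. Qed.

End expectation.

(** * Moduli of continuity of the two test functions *)

Section test_modulus.
Context {R : realType}.
Implicit Types x y t : R.

Lemma norm_expRB1 (s u : R) : `|s| <= u -> `|expR s - 1| <= u * expR u.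
Proof.
move=> su; have u0 : 0 <= u by apply: le_trans su.
have e1 : 1 <= expR u by rewrite -expR0 ler_expR.
have h := expR_ge1Dx s; have h' := expR_ge1Dx (- u).
have eu : expR (- u) * expR u = 1 by rewrite -expRD addNr expR0.
move: su; rewrite ler_norml => /andP[s1 s2].
have se : expR s <= expR u by rewrite ler_expR.
have e0 := expR_gt0 u; have en := expR_gt0 (- u).
rewrite ler_norml; apply/andP; split; nra.
Qed.

Lemma ger0_norm_subl (x y : R) : `| `|x + y| - `|x| | <= `|y|.
Proof. by have := ler_dist_dist (x + y) x; rewrite addrAC subrr add0r. Qed.

(** The factor exp(-|x - x0|/d) is deliberately kept on the right: averaged over x it is again a
    value of the test function's expectation, which lets the Stein bound feed back on itself. *)
Lemma expR_dist_modulus (x0 d x y : R) : 0 < d ->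
  `|expR (- (`|x + y - x0| / d)) - expR (- (`|x - x0| / d))| <=
  `|y| / d * expR (`|y| / d) * expR (- (`|x - x0| / d)).
Proof.
move=> d0.
have -> : expR (- (`|x + y - x0| / d)) = expR (- (`|x - x0| / d)) *
    expR (- ((`|x + y - x0| - `|x - x0|) / d)).
  by rewrite -expRD; congr expR; rewrite mulrBl; lra.
rewrite -[X in _ - X]mulr1 -mulrBr normrM ger0_norm ?expR_ge0// mulrC.
rewrite ler_wpM2r ?expR_ge0//; apply: norm_expRB1.
rewrite normrN normrM (ger0_norm (_ : 0 <= d^-1)) ?invr_ge0 ?(ltW d0)//.
rewrite ler_wpM2r ?invr_ge0 ?(ltW d0)//.
by have := ger0_norm_subl (x - x0) y; rewrite addrAC.
Qed.

Lemma norm_expRN_le (s t : R) : 0 <= s -> 0 <= t -> `|expR (- s) - expR (- t)| <= `|s - t|.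
Proof.
wlog st : s t / s <= t.
  move=> H s0 t0; have [st|/ltW ts] := leP s t; first exact: H.
  by rewrite distrC (distrC s); exact: H.
move=> s0 t0.
have e : expR (- t) = expR (- s) * expR (- (t - s)) by rewrite -expRD; congr expR; ring.
have e1 : expR (- s) <= 1 by rewrite -expR0 ler_expR; lra.
have e0 := expR_gt0 (- s).
have h := expR_ge1Dx (- (t - s)).
have h1 : expR (- (t - s)) <= 1 by rewrite -expR0 ler_expR; lra.
rewrite (ler0_norm (_ : s - t <= 0)) ?ger0_norm; nra.
Qed.

(** The right-hand factor [p] is z-Lipschitz; the left-hand factor [r] is steep, of slope [1 / d],
    but its increments decay like exp(-|x|/d). Writing [x - 0] puts the bound in the same shape as
    [expR_dist_modulus]. *)
Lemma laplace_test_modulus (z d x y : R) : 0 <= z -> 0 < d ->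
  `|laplace_test z d (x + y) - laplace_test z d x| <=
  z * `|y| + `|y| / d * expR (`|y| / d) * expR (- (`|x - 0| / d)).
Proof.
move=> z0 d0; rewrite subr0.
have di0 : 0 <= d^-1 by rewrite invr_ge0 ltW.
pose p t := expR (- (z * Num.max t 0)); pose r t := expR (- (Num.max (- t) 0 / d)).
have pr t : laplace_test z d t = p t * r t.
  by rewrite /laplace_test opprD expRD.
have m0 t : 0 <= Num.max t 0 by rewrite le_max lexx orbT.
have p1 t : 0 <= p t <= 1.
  by rewrite expR_ge0/= -expR0 ler_expR oppr_le0 mulr_ge0.
have r1 t : 0 <= r t <= 1.
  by rewrite expR_ge0/= -expR0 ler_expR oppr_le0 mulr_ge0.
have dp : `|p (x + y) - p x| <= z * `|y|.
  apply: le_trans; first by apply: norm_expRN_le; exact: mulr_ge0.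
  rewrite -mulrBr normrM ger0_norm// ler_wpM2l//.
  have : - `|y| <= y <= `|y| by rewrite -ler_norml.
  move=> /andP[y1 y2]; rewrite ler_norml; apply/andP.
  by have [a|a] := leP (x + y) 0; have [b|b] := leP x 0; split; lra.
have dr : `|r (x + y) - r x| <= `|y| / d * expR (`|y| / d) * expR (- (`|x| / d)).
  have [x0|x0] := leP 0 x.
    have rx : r x = 1.
      by rewrite /r (max_idPr _) ?mul0r ?oppr0 ?expR0// oppr_le0.
    have [xy|xy] := leP 0 (x + y).
      have -> : r (x + y) = 1.
        by rewrite /r (max_idPr _) ?mul0r ?oppr0 ?expR0// oppr_le0.
      by rewrite rx subrr normr0 !mulr_ge0 ?expR_ge0.
    (* Crossing 0 forces x <= |y|, so exp((|y| - |x|)/d) >= 1 and the decaying factor can be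
       inserted for free. *)
    have yx : x <= `|y| by rewrite ler0_norm; lra.
    apply: (@le_trans _ _ (`|y| / d * 1)).
      rewrite mulr1; apply: le_trans.
        by apply: norm_expRN_le; rewrite mulr_ge0.
      rewrite -mulrBl normrM (ger0_norm di0) ler_wpM2r//.
      rewrite (max_idPr (_ : - x <= 0)) ?oppr_le0// subr0.
      rewrite (max_idPl (_ : 0 <= - (x + y))) ?oppr_ge0 ?(ltW xy)//.
      by rewrite normrN (ltr0_norm xy) ler0_norm; lra.
    rewrite -[leRHS]mulrA ler_wpM2l ?mulr_ge0// -expRD -[leLHS]expR0 ler_expR.
    by rewrite -mulrBl mulr_ge0// subr_ge0 (ger0_norm x0).
  have rx : r x = expR (- (`|x| / d)).
    by rewrite /r (max_idPl _) ?oppr_ge0 ?(ltW x0)// ltr0_norm.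
  have -> : r (x + y) = r x * expR (- ((Num.max (- (x + y)) 0 - `|x|) / d)).
    by rewrite rx /r -expRD; congr expR; rewrite mulrBl; lra.
  rewrite -[X in _ - X]mulr1 -mulrBr normrM rx ger0_norm ?expR_ge0// mulrC.
  rewrite ler_wpM2r ?expR_ge0//; apply: norm_expRB1.
  rewrite normrN normrM (ger0_norm di0) ler_wpM2r//.
  have : - `|y| <= y <= `|y| by rewrite -ler_norml.
  by rewrite (ltr0_norm x0) ler_norml /Num.max; case: ltP; lra.
rewrite !pr; have -> : p (x + y) * r (x + y) - p x * r x =
  (p (x + y) - p x) * r (x + y) + p x * (r (x + y) - r x) by ring.
apply: le_trans (ler_normD _ _) _; rewrite !normrM lerD//.
  rewrite (le_trans _ dp)// ler_piMr// ger0_norm//; first by have /andP[] := r1 (x + y).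
  by have /andP[] := r1 (x + y).
rewrite (le_trans _ dr)// ler_piMl// ger0_norm//; first by have /andP[] := p1 x.
by have /andP[] := p1 x.
Qed.

End test_modulus.

(** * Stein's method for tilted sums *)

Section stein_bound.
Context d (T : measurableType d) (R : realType) (P : probability T R).
Variables (n : nat) (X : 'I_n -> T -> R) (z b D K0 : R).
Local Notation L1 := (L1 P).
Local Notation Ex := (Ex P).

Let V w := \sum_(i < n) X i w - z.
Let Vi i w := V w - X i w.

(* These hold for X_i = b W_i / theta, with W_i as in [summands] below, under the
   law whose density is proportional to exp (z * sum_i X_i). *)
Record tilted_sum : Prop := TiltedSum {
  ts_meas : forall i, measurable_fun setT (X i) ;
  ts_ind : forall i, independent2 P (X i) (fun w => \sum_(j < n) X j w - z - X i w) ;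
  ts_b : 0 < b ;
  ts_nb : n%:R * b ^+ 2 = 1 ;
  ts_D : 1 <= D ;
  ts_z : 0 <= z ;
  ts_K0 : 0 < K0 ;
  ts_small : (1 + z) ^+ 2 * b <= 1 ;
  ts_L1 : forall i k, (k <= 3)%N ->
    L1 (fun w => `|X i w| ^+ k * expR (`|X i w| / (K0 * b))) ;
  ts_Ex : forall i k, (1 <= k <= 3)%N ->
    Ex (fun w => `|X i w| ^+ k * expR (`|X i w| / (K0 * b))) <= D * b ^+ k ;
  ts_mean : forall i, `|Ex (X i)| <= D * (1 + z) * b ^+ 2 ;
  ts_sum_mean : `|\sum_(i < n) Ex (X i) - z| <= D * (1 + z) ^+ 2 * b ;
  ts_sum_var : `|\sum_(i < n) Ex (fun w => X i w ^+ 2) - 1| <= D * (1 + z) ^+ 2 * b }.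

Hypothesis HX : tilted_sum.

Let mX := ts_meas HX.
Let b0 := ts_b HX.
Let nb := ts_nb HX.
Let D1 := ts_D HX.
Let z0 := ts_z HX.
Let K00 := ts_K0 HX.
Let small := ts_small HX.

Let mV : measurable_fun setT V.
Proof. by apply: measurable_funB => //; exact: measurable_sum. Qed.

Let mVi i : measurable_fun setT (Vi i).
Proof. by apply: measurable_funB => //; exact: mV. Qed.

Let indVi i : independent2 P (X i) (Vi i).
Proof. exact: ts_ind. Qed.

Let b1 : b <= 1.
Proof.
have n1 : 1 <= n%:R :> R.
  move: nb; case: n => [|m _]; last by rewrite ler1n.
  by rewrite mul0r => /esym/eqP; rewrite oner_eq0.
have := nb; have := b0; nra.
Qed.

(** [b] stands for 1 / sqrt n: the n remainders of third order add up to a single [b]. *)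
Let nb3 : n%:R * b ^+ 3 = b.
Proof. by rewrite exprS mulrCA nb mulr1. Qed.

Section scale.
Variable K : R.
Hypothesis K0K : K0 <= K.
Let K_gt0 : 0 < K := lt_le_trans K00 K0K.
Let dl := K * b.
Let dl0 : 0 < dl. Proof. by rewrite mulr_gt0. Qed.

Let e_le i w : expR (`|X i w| / dl) <= expR (`|X i w| / (K0 * b)).
Proof.
rewrite ler_expR ler_wpM2l// lef_pV2 ?posrE ?mulr_gt0//.
by rewrite /dl ler_pM2r.
Qed.

Let me k i : measurable_fun setT (fun w => `|X i w| ^+ k * expR (`|X i w| / dl)).
Proof.
apply: measurable_funM; first by apply: measurable_funX; exact: measurableT_comp.
apply: measurableT_comp => //; apply: measurable_funM => //; exact: measurableT_comp.
Qed.

Lemma L1_moment_expR i k : (k <= 3)%N -> L1 (fun w => `|X i w| ^+ k * expR (`|X i w| / dl)).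
Proof.
move=> k3; apply: (L1_le _ _ (ts_L1 HX i k3)); first exact: me.
move=> w; rewrite ger0_norm ?mulr_ge0 ?exprn_ge0 ?expR_ge0//.
by rewrite ler_wpM2l ?exprn_ge0.
Qed.

Lemma Ex_moment_expR i k : (1 <= k <= 3)%N ->
  Ex (fun w => `|X i w| ^+ k * expR (`|X i w| / dl)) <= D * b ^+ k.
Proof.
move=> k13; have /andP[k1 k3] := k13.
apply: le_trans (ts_Ex HX i k13); apply: le_Ex; [exact: L1_moment_expR|exact: (ts_L1 HX)|].
by move=> w; rewrite ler_wpM2l ?exprn_ge0.
Qed.
End scale.

Let e_ge1 i w : 1 <= expR (`|X i w| / (K0 * b)).
Proof. by rewrite -expR0 ler_expR divr_ge0// mulr_ge0// ltW. Qed.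

Let L1p i k : (k <= 3)%N -> L1 (fun w => `|X i w| ^+ k).
Proof.
move=> k3; apply: (L1_le _ _ (ts_L1 HX i k3)).
  by apply: measurable_funX; exact: measurableT_comp.
by move=> w; rewrite ger0_norm ?exprn_ge0// ler_peMr ?exprn_ge0.
Qed.

Let Exp i k : (1 <= k <= 3)%N -> Ex (fun w => `|X i w| ^+ k) <= D * b ^+ k.
Proof.
move=> k13; have /andP[k1 k3] := k13.
apply: le_trans (ts_Ex HX i k13); apply: le_Ex; [exact: L1p|exact: (ts_L1 HX)|].
by move=> w; rewrite ler_peMr ?exprn_ge0.
Qed.

Let L1a i : L1 (fun w => `|X i w|).
Proof. exact: (@L1p i 1). Qed.

Let Exa i : Ex (fun w => `|X i w|) <= D * b.
Proof. exact: (@Exp i 1). Qed.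

Let L1X i : L1 (X i).
Proof. by apply: (L1_le _ _ (L1a i)) => //; exact: mX. Qed.

Let L1X2 i : L1 (fun w => X i w ^+ 2).
Proof.
by under eq_fun do rewrite -real_normK ?num_real//; exact: (@L1p i 2).
Qed.

Let ExX2_ge0 i : 0 <= Ex (fun w => X i w ^+ 2).
Proof. by apply: Ex_ge0 => w; exact: sqr_ge0. Qed.

Let ExX2 i : Ex (fun w => X i w ^+ 2) <= D * b ^+ 2.
Proof.
rewrite (_ : Ex _ = Ex (fun w => `|X i w| ^+ 2)); first exact: Exp.
by congr Ex; apply/funext => w; rewrite real_normK// num_real.
Qed.

Let L1V : L1 V.
Proof. by apply: L1B; [exact: L1_sum|exact: L1_cst]. Qed.

Let L1Vi i : L1 (Vi i).
Proof. exact: L1B. Qed.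

(* Leaving one summand out, E(V^2) = (E V)^2 + sum of the variances. *)
Let ExV2 : L1 (fun w => V w ^+ 2) /\ Ex (fun w => V w ^+ 2) <= D ^+ 2 + 1 + D.
Proof.
have XV i : L1 (fun w => X i w * Vi i w) /\
    Ex (fun w => X i w * Vi i w) = Ex (X i) * Ex (Vi i).
  by have := independent2_Ex (a := id) (b := id) (mX i) (mVi i) (@indVi i); apply.
have V2E : (fun w => V w ^+ 2) = (fun w =>
    \sum_(i < n) (X i w * Vi i w + X i w ^+ 2) - z * V w).
  apply/funext => w; rewrite expr2 {1}/V mulrBl mulr_suml; congr (_ - _).
  by apply: eq_bigr => i _; rewrite /Vi; ring.
have L1i i : L1 (fun w => X i w * Vi i w + X i w ^+ 2).
  by apply: L1D => //; have [] := XV i.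
have EV : Ex V = \sum_(i < n) Ex (X i) - z.
  rewrite ExB; [|exact: L1_sum|exact: L1_cst].
  by rewrite Ex_sum// Ex_cst.
split.
  by rewrite V2E; apply: L1B; [exact: L1_sum|exact: L1Z].
rewrite V2E ExB; [|exact: L1_sum|exact: L1Z].
rewrite Ex_sum// ExZ//.
under eq_bigr => i _.
  rewrite ExD//; last by have [] := XV i.
  rewrite (XV i).2 ExB//.
  over.
rewrite big_split/=.
have -> : \sum_(i < n) Ex (X i) * (Ex V - Ex (X i)) =
   (\sum_(i < n) Ex (X i)) * Ex V - \sum_(i < n) Ex (X i) ^+ 2.
  by rewrite mulr_suml -sumrB; apply: eq_bigr => i _; ring.
have m0 : 0 <= \sum_(i < n) Ex (X i) ^+ 2 by apply: sumr_ge0 => i _; exact: sqr_ge0.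
have EV1 : `|Ex V| <= D.
  rewrite EV; apply: le_trans (ts_sum_mean HX) _.
  by rewrite -mulrA -[leRHS]mulr1 ler_wpM2l//; have := D1; lra.
have sv : `|\sum_(i < n) Ex (fun w => X i w ^+ 2) - 1| <= D.
  apply: le_trans (ts_sum_var HX) _.
  by rewrite -mulrA -[leRHS]mulr1 ler_wpM2l//; have := D1; lra.
have EV2 : Ex V ^+ 2 <= D ^+ 2.
  by rewrite -real_normK ?num_real// ler_sqr ?nnegrE//; have := D1; lra.
move: sv; rewrite ler_norml => /andP[_ sv].
have : (\sum_(i < n) Ex (X i)) * Ex V - z * Ex V = Ex V ^+ 2.
  by rewrite -mulrBl -EV expr2.
move: m0 sv EV2; set a := _ ^+ 2; lra.
Qed.

(** From |V| <= (1 + V^2)/2 and the second moment of V; the constant absorbs lower powers of [D] by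
    [1 <= D]. *)
Let ExVi i : Ex (fun w => `|Vi i w|) <= 4 * D ^+ 2.
Proof.
have [LV2 EV2] := ExV2.
apply: (@le_trans _ _ (Ex (fun w => (1 / 2 + 1 / 2 * V w ^+ 2) + `|X i w|))).
  apply: le_Ex.
  - exact: L1_norm.
  - by apply: L1D => //; apply: L1D; [exact: L1_cst|exact: L1Z].
  - move=> w; apply: le_trans (ler_normB _ _) _; rewrite lerD2r.
    have : 0 <= (`|V w| - 1) ^+ 2 by exact: sqr_ge0.
    by rewrite -(real_normK (num_real (V w))); lra.
have L2 : L1 (fun w => 1 / 2 * V w ^+ 2) by exact: L1Z.
rewrite ExD//; last by apply: L1D => //; exact: L1_cst.
rewrite ExD//; last exact: L1_cst.
rewrite Ex_cst ExZ//; have := Exa i; have := D1; have := b1; have := b0; nra.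
Qed.

(** The three copies of [C0 * D ^+ 2] pay for the defect of the total mean, the defect of the total
    second moment, and the replacement of E f(V - X_i) by E f(V). The last term is the Taylor
    remainder, without its concentration part. *)
Definition stein_rate : R :=
  let C0 := @stein_const R + 1 in
  3 * C0 * D ^+ 2 + 2 * D ^+ 2 * (C0 + 1 + 4 * C0 * D ^+ 2).

(** * The Stein bound for a general test function *)

Section test_function.
Variables (k : R -> R) (K L x0 Q : R).
Hypotheses (ck : continuous k) (k01 : forall t, 0 <= k t <= 1).
Hypotheses (K0K : K0 <= K) (DK : 2 * D <= K) (L0 : 0 <= L) (Lz : L <= 1 + z).
Let dl := K * b.
(** The common shape of the two moduli: [L = 0] and [x0 = a] for the exponential of the distance to
    [a], [L = z] and [x0 = 0] for the Laplace test function. The bound [Q] on the concentration of V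
    remains a parameter at this stage. *)
Hypothesis kmod : forall x y, `|k (x + y) - k x| <=
  L * `|y| + `|y| / dl * expR (`|y| / dl) * expR (- (`|x - x0| / dl)).
Hypothesis HQ : forall x, Ex (fun w => expR (- (`|V w - x| / dl))) <= Q.

Let dl0 : 0 < dl. Proof. by rewrite mulr_gt0// (lt_le_trans K00). Qed.
Let qi i := Ex (fun w => expR (- (`|Vi i w - x0| / dl))).

Let L1q (Y : T -> R) (a : R) : measurable_fun setT Y -> L1 (fun w => expR (- (`|Y w - a| / dl))).
Proof.
move=> mY; apply: (@L1_bounded _ _ _ _ _ 1).
  exact: (measurableT_comp (measurable_expR_dist a dl) mY).
move=> w; rewrite ger0_norm ?expR_ge0// -expR0 ler_expR oppr_le0.
by rewrite divr_ge0// ltW.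
Qed.

(** Removing one summand at most doubles the concentration bound. By the triangle inequality and
    independence, [qi i] times E exp(-|X_i|/dl) is at most [Q], and the second factor is at least
    1/2 because E|X_i| <= D b <= dl / 2. *)
Let qi_le i : 0 <= qi i <= 2 * Q.
Proof.
apply/andP; split; first by apply: Ex_ge0 => w; exact: expR_ge0.
have [Lp Ep] := independent2_Ex (a := fun t => expR (- (`|t - 0| / dl)))
  (b := fun t => expR (- (`|t - x0| / dl))) (mX i) (mVi i) (@indVi i)
  (measurable_expR_dist 0 dl) (measurable_expR_dist x0 dl) (L1q 0 (mX i)) (L1q x0 (mVi i)).
have H1 : 1 / 2 <= Ex (fun w => expR (- (`|X i w - 0| / dl))).
  apply: (@le_trans _ _ (Ex (fun w => 1 - dl^-1 * `|X i w|))).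
    rewrite ExB; [|exact: L1_cst|exact: L1Z].
    rewrite Ex_cst ExZ//.
    have : dl^-1 * Ex (fun w => `|X i w|) <= 1 / 2.
      rewrite mulrC ler_pdivrMr//; apply: le_trans (Exa i) _.
      have : 2 * D * b <= dl by rewrite /dl ler_pM2r.
      lra.
    lra.
  apply: le_Ex; [|exact: L1q|].
    by apply: L1B; [exact: L1_cst|exact: L1Z].
  by move=> w; rewrite subr0 [X in 1 - X]mulrC; exact: expR_ge1Dx.
have H2 : Ex (fun w => expR (- (`|X i w - 0| / dl))) * qi i <= Q.
  rewrite -Ep; apply: le_trans (HQ x0); apply: le_Ex => //; first exact: L1q.
  move=> w; rewrite -expRD ler_expR -opprD lerN2 -mulrDl.
  rewrite ler_wpM2r ?invr_ge0 ?(ltW dl0)//.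
  have -> : V w - x0 = X i w + (Vi i w - x0) by rewrite /Vi; ring.
  by rewrite subr0 ler_normD.
have q0 : 0 <= qi i by apply: Ex_ge0 => w; exact: expR_ge0.
move: H1 H2 q0; set e := Ex _; set q := qi i; nra.
Qed.

Let C0 := @stein_const R + 1.
Let C01 : 1 <= C0. Proof. by have := @stein_const_ge1 R; rewrite /C0; lra. Qed.

Section with_solution.
Variable f : R -> R.
Let N := gauss_mean k.
Let f' x := x * f x + k x - N.
Hypothesis df : forall x : R, is_derive x 1 f (f' x).
Hypothesis fb : forall x, `|f x| <= C0.
Hypothesis f'b : forall x, `|f' x| <= C0.

(** A modulus for [f'] read off Stein's equation itself, since [k], hence [f'], need not be
    differentiable. The terms come from the increments of [x * f x] and of [k]. *)
Let omega (x y : R) : R := (C0 + L) * y + C0 * (y * `|x|) +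
  dl^-1 * (y * expR (y / dl) * expR (- (`|x - x0| / dl))).

Let omega_mono x y y' : 0 <= y' <= y -> omega x y' <= omega x y.
Proof.
move=> /andP[y0 yy].
have e : expR (y' / dl) <= expR (y / dl).
  by rewrite ler_expR ler_wpM2r// invr_ge0 ltW.
rewrite /omega lerD ?lerD//.
- by rewrite ler_wpM2l// addr_ge0//; have := C01; lra.
- by rewrite ler_wpM2l; [|have := C01; lra|rewrite ler_wpM2r].
- rewrite ler_wpM2l ?invr_ge0 ?(ltW dl0)// ler_wpM2r ?expR_ge0//.
  by rewrite ler_pM// expR_ge0.
Qed.

Let cf : continuous f.
Proof.
by move=> x; have [/derivable1_diffP/differentiable_continuous] := df x.
Qed.

Let f_lip x y : exists2 c, `|c| <= `|y| & f (x + y) - f x = f' (x + c) * y.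
Proof.
have cc (u v : R) : {within `[u, v], continuous f}.
  by apply: continuous_subspaceT; exact: cf.
have [y0|/ltW y0] := leP 0 y.
  have xy : x <= x + y by rewrite lerDl.
  have [c] := MVT_segment xy (fun c _ => df c) (cc _ _).
  rewrite in_itv/= => /andP[xc cx] ->; exists (c - x).
    by rewrite (ger0_norm y0) ger0_norm; lra.
  have -> : x + (c - x) = c by ring.
  by have -> : x + y - x = y by ring.
have xy : x + y <= x by rewrite gerDl.
have [c] := MVT_segment xy (fun c _ => df c) (cc _ _).
rewrite in_itv/= => /andP[xc cx] H; exists (c - x).
  by rewrite (ler0_norm y0) ler0_norm; lra.
have -> : x + (c - x) = c by ring.
by rewrite -opprB H; ring.
Qed.

Let f_lip1 x y : `|f (x + y) - f x| <= C0 * `|y|.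
Proof.
by have [c _ ->] := f_lip x y; rewrite normrM ler_wpM2r.
Qed.

Let f'_mod x y : `|f' (x + y) - f' x| <= omega x `|y|.
Proof.
have -> : f' (x + y) - f' x = y * f (x + y) + x * (f (x + y) - f x) + (k (x + y) - k x).
  by rewrite /f'; ring.
apply: le_trans (ler_normD _ _) _; apply: le_trans (lerD (ler_normD _ _) (kmod x y)) _.
rewrite !normrM /omega.
have h1 : `|y| * `|f (x + y)| <= C0 * `|y| by rewrite mulrC ler_wpM2r.
have h2 : `|x| * `|f (x + y) - f x| <= C0 * (`|y| * `|x|).
  by rewrite mulrA [leRHS]mulrC ler_wpM2l.
have -> : `|y| / dl * expR (`|y| / dl) * expR (- (`|x - x0| / dl)) =
  dl^-1 * (`|y| * expR (`|y| / dl) * expR (- (`|x - x0| / dl))) by ring.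
lra.
Qed.

Let f_taylor x y : `|f (x + y) - f x - y * f' x| <= `|y| * omega x `|y|.
Proof.
have [c cy ->] := f_lip x y.
have -> : f' (x + c) * y - y * f' x = y * (f' (x + c) - f' x) by ring.
rewrite normrM ler_wpM2l//; apply: le_trans (f'_mod _ _) _.
by apply: omega_mono; rewrite normr_ge0.
Qed.

Let mf : measurable_fun setT f. Proof. exact: continuous_measurable_fun. Qed.

Let mf' : measurable_fun setT f'.
Proof.
apply: measurable_funB => //; apply: measurable_funD; first exact: measurable_funM.
exact: continuous_measurable_fun.
Qed.

Let L1f (Y : T -> R) : measurable_fun setT Y -> L1 (fun w => f (Y w)).
Proof. by move=> mY; apply: (@L1_bounded _ _ _ _ _ C0) => //; exact: measurableT_comp. Qed.

Let L1f' (Y : T -> R) : measurable_fun setT Y -> L1 (fun w => f' (Y w)).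
Proof. by move=> mY; apply: (@L1_bounded _ _ _ _ _ C0) => //; exact: measurableT_comp. Qed.

Let Omega : R := C0 + L + 4 * C0 * D ^+ 2 + 2 * Q / dl.

(** Independence of X_i and V - X_i splits each term of [omega]; in [Omega], [4 * D ^+ 2] stands for
    E|V - X_i| and [2 * Q] for [qi i]. The case [j = 2] serves the Taylor remainder, [j = 0] the
    passage from V - X_i to V inside [f']. *)
Let Ex_omega i j : (j <= 2)%N ->
  L1 (fun w => `|X i w| ^+ j * omega (Vi i w) `|X i w|) /\
  Ex (fun w => `|X i w| ^+ j * omega (Vi i w) `|X i w|) <= Omega * (D * b ^+ j.+1).
Proof.
move=> j2; have j3 : (j.+1 <= 3)%N by [].
have j13 : (1 <= j.+1 <= 3)%N by [].
have Lj := L1p i j3.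
have Lej := L1_moment_expR K0K i j3.
have mn : measurable_fun setT (fun t : R => `|t|) by exact: measurableT_comp.
have aj : measurable_fun setT (fun t : R => `|t| ^+ j.+1) by exact: measurable_funX.
have ae : measurable_fun setT (fun t : R => `|t| ^+ j.+1 * expR (`|t| / dl)).
  apply: measurable_funM => //; apply: measurableT_comp => //.
  exact: measurable_funM.
have [LA EA] := independent2_Ex (a := fun t => `|t| ^+ j.+1) (b := fun t : R => `|t|)
  (mX i) (mVi i) (@indVi i) aj mn Lj (L1_norm (L1Vi i)).
have [LB EB] := independent2_Ex (a := fun t => `|t| ^+ j.+1 * expR (`|t| / dl))
  (b := fun t => expR (- (`|t - x0| / dl)))
  (mX i) (mVi i) (@indVi i) ae (measurable_expR_dist x0 dl) Lej (L1q x0 (mVi i)).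
have -> : (fun w => `|X i w| ^+ j * omega (Vi i w) `|X i w|) = (fun w =>
    ((C0 + L) * `|X i w| ^+ j.+1 + C0 * (`|X i w| ^+ j.+1 * `|Vi i w|)) +
    dl^-1 * (`|X i w| ^+ j.+1 * expR (`|X i w| / dl) * expR (- (`|Vi i w - x0| / dl)))).
  by apply/funext => w; rewrite /omega exprS; ring.
have LA' := L1Z C0 LA; have LB' := L1Z dl^-1 LB; have Lj' := L1Z (C0 + L) Lj.
split; first by apply: L1D => //; exact: L1D.
rewrite ExD//; last exact: L1D.
rewrite ExD// !ExZ// EA EB.
have e1 := Exp i j13.
have e2 := Ex_moment_expR K0K i j13.
have /andP[q0 q2] := qi_le i; have a1 := ExVi i.
have u0 : 0 <= Ex (fun w => `|X i w| ^+ j.+1) by apply: Ex_ge0 => w; exact: exprn_ge0.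
have g0 : 0 <= Ex (fun w => `|X i w| ^+ j.+1 * expR (`|X i w| / dl)).
  by apply: Ex_ge0 => w; rewrite mulr_ge0 ?exprn_ge0 ?expR_ge0.
have a0 : 0 <= Ex (fun w => `|Vi i w|) by exact: Ex_ge0.
have -> : Omega * (D * b ^+ j.+1) = (C0 + L) * (D * b ^+ j.+1) +
    C0 * ((D * b ^+ j.+1) * (4 * D ^+ 2)) + dl^-1 * (D * b ^+ j.+1 * (2 * Q)).
  have dn : dl != 0 by rewrite gt_eqF.
  by rewrite /Omega; move: (dl) dn => e dn; field.
have C00 : 0 <= C0 by have := C01; lra.
rewrite lerD ?lerD//.
- by rewrite (ler_wpM2l (addr_ge0 C00 L0)).
- by rewrite (ler_wpM2l C00) ?ler_pM.
- by rewrite ler_wpM2l ?invr_ge0 ?(ltW dl0)// ler_pM.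
Qed.

Let Rem : R := (C0 * D ^+ 2 * (1 + z) + 2 * D ^+ 2 * Omega) * b ^+ 3.

Let Omega0 : 0 <= Omega.
Proof.
have Q0 : 0 <= Q by apply: le_trans (HQ 0); apply: Ex_ge0 => w; exact: expR_ge0.
by rewrite /Omega !addr_ge0 ?mulr_ge0 ?exprn_ge0 ?invr_ge0//; have := C01; have := D1; have := dl0; lra.
Qed.

Let L1XfV i : L1 (fun w => X i w * f (V w)).
Proof.
apply: (L1_le _ _ (L1Z C0 (L1a i))).
  by apply: measurable_funM => //; exact: measurableT_comp.
by move=> w; rewrite normrM mulrC ler_wpM2r.
Qed.

(** Expanding [f] at V - X_i, which is independent of X_i, makes the main terms factor. Restoring V
    in the two factors costs order [b] each, multiplied by a mean or second moment of order
    [b ^+ 2]. *)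
Let one_summand i : Ex (X i) * Ex (fun w => f (V w)) +
  Ex (fun w => X i w ^+ 2) * Ex (fun w => f' (V w)) - Rem <= Ex (fun w => X i w * f (V w)).
Proof.
have [LO0 E0] := @Ex_omega i 0 isT; have [LO2 E2] := @Ex_omega i 2 isT.
have VE w : V w = Vi i w + X i w by rewrite /Vi subrK.
have [LA EA] := independent2_Ex (a := id) (mX i) (mVi i) (@indVi i)
  (@measurable_id _ _ setT) mf (L1X i) (L1f (mVi i)).
have msq : measurable_fun setT (fun t : R => t ^+ 2) by exact: measurable_funX.
have [LB EB] := independent2_Ex (a := fun t => t ^+ 2) (mX i) (mVi i) (@indVi i)
  msq mf' (L1X2 i) (L1f' (mVi i)).
have H1 : Ex (X i) * Ex (fun w => f (Vi i w)) +
    Ex (fun w => X i w ^+ 2) * Ex (fun w => f' (Vi i w)) - Omega * (D * b ^+ 3)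
    <= Ex (fun w => X i w * f (V w)).
  apply: (@le_trans _ _ (Ex (fun w => X i w * f (Vi i w) + X i w ^+ 2 * f' (Vi i w) -
      `|X i w| ^+ 2 * omega (Vi i w) `|X i w|))).
    rewrite [leRHS]ExB//; last exact: L1D.
    rewrite [X in _ <= X - _]ExD// EB; have -> : Ex (fun w => X i w * f (Vi i w)) = Ex (X i) * Ex (fun w => f (Vi i w)) by exact: EA.
    by rewrite lerD2l lerN2.
  apply: le_Ex => //; first by apply: L1B => //; exact: L1D.
  move=> w; have := f_taylor (Vi i w) (X i w); rewrite -VE.
  set a := f (V w); set a' := f (Vi i w); set c := f' _; set o := omega _ _ => ht.
  have : `|X i w * (a - a' - X i w * c)| <= `|X i w| * (`|X i w| * o).
    by rewrite normrM ler_wpM2l.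
  rewrite ler_norml => /andP[h _]; rewrite !expr2; lra.
have H2 : `|Ex (fun w => f (V w)) - Ex (fun w => f (Vi i w))| <= C0 * (D * b).
  rewrite -ExB; [|exact: L1f|exact: L1f].
  apply: (@le_trans _ _ (Ex (fun w => C0 * `|X i w|))).
    apply: Ex_norm_le; [by apply: L1B; exact: L1f|exact: L1Z|].
    by move=> w; rewrite VE; exact: f_lip1.
  by rewrite ExZ// ler_wpM2l//; have := C01; lra.
have H3 : `|Ex (fun w => f' (V w)) - Ex (fun w => f' (Vi i w))| <= Omega * (D * b).
  rewrite -ExB; [|exact: L1f'|exact: L1f'].
  apply: le_trans E0; apply: Ex_norm_le => //; first by apply: L1B; exact: L1f'.
  by move=> w; rewrite expr0 mul1r VE; exact: f'_mod.
have H4 := ts_mean HX i.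
have H5 : `|Ex (X i) * (Ex (fun w => f (V w)) - Ex (fun w => f (Vi i w)))| <=
    D * (1 + z) * b ^+ 2 * (C0 * (D * b)).
  by rewrite normrM ler_pM.
have H6 : `|Ex (fun w => X i w ^+ 2) * (Ex (fun w => f' (V w)) - Ex (fun w => f' (Vi i w)))| <=
    D * b ^+ 2 * (Omega * (D * b)).
  by rewrite normrM ler_pM// ger0_norm.
have RE : Rem = D * (1 + z) * b ^+ 2 * (C0 * (D * b)) + D * b ^+ 2 * (Omega * (D * b)) +
    D * Omega * D * b ^+ 3 by rewrite /Rem; ring.
have DD : Omega * (D * b ^+ 3) <= D * Omega * D * b ^+ 3.
  have -> : D * Omega * D * b ^+ 3 = D * (Omega * (D * b ^+ 3)) by ring.
  by rewrite ler_peMl// !mulr_ge0// ?exprn_ge0//; have := b0; have := D1; lra.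
move: H5 H6; rewrite !ler_norml => /andP[_ H5] /andP[_ H6].
rewrite RE; lra.
Qed.

(** By Stein's equation, E k(V) exceeds the Gaussian mean by E[f'(V) - V f(V)]. Summing
    [one_summand], the means add up to about [z], cancelling the shift in V, and the second moments
    to about 1, cancelling E f'(V). *)
Lemma stein_bound_with_solution : Ex (fun w => k (V w)) <= gauss_mean k +
  (3 * C0 * D ^+ 2 + 2 * D ^+ 2 * (C0 + 1 + 4 * C0 * D ^+ 2)) * (1 + z) ^+ 2 * b +
  4 * D ^+ 2 / K * Q.
Proof.
have LV : L1 (fun w => V w * f (V w)).
  apply: (L1_le _ _ (L1Z C0 (L1_norm L1V))).
    by apply: measurable_funM => //; exact: measurableT_comp.
  by move=> w; rewrite normrM mulrC ler_wpM2r.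
have EV : Ex (fun w => V w * f (V w)) =
    \sum_(i < n) Ex (fun w => X i w * f (V w)) - z * Ex (fun w => f (V w)).
  rewrite -Ex_sum// -ExZ; last exact: L1f.
  rewrite -ExB; [|exact: L1_sum|by apply: L1Z; exact: L1f].
  by congr Ex; apply/funext => w; rewrite /V mulrBl mulr_suml.
have kE : Ex (fun w => k (V w)) = gauss_mean k + (Ex (fun w => f' (V w)) - Ex (fun w => V w * f (V w))).
  rewrite -ExB//; last exact: L1f'.
  rewrite -[X in X + _](Ex_cst P) -ExD; [|exact: L1_cst|by apply: L1B => //; exact: L1f'].
  by congr Ex; apply/funext => w; rewrite /f' /N; ring.
rewrite kE.
pose F := Ex (fun w => f (V w)); pose F' := Ex (fun w => f' (V w)).
have FC : `|F| <= C0.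
  rewrite -[leRHS](Ex_cst P); apply: Ex_norm_le => //; [exact: L1f|exact: L1_cst].
have F'C : `|F'| <= C0.
  rewrite -[leRHS](Ex_cst P); apply: Ex_norm_le => //; [exact: L1f'|exact: L1_cst].
have S1 : (\sum_(i < n) Ex (X i)) * F + (\sum_(i < n) Ex (fun w => X i w ^+ 2)) * F' -
    n%:R * Rem <= \sum_(i < n) Ex (fun w => X i w * f (V w)).
  have -> : n%:R * Rem = \sum_(i < n) Rem by rewrite sumr_const card_ord mulr_natl.
  by rewrite !mulr_suml -big_split/= -sumrB; apply: ler_sum => i _; exact: one_summand.
have A1 : `|(\sum_(i < n) Ex (X i) - z) * F| <= D * (1 + z) ^+ 2 * b * C0.
  by rewrite normrM ler_pM// (ts_sum_mean HX).
have A2 : `|(\sum_(i < n) Ex (fun w => X i w ^+ 2) - 1) * F'| <= D * (1 + z) ^+ 2 * b * C0.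
  by rewrite normrM ler_pM// (ts_sum_var HX).
(* In the concentration term the scale [dl = K * b] cancels the remaining [b]: it has no small
   factor but 1 / K, so K must be large compared with D^2. *)
have A3 : n%:R * Rem = (C0 * D ^+ 2 * (1 + z) + 2 * D ^+ 2 * (C0 + L + 4 * C0 * D ^+ 2)) * b +
    4 * D ^+ 2 / K * Q.
  rewrite /Rem mulrCA nb3 /Omega /dl; field.
  by rewrite !gt_eqF// (lt_le_trans K00).
rewrite EV -/F -/F'.
have q1 : 1 <= (1 + z) ^+ 2 by rewrite -[leLHS](expr1n _ 2) ler_sqr ?nnegrE; have := z0; lra.
have zq : 1 + z <= (1 + z) ^+ 2 by rewrite expr2 ler_peMr; have := z0; lra.
have D12 : D <= D ^+ 2 by rewrite expr2 ler_peMr; have := D1; lra.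
have C00 : 0 <= C0 by have := C01; lra.
have D0 : 0 <= D by have := D1; lra.
have D20 : 0 <= D ^+ 2 by exact: sqr_ge0.
set q := (1 + z) ^+ 2 in q1 zq A1 A2 *.
have q0 : 0 <= q by exact: le_trans ler01 q1.
clearbody q.
have b0' := ltW b0.
have B1 : D * q * b * C0 <= C0 * D ^+ 2 * q * b.
  have -> : D * q * b * C0 = C0 * q * b * D by ring.
  have -> : C0 * D ^+ 2 * q * b = C0 * q * b * D ^+ 2 by ring.
  by rewrite ler_wpM2l// !mulr_ge0.
have B2 : C0 * D ^+ 2 * (1 + z) * b <= C0 * D ^+ 2 * q * b.
  by rewrite ler_wpM2r// ler_wpM2l// mulr_ge0.
have B3 : 2 * D ^+ 2 * (C0 + L + 4 * C0 * D ^+ 2) * b <=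
    2 * D ^+ 2 * (C0 + 1 + 4 * C0 * D ^+ 2) * q * b.
  rewrite ler_wpM2r ?(ltW b0)// -[leRHS]mulrA ler_wpM2l ?mulr_ge0//.
  have : C0 <= C0 * q by rewrite ler_peMr.
  have : 4 * C0 * D ^+ 2 <= 4 * C0 * D ^+ 2 * q by rewrite ler_peMr// !mulr_ge0.
  have := Lz; lra.
move: A1 A2; rewrite !ler_norml => /andP[A1 _] /andP[A2 _].
lra.
Qed.

End with_solution.

Lemma stein_bound : Ex (fun w => k (V w)) <= gauss_mean k +
  stein_rate * (1 + z) ^+ 2 * b +
  4 * D ^+ 2 / K * Q.
Proof.
have [f [df fb f'b]] := stein_solution ck k01.
apply: (stein_bound_with_solution df) => // x.
by rewrite (le_trans (fb x))// /C0 lerDl.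
Qed.

End test_function.

(* The test function exp(-|x - a|/delta) controls its own Stein error, so the
   bound on sup_a E exp(-|V - a|/delta) closes once 4 D^2/K <= 1/2. *)
Lemma concentration (K a : R) : K0 <= K -> 8 * D ^+ 2 <= K ->
  Ex (fun w => expR (- (`|V w - a| / (K * b)))) <=
  (4 * K + 2 * stein_rate) * (1 + z) ^+ 2 * b.
Proof.
move=> K0K DK; pose dl := K * b.
have dl0 : 0 < dl by rewrite mulr_gt0// (lt_le_trans K00).
pose q x := Ex (fun w => expR (- (`|V w - x| / dl))).
have D12 : D <= D ^+ 2 by rewrite expr2 ler_peMr; have := D1; lra.
have q1 x : q x <= 1.
  apply: Ex_le_cst.
    apply: (@L1_bounded _ _ _ _ _ 1).
      exact: (measurableT_comp (measurable_expR_dist x dl) mV).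
    move=> w; rewrite ger0_norm ?expR_ge0// -expR0 ler_expR oppr_le0.
    by rewrite divr_ge0// ltW.
  move=> w; rewrite -expR0 ler_expR oppr_le0.
  by rewrite divr_ge0// ltW.
(* The supremum is finite because each [q x] is at most 1; only a finite [Q] can be absorbed from
   right to left below. *)
pose Q := sup (range q).
have hq : has_sup (range q).
  by split; [exists (q 0); exists 0|exists 1 => _ [x _ <-]].
have HQ x : q x <= Q by apply: (ub_le_sup hq.2); exists x.
have Hx x : q x <= 2 * dl + stein_rate * (1 + z) ^+ 2 * b + 1 / 2 * Q.
  have ck : continuous (fun t : R => expR (- (`|t - x| / dl))).
    move=> t; apply: (cvg_comp _ expR); last exact: continuous_expR.
    apply: cvgN; apply: cvgM; last exact: cvg_cst.
    by apply: cvg_norm; apply: cvgB; [exact: cvg_id|exact: cvg_cst].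
  have k01 (t : R) : 0 <= expR (- (`|t - x| / dl)) <= 1.
    rewrite expR_ge0 -expR0 ler_expR oppr_le0 divr_ge0//; exact: ltW.
  have := @stein_bound _ K 0 x Q ck k01 K0K _ (lexx 0) _ _ HQ.
  move=> /(_ _ _ _)/le_trans; apply.
  - have : 0 <= D ^+ 2 by exact: sqr_ge0.
    lra.
  - have := z0; lra.
  - by move=> u v; rewrite mul0r add0r; exact: expR_dist_modulus.
  rewrite !lerD//.
    by rewrite mulr_natl; exact: gauss_mean_expR_dist.
  rewrite ler_wpM2r//.
    by apply: le_trans (HQ 0); apply: Ex_ge0 => w; exact: expR_ge0.
  rewrite ler_pdivrMr ?(lt_le_trans K00)//; lra.
have HQ2 : Q <= 2 * dl + stein_rate * (1 + z) ^+ 2 * b + 1 / 2 * Q.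
  by apply: ge_sup; [exact: hq.1|move=> _ [x _ <-]].
apply: le_trans (HQ a) _.
have zq : 1 <= (1 + z) ^+ 2 by rewrite -[leLHS](expr1n _ 2) ler_sqr ?nnegrE; have := z0; lra.
have : 4 * dl <= 4 * K * (1 + z) ^+ 2 * b.
  rewrite /dl mulrA ler_wpM2r ?(ltW b0)// ler_peMr// mulr_ge0//.
  by rewrite ltW// (lt_le_trans K00).
move: HQ2; clearbody dl Q; lra.
Qed.

(** The Stein bound with [L = z] and with [Q] supplied by [concentration]. Of the coefficient of
    [K], one unit is the cost of smoothing and two come from [Q / 2]; of the two copies of
    [stein_rate], one comes from [Q / 2]. *)
Lemma laplace_bound (K : R) : K0 <= K -> 8 * D ^+ 2 <= K ->
  Ex (fun w => laplace_test z (K * b) (V w)) <=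
  expR (z ^+ 2 / 2) * gauss_tail z +
  (3 * K + 2 * stein_rate) * (1 + z) ^+ 2 * b.
Proof.
move=> K0K DK; pose dl := K * b.
have dl0 : 0 < dl by rewrite mulr_gt0// (lt_le_trans K00).
have D12 : D <= D ^+ 2 by rewrite expr2 ler_peMr; have := D1; lra.
pose Q := (4 * K + 2 * stein_rate) * (1 + z) ^+ 2 * b.
have HQ x : Ex (fun w => expR (- (`|V w - x| / dl))) <= Q by exact: concentration.
have := @stein_bound _ K z 0 Q (@continuous_laplace_test _ z dl)
  (fun t => laplace_test01 t z0 dl0) K0K _ z0 _ _ HQ.
move=> /(_ _ _ _)/le_trans; apply.
- have : 0 <= D ^+ 2 by exact: sqr_ge0.
  lra.
- lra.
- by move=> u v; exact: laplace_test_modulus.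
have h1 := gauss_mean_laplace_test z0 dl0.
have h2 : 4 * D ^+ 2 / K * Q <= 1 / 2 * Q.
  rewrite ler_wpM2r//.
    by apply: le_trans (HQ 0); apply: Ex_ge0 => w; exact: expR_ge0.
  rewrite ler_pdivrMr ?(lt_le_trans K00)//; lra.
have zq : 1 <= (1 + z) ^+ 2 by rewrite -[leLHS](expr1n _ 2) ler_sqr ?nnegrE; have := z0; lra.
have h3 : dl <= K * (1 + z) ^+ 2 * b.
  rewrite /dl ler_wpM2r ?(ltW b0)// ler_peMr//.
  by rewrite ltW// (lt_le_trans K00).
move: h1 h2 h3; rewrite /Q; clearbody dl; lra.
Qed.

End stein_bound.

(** * Taylor remainders of the exponential and exponential moments *)

Section exponential_taylor.
Context {R : realType}.
Implicit Types x s h : R.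

Lemma norm_le_derive (F F' : R -> R) (B s : R) : F 0 = 0 ->
  (forall x : R, is_derive x 1 F (F' x)) ->
  (forall x, `|x| <= `|s| -> `|F' x| <= B) -> `|F s| <= B * `|s|.
Proof.
move=> F0 dF FB.
have cF (u v : R) : {within `[u, v], continuous F}.
  apply: continuous_subspaceT => x.
  by have [/derivable1_diffP/differentiable_continuous] := dF x.
have [s0|/ltW s0] := leP 0 s.
  have [c] := MVT_segment s0 (fun c _ => dF c) (cF _ _).
  rewrite in_itv/= F0 !subr0 => /andP[c0 cs] ->.
  by rewrite normrM ler_wpM2r// FB// !ger0_norm.
have [c] := MVT_segment s0 (fun c _ => dF c) (cF _ _).
rewrite in_itv/= F0 !sub0r => /andP[c0 cs] /eqP; rewrite eqr_oppLR => /eqP ->.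
rewrite normrN normrM normrN ler_wpM2r// FB// !ler0_norm// lerN2//.
Qed.

Lemma norm_expR_taylor1 s : `|expR s - 1 - s| <= `|s| ^+ 2 * expR `|s|.
Proof.
have -> : `|s| ^+ 2 * expR `|s| = (`|s| * expR `|s|) * `|s| by ring.
apply: (@norm_le_derive (fun s => expR s - 1 - s) (fun s => expR s - 1)).
- by rewrite expR0; lra.
- by move=> x; apply: is_derive_eq; rewrite /GRing.scale/=; lra.
- move=> x xs; apply: le_trans (norm_expRB1 (lexx _)) _.
  by rewrite ler_pM ?expR_ge0// ler_expR.
Qed.

Lemma norm_expR_taylor2 s : `|expR s - 1 - s - s ^+ 2 / 2| <= `|s| ^+ 3 * expR `|s|.
Proof.
have -> : `|s| ^+ 3 * expR `|s| = (`|s| ^+ 2 * expR `|s|) * `|s| by ring.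
apply: (@norm_le_derive (fun s => expR s - 1 - s - s ^+ 2 / 2) (fun s => expR s - 1 - s)).
- by rewrite expR0; lra.
- by move=> x; apply: is_derive_eq; rewrite /GRing.scale/=; lra.
- move=> x xs; apply: le_trans (norm_expR_taylor1 _) _.
  by rewrite ler_pM ?exprn_ge0 ?expR_ge0 ?ler_expR// lerXn2r ?nnegrE.
Qed.

(** From u^k <= k! exp(u) at u = t1 |x| / 2, with 3! = 6 and a base above 1 so that one constant
    serves all [k <= 3]. Only half of the exponent t1 is used. *)
Definition moment_const (t1 : R) : R := 6 * (1 + 2 / t1) ^+ 3.

Lemma moment_const_ge1 t1 : 0 < t1 -> 1 <= moment_const t1.
Proof.
move=> t0; have h : 0 <= 2 / t1 by rewrite divr_ge0// ltW.
have : 1 <= (1 + 2 / t1) ^+ 3 by rewrite exprn_ege1//; lra.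
rewrite /moment_const; lra.
Qed.

Lemma power_le_expR t1 x k : 0 < t1 -> (k <= 3)%N ->
  `|x| ^+ k <= moment_const t1 * expR (t1 * `|x| / 2).
Proof.
move=> t0 k3; set u := t1 * `|x| / 2.
have u0 : 0 <= u by rewrite divr_ge0// mulr_ge0// ltW.
have r0 : 0 <= 2 / t1 by rewrite divr_ge0// ltW.
have e1 : 1 <= expR u by rewrite -expR0 ler_expR.
case: k k3 => [_|k k3].
  by rewrite expr0; have := moment_const_ge1 t0; nra.
have -> : `|x| = 2 / t1 * u by rewrite /u; field; rewrite gt_eqF.
have h := expR_ge1Dxn k u0.
have f0 : 0 < (k.+1)`!%:R :> R by rewrite ltr0n fact_gt0.
have h' : u ^+ k.+1 <= (k.+1)`!%:R * expR u.
  by rewrite -ler_pdivrMl// mulrC; lra.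
rewrite exprMn /moment_const.
have f6 : (k.+1)`!%:R <= 6 :> R.
  by rewrite (ler_nat R _ 6); case: k k3 {h h' f0} => [|[|[|]]].
have p : (2 / t1) ^+ k.+1 <= (1 + 2 / t1) ^+ 3.
  apply: (@le_trans _ _ ((1 + 2 / t1) ^+ k.+1)).
    by rewrite lerXn2r ?nnegrE//; lra.
  by rewrite ler_weXn2l//; lra.
apply: (@le_trans _ _ ((1 + 2 / t1) ^+ 3 * (6 * expR u))); last by rewrite mulrCA mulrA.
rewrite ler_pM ?exprn_ge0//; apply: le_trans h' _.
by rewrite ler_wpM2r// expR_ge0.
Qed.

End exponential_taylor.

(** * Expectations under a change of measure *)

Section density.
Context d (T : measurableType d) (R : realType) (P Q : probability T R).
Variable rho : T -> R.
Hypotheses (mrho : measurable_fun setT rho) (rho0 : forall w, 0 <= rho w).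
Hypothesis QE : forall f : T -> \bar R, measurable_fun setT f ->
    (forall w, 0 <= f w)%E -> (\int[Q]_w f w = \int[P]_w (f w * (rho w)%:E))%E.

Lemma density_L1 (f : T -> R) : measurable_fun setT f ->
  L1 P (fun w => f w * rho w) -> L1 Q f.
Proof.
move=> mf /integrableP[_ fr]; apply/integrableP; split; first exact/measurable_EFinP.
rewrite QE//; last by apply: measurableT_comp => //; exact/measurable_EFinP.
apply: le_lt_trans fr; rewrite le_eqVlt; apply/orP; left; apply/eqP.
apply: eq_integral => w _ /=.
by rewrite normrM (ger0_norm (rho0 w)) EFinM.
Qed.

Let ge0_density_Ex (f : T -> R) : measurable_fun setT f -> (forall w, 0 <= f w) ->
  Ex Q f = Ex P (fun w => f w * rho w).
Proof.
move=> mf f0; rewrite /Ex /Rintegral QE//; first exact/measurable_EFinP.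
Qed.

(** Positive and negative parts reduce this to nonnegative functions, for which [QE] is
    available. *)
Lemma density_Ex (f : T -> R) : measurable_fun setT f ->
  L1 P (fun w => f w * rho w) -> Ex Q f = Ex P (fun w => f w * rho w).
Proof.
move=> mf Lf; have Lq := density_L1 mf Lf.
pose fp w := Num.max (f w) 0; pose fm w := Num.max (- f w) 0.
have mfp : measurable_fun setT fp by apply: measurable_maxr.
have mfm : measurable_fun setT fm by apply: measurable_maxr => //; exact: measurableT_comp.
have fp0 w : 0 <= fp w by rewrite le_max lexx orbT.
have fm0 w : 0 <= fm w by rewrite le_max lexx orbT.
have fpn w : `|fp w| <= `|f w|.
  by rewrite ger0_norm// ge_max ler_norm normr_ge0.
have fmn w : `|fm w| <= `|f w|.
  by rewrite ger0_norm// ge_max normr_ge0 andbT -normrN ler_norm.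
have fE w : f w = fp w - fm w.
  by rewrite /fp /fm; have [a|a] := leP (f w) 0; have [b|b] := leP (- f w) 0; lra.
have Lpp : L1 P (fun w => fp w * rho w).
  apply: (L1_le _ _ (L1_norm Lf)); first exact: measurable_funM.
  by move=> w; rewrite !normrM ler_wpM2r.
have Lpm : L1 P (fun w => fm w * rho w).
  apply: (L1_le _ _ (L1_norm Lf)); first exact: measurable_funM.
  by move=> w; rewrite !normrM ler_wpM2r.
have -> : Ex Q f = Ex Q (fun w => fp w - fm w) by congr Ex; apply/funext => w.
have -> : (fun w => f w * rho w) = (fun w => fp w * rho w - fm w * rho w).
  by apply/funext => w; rewrite {1}fE mulrBl.
rewrite !ExB//; [|exact: density_L1|exact: density_L1].
by rewrite !ge0_density_Ex.
Qed.
End density.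

Section events.
Context d (T : measurableType d) (R : realType) (P : probability T R).

Lemma L1_indic (A : set T) : measurable A -> L1 P (\1_A : T -> R).
Proof. by move=> mA; exact: integrable_indic. Qed.

Lemma Ex_indic (A : set T) : measurable A -> (Ex P (\1_A : T -> R))%:E = P A.
Proof.
move=> mA; rewrite /Ex /Rintegral integral_indic// setIT fineK//.
exact: fin_num_measure.
Qed.

Lemma independent2_comp (X Y : T -> R) (a b : R -> R) :
  measurable_fun setT a -> measurable_fun setT b -> independent2 P X Y ->
  independent2 P (fun w => a (X w)) (fun w => b (Y w)).
Proof.
move=> ma mb XY A B mA mB.
have := XY (a @^-1` A) (b @^-1` B); apply.
  by rewrite -[X in measurable X]setTI; exact: ma.
by rewrite -[X in measurable X]setTI; exact: mb.
Qed.
End events.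

(** * Moderate deviations *)

(** A bound for E |W_i|^k exp(t1 |W_i| / 2), valid for every [k <= 3]. *)
Definition cramer_moment {R : realType} (t1 M : R) : R := moment_const t1 * M.

(** The constant [D] of [tilted_sum]. The middle factor arises from dividing tilted moments by the
    generating function of W_i; the last one dominates theta^-k for [k <= 3]. *)
Definition cramer_D {R : realType} (theta t1 M : R) : R :=
  let A := cramer_moment t1 M in
  A * (1 + t1 + A * t1 + A * t1 ^+ 2) * (1 + theta^-1) ^+ 3.

(** The first term is the scale [K0] at which the weight exp(|X_i| / (K0 b)) is exp(t1 |W_i| / 4);
    the second secures [8 * D ^+ 2 <= K]. *)
Definition cramer_K {R : realType} (theta t1 M : R) : R :=
  4 / (theta * t1) + 8 * cramer_D theta t1 M ^+ 2.

(** Here [a] is the third-order error in the normalizing constant and [c] the Stein error divided by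
    the Mills lower bound; the value is what remains of (1 + a e^a y)(1 + c y) - 1 for 0 <= y <= 1,
    after division by y. *)
Definition cramer_rate {R : realType} (theta t1 M : R) : R :=
  let a := cramer_moment t1 M / theta ^+ 3 in
  let c := (3 * cramer_K theta t1 M + 2 * stein_rate (cramer_D theta t1 M)) *
           (expR (3 / 2) / normal_peak 1) in
  a * expR a + c + a * expR a * c.

Section cramer.
Context d (T : measurableType d) (R : realType) (P : probability T R).
Variables (n : nat) (W : 'I_n -> T -> R) (theta t1 M : R).

Record summands : Prop := Summands {
  sm_meas : forall i, measurable_fun setT (W i) ;
  sm_ind : mutually_independent P W ;
  sm_theta : 0 < theta ;
  sm_t1 : 0 < t1 ;
  sm_mean : forall i, Ex P (W i) = 0 ;
  sm_var : \sum_(i < n) Ex P (fun w => W i w ^+ 2) = n%:R * theta ^+ 2 ;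
  sm_L1 : forall i, L1 P (fun w => expR (t1 * `|W i w|)) ;
  sm_exp : forall i, Ex P (fun w => expR (t1 * `|W i w|)) <= M }.

Hypothesis HW : summands.
Variables z b : R.
Hypotheses (b0 : 0 < b) (nb : n%:R * b ^+ 2 = 1) (z0 : 0 <= z).
Hypotheses (zb3 : (1 + z) ^+ 3 * b <= 1) (zb : z * b <= theta * t1 / 4).

Let mW := sm_meas HW.
Let th0 := sm_theta HW.
Let t10 := sm_t1 HW.
(** The tilt, normalized by n h^2 theta^2 = z^2. The hypothesis [zb] keeps it within a quarter of
    the available exponent. *)
Let h := z * b / theta.
Let h0 : 0 <= h. Proof. by rewrite divr_ge0// ?mulr_ge0// ltW. Qed.
Let ht : h <= t1 / 4.
Proof. by rewrite /h ler_pdivrMr// mulrAC [t1 * _]mulrC. Qed.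

Let A := cramer_moment t1 M.

Let M1 : 1 <= M.
Proof.
have i : 'I_n.
  case: n nb => [|m _]; last exact: ord0.
  by rewrite mul0r => /esym/eqP; rewrite oner_eq0.
apply: le_trans (sm_exp HW i); rewrite -[leLHS](Ex_cst P).
apply: le_Ex; [exact: L1_cst|exact: sm_L1|].
by move=> w; rewrite -expR0 ler_expR mulr_ge0// ltW.
Qed.

Let A1 : 1 <= A.
Proof. by have := M1; have := moment_const_ge1 t10; rewrite /A /cramer_moment; nra. Qed.

Let mexp (c : R) i : measurable_fun setT (fun w => expR (c * `|W i w|)).
Proof.
apply: measurableT_comp => //; apply: measurable_funM => //; exact: measurableT_comp.
Qed.

(* All moments below are dominated by [moment_const t1 * expR (t1 |W_i|)]. *)
Let L1dom (f : T -> R) i k : (k <= 3)%N -> measurable_fun setT f ->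
  (forall w, `|f w| <= `|W i w| ^+ k * expR (t1 / 2 * `|W i w|)) ->
  L1 P f /\ Ex P (fun w => `|f w|) <= A.
Proof.
move=> k3 mf fk.
have fM w : `|f w| <= moment_const t1 * expR (t1 * `|W i w|).
  apply: le_trans (fk w) _; have := power_le_expR (W i w) t10 k3 => H.
  apply: (@le_trans _ _ (moment_const t1 * expR (t1 * `|W i w| / 2) * expR (t1 / 2 * `|W i w|))).
    by rewrite ler_wpM2r// expR_ge0.
  rewrite -mulrA -expRD le_eqVlt; apply/orP; left; apply/eqP.
  by congr (_ * expR _); field.
have LM := L1Z (moment_const t1) (sm_L1 HW i).
have Lf := L1_le mf fM LM; split=> //.
apply: (@le_trans _ _ (Ex P (fun w => moment_const t1 * expR (t1 * `|W i w|)))).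
  by apply: le_Ex => //; exact: L1_norm.
rewrite ExZ; last exact: sm_L1.
by rewrite ler_wpM2l ?(sm_exp HW)//; have := moment_const_ge1 t10; lra.
Qed.

Let Exdom (f : T -> R) i k : (k <= 3)%N -> measurable_fun setT f ->
  (forall w, `|f w| <= `|W i w| ^+ k * expR (t1 / 2 * `|W i w|)) ->
  `|Ex P f| <= A.
Proof.
move=> k3 mf fk; have [Lf Ef] := L1dom k3 mf fk.
by apply: le_trans Ef; apply: Ex_norm_le => //; exact: L1_norm.
Qed.

Let e_hW c x : 0 <= c <= t1 / 4 -> expR (c * x) <= expR (t1 / 4 * `|x|).
Proof.
move=> /andP[c0 ct]; rewrite ler_expR; apply: (@le_trans _ _ (c * `|x|)).
  by rewrite ler_wpM2l// ler_norm.
by rewrite ler_wpM2r.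
Qed.

Let e14 (x : R) : expR (t1 / 4 * `|x|) <= expR (t1 / 2 * `|x|).
Proof. by rewrite ler_expR ler_wpM2r//; have := t10; lra. Qed.

Let e44 (x : R) : expR (t1 / 4 * `|x|) * expR (t1 / 4 * `|x|) = expR (t1 / 2 * `|x|).
Proof. by rewrite -expRD; congr expR; lra. Qed.

Let ehW x : expR (h * x) <= expR (t1 / 4 * `|x|).
Proof. by apply: e_hW; rewrite h0 ht. Qed.

Let ehWn (x : R) : expR `|h * x| <= expR (t1 / 2 * `|x|).
Proof.
rewrite normrM (ger0_norm h0); apply: le_trans (e14 x).
by have := @e_hW h `|x|; rewrite normr_id; apply; rewrite h0 ht.
Qed.

Let mhW i : measurable_fun setT (fun w => expR (h * W i w)).
Proof. by apply: measurableT_comp => //; exact: measurable_funM. Qed.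

Let mWk i k : measurable_fun setT (fun w => W i w ^+ k).
Proof. exact: measurable_funX. Qed.

Let L1W i : L1 P (W i).
Proof.
have [] // := @L1dom (W i) i 1 isT (mW i).
by move=> w; rewrite expr1 ler_peMr// -expR0 ler_expR mulr_ge0// divr_ge0// ltW.
Qed.

Let L1W2 i : L1 P (fun w => W i w ^+ 2) /\ `|Ex P (fun w => W i w ^+ 2)| <= A.
Proof.
have H w : `|W i w ^+ 2| <= `|W i w| ^+ 2 * expR (t1 / 2 * `|W i w|).
  by rewrite normrX ler_peMr ?exprn_ge0// -expR0 ler_expR mulr_ge0// divr_ge0// ltW.
split; first by have [] := L1dom (k := 2) isT (mWk i 2) H.
exact: (Exdom (k := 2) isT (mWk i 2) H).
Qed.

Let L1hW i k : (k <= 3)%N -> L1 P (fun w => W i w ^+ k * expR (h * W i w)).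
Proof.
move=> k3; have mf : measurable_fun setT (fun w => W i w ^+ k * expR (h * W i w)).
  by apply: measurable_funM.
have [] // := @L1dom _ i k k3 mf.
move=> w; rewrite normrM normrX (ger0_norm (expR_ge0 _)) ler_wpM2l ?exprn_ge0//.
exact: le_trans (ehW _) (e14 _).
Qed.

Let Lh i := Ex P (fun w => expR (h * W i w)).
Let L1Lh i : L1 P (fun w => expR (h * W i w)).
Proof. by have := @L1hW i 0 isT; under eq_fun do rewrite expr0 mul1r. Qed.

Let var i := Ex P (fun w => W i w ^+ 2).
Let var0 i : 0 <= var i <= A.
Proof.
apply/andP; split; first by apply: Ex_ge0 => w; exact: sqr_ge0.
by have [_] := L1W2 i; exact: le_trans (ler_norm _).
Qed.

Let Lh_ge1 i : 1 <= Lh i.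
Proof.
have LL : L1 P (fun w => h * W i w) by exact: L1Z.
have -> : 1 = Ex P (fun w => 1 + h * W i w).
  by rewrite ExD//; [rewrite Ex_cst ExZ// (sm_mean HW) mulr0 addr0|exact: L1_cst].
apply: le_Ex => //; first by apply: L1D => //; exact: L1_cst.
by move=> w; exact: expR_ge1Dx.
Qed.

Let third_moment i (f := fun w => `|W i w| ^+ 3 * expR (t1 / 2 * `|W i w|)) :
  L1 P f /\ Ex P f <= A.
Proof.
have mf : measurable_fun setT f.
  by apply: measurable_funM => //; apply: measurable_funX; exact: measurableT_comp.
have nf w : `|f w| <= f w.
  by rewrite ger0_norm// mulr_ge0 ?exprn_ge0 ?expR_ge0.
have [L3 _] := L1dom (k := 3) isT mf nf; split => //.
exact: le_trans (ler_norm _) (Exdom (k := 3) isT mf nf).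
Qed.

Let Lh_taylor i : Lh i <= 1 + h ^+ 2 * var i / 2 + h ^+ 3 * A.
Proof.
have LL : L1 P (fun w => h * W i w) by exact: L1Z.
have L2 : L1 P (fun w => h ^+ 2 / 2 * W i w ^+ 2) by apply: L1Z; have [] := L1W2 i.
have [L3 E3] := third_moment i.
have LL3 := L1Z (h ^+ 3) L3.
apply: (@le_trans _ _ (Ex P (fun w => (1 + h * W i w + h ^+ 2 / 2 * W i w ^+ 2) +
    h ^+ 3 * (`|W i w| ^+ 3 * expR (t1 / 2 * `|W i w|))))).
  apply: le_Ex => //.
    by apply: L1D => //; apply: L1D => //; apply: L1D => //; exact: L1_cst.
  move=> w; have := norm_expR_taylor2 (h * W i w); rewrite ler_norml => /andP[_].
  have : `|h * W i w| ^+ 3 * expR `|h * W i w| <=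
      h ^+ 3 * (`|W i w| ^+ 3 * expR (t1 / 2 * `|W i w|)).
    rewrite {1}normrM (ger0_norm h0) exprMn -[leLHS]mulrA ler_wpM2l ?exprn_ge0//.
    by rewrite ler_wpM2l ?exprn_ge0.
  have -> : (h * W i w) ^+ 2 / 2 = h ^+ 2 / 2 * W i w ^+ 2 by rewrite exprMn; ring.
  lra.
rewrite ExD//; last by apply: L1D => //; apply: L1D => //; exact: L1_cst.
rewrite ExD//; last by apply: L1D => //; exact: L1_cst.
rewrite ExD//; last exact: L1_cst.
rewrite Ex_cst !ExZ//; last by have [] := L1W2 i.
by rewrite (sm_mean HW) mulr0 addr0 -/(var i) mulrAC lerD2l ler_wpM2l ?exprn_ge0.
Qed.

Let E1_taylor i : `|Ex P (fun w => W i w * expR (h * W i w)) - h * var i| <= h ^+ 2 * A.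
Proof.
have L1' : L1 P (fun w => W i w * expR (h * W i w)) by exact: (@L1hW i 1).
have L2 : L1 P (fun w => h * W i w ^+ 2) by apply: L1Z; have [] := L1W2 i.
have [L3 E3] := third_moment i.
have LL3 := L1Z (h ^+ 2) L3.
have -> : Ex P (fun w => W i w * expR (h * W i w)) - h * var i =
    Ex P (fun w => W i w * expR (h * W i w) - W i w - h * W i w ^+ 2).
  rewrite ExB//; last exact: L1B.
  by rewrite ExB// (sm_mean HW) subr0 ExZ//; have [] := L1W2 i.
apply: (@le_trans _ _ (Ex P (fun w => h ^+ 2 * (`|W i w| ^+ 3 * expR (t1 / 2 * `|W i w|))))).
  apply: Ex_norm_le => //; first by apply: L1B => //; exact: L1B.
  move=> w.
  have -> : W i w * expR (h * W i w) - W i w - h * W i w ^+ 2 =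
    W i w * (expR (h * W i w) - 1 - h * W i w) by ring.
  rewrite normrM.
  apply: (@le_trans _ _ (`|W i w| * (`|h * W i w| ^+ 2 * expR (t1 / 2 * `|W i w|)))).
    rewrite ler_wpM2l//; apply: le_trans (norm_expR_taylor1 _) _.
    by rewrite ler_wpM2l ?exprn_ge0.
  rewrite normrM (ger0_norm h0) exprMn le_eqVlt; apply/orP; left; apply/eqP; ring.
by rewrite ExZ// ler_wpM2l ?exprn_ge0.
Qed.

Let E2_taylor i : `|Ex P (fun w => W i w ^+ 2 * expR (h * W i w)) - var i| <= h * A.
Proof.
have L1' : L1 P (fun w => W i w ^+ 2 * expR (h * W i w)) by exact: (@L1hW i 2).
have L2 : L1 P (fun w => W i w ^+ 2) by have [] := L1W2 i.
have [L3 E3] := third_moment i.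
have LL3 := L1Z h L3.
rewrite -ExB//.
apply: (@le_trans _ _ (Ex P (fun w => h * (`|W i w| ^+ 3 * expR (t1 / 2 * `|W i w|))))).
  apply: Ex_norm_le => //; first exact: L1B.
  move=> w.
  have -> : W i w ^+ 2 * expR (h * W i w) - W i w ^+ 2 =
    W i w ^+ 2 * (expR (h * W i w) - 1) by ring.
  rewrite normrM normrX.
  apply: (@le_trans _ _ (`|W i w| ^+ 2 * (`|h * W i w| * expR (t1 / 2 * `|W i w|)))).
    rewrite ler_wpM2l ?exprn_ge0//; apply: le_trans (norm_expRB1 (lexx _)) _.
    by rewrite ler_wpM2l.
  rewrite normrM (ger0_norm h0) le_eqVlt; apply/orP; left; apply/eqP; ring.
by rewrite ExZ// ler_wpM2l.
Qed.

Let S w := \sum_(i < n) W i w.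
Let Si i w := S w - W i w.
Let mS : measurable_fun setT S.
Proof. exact: measurable_sum. Qed.
Let mSi i : measurable_fun setT (Si i).
Proof. exact: measurable_funB. Qed.

Let Z := Ex P (fun w => expR (h * S w)).

Let mea (c : R) : measurable_fun setT (fun x : R => expR (c * x)).
Proof. by apply: measurableT_comp => //; exact: measurable_funM. Qed.

Let Zprod : L1 P (fun w => expR (h * S w)) /\ Z = \prod_(i < n) Lh i.
Proof.
have [] := independent_prod_Rintegral mW (sm_ind HW) (mea h) _ _ L1Lh (s := index_enum 'I_n) _.
- by move=> x y; rewrite mulrDr expRD.
- by rewrite mulr0 expR0.
- exact: index_enum_uniq.
by [].
Qed.

Let Z_ge1 : 1 <= Z.
Proof. rewrite Zprod.2; apply: (big_ind (fun x => 1 <= x)) => // x y.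
exact: mulr_ege1. Qed.

(** Each factor is at most 1 + u <= exp(u) with u its Taylor bound. The variances sum to n theta^2,
    so the quadratic parts give exactly z^2/2. *)
Let Z_le : Z <= expR (z ^+ 2 / 2 + z ^+ 3 * b * A / theta ^+ 3).
Proof.
rewrite Zprod.2.
have -> : z ^+ 2 / 2 + z ^+ 3 * b * A / theta ^+ 3 =
    \sum_(i < n) (h ^+ 2 * var i / 2 + h ^+ 3 * A).
  rewrite big_split/= sumr_const card_ord -mulr_suml -mulr_sumr (sm_var HW).
  rewrite -[h ^+ 3 * A *+ n]mulr_natl.
  have e1 : z ^+ 2 = h ^+ 2 * (n%:R * theta ^+ 2).
    have -> : h ^+ 2 * (n%:R * theta ^+ 2) = z ^+ 2 * (n%:R * b ^+ 2).
      by rewrite /h; field; rewrite gt_eqF.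
    by rewrite nb mulr1.
  have e2 : z ^+ 3 * b * A / theta ^+ 3 = n%:R * (h ^+ 3 * A).
    have -> : n%:R * (h ^+ 3 * A) = z ^+ 3 * b * A / theta ^+ 3 * (n%:R * b ^+ 2).
      by rewrite /h; field; rewrite gt_eqF.
    by rewrite nb mulr1.
  by rewrite -e1 e2.
rewrite expR_sum; apply: ler_prod => i _; apply/andP; split.
  by apply: le_trans (Lh_ge1 i).
apply: le_trans (Lh_taylor i) _; rewrite -addrA; exact: expR_ge1Dx.
Qed.

Let indSi i : independent2 P (W i) (Si i).
Proof. exact: (independent2_leave_one_out mW (sm_ind HW)). Qed.

Let Zi i := Ex P (fun w => expR (h * Si i w)).

Let L1Zi i : L1 P (fun w => expR (h * Si i w)).
Proof.
have [] := independent_prod_Rintegral mW (sm_ind HW) (mea h) _ _ L1Lh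
  (s := [seq j <- enum 'I_n | j != i]) _.
- by move=> x y; rewrite mulrDr expRD.
- by rewrite mulr0 expR0.
- by rewrite filter_uniq// enum_uniq.
move=> + _; congr (L1 P _); apply/funext => w; congr (expR (h * _)).
rewrite /Si /S big_filter big_enum_cond/= [in RHS](bigD1 i)//=.
by rewrite addrAC subrr add0r.
Qed.

Let Z_split i : Z = Lh i * Zi i.
Proof.
have [_ E] := independent2_Ex (mW i) (mSi i) (@indSi i) (mea h) (mea h) (L1Lh i) (L1Zi i).
rewrite -E; congr Ex; apply/funext => w; rewrite -expRD -mulrDr.
by rewrite /Si addrC subrK.
Qed.

(** * The exponentially tilted law *)

Section tilted.
Variable Q : probability T R.
Let rho w := expR (h * S w) / Z.
Hypothesis QE : forall f : T -> \bar R, measurable_fun setT f ->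
    (forall w, 0 <= f w)%E -> (\int[Q]_w f w = \int[P]_w (f w * (rho w)%:E))%E.

Let Z0 : 0 < Z. Proof. by have := Z_ge1; lra. Qed.

Let mrho : measurable_fun setT rho.
Proof.
by apply: measurable_funM => //; exact: (measurableT_comp (mea h) mS).
Qed.

Let rho0 w : 0 <= rho w.
Proof. by rewrite divr_ge0 ?expR_ge0// ltW. Qed.

(** The density is the product of exp(h W_i) / Lh_i and exp(h (S - W_i)) / Zi_i, each of which is a
    density, so the tilt acts separately on the two independent parts. *)
Let tilt_pair i (a c : R -> R) : measurable_fun setT a -> measurable_fun setT c ->
  L1 P (fun w => a (W i w) * expR (h * W i w)) ->
  L1 P (fun w => c (Si i w) * expR (h * Si i w)) ->
  L1 Q (fun w => a (W i w) * c (Si i w)) /\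
  Ex Q (fun w => a (W i w) * c (Si i w)) =
  (Ex P (fun w => a (W i w) * expR (h * W i w)) / Lh i) *
  (Ex P (fun w => c (Si i w) * expR (h * Si i w)) / Zi i).
Proof.
move=> ma mc La Lc.
have ma' : measurable_fun setT (fun x => a x * expR (h * x)) by exact: measurable_funM.
have mc' : measurable_fun setT (fun x => c x * expR (h * x)) by exact: measurable_funM.
have [L E] := independent2_Ex (mW i) (mSi i) (@indSi i) ma' mc' La Lc.
have eqf : (fun w => a (W i w) * c (Si i w) * rho w) = (fun w =>
    Z^-1 * ((a (W i w) * expR (h * W i w)) * (c (Si i w) * expR (h * Si i w)))).
  apply/funext => w; rewrite /rho.
  have -> : expR (h * S w) = expR (h * W i w) * expR (h * Si i w).
    by rewrite -expRD -mulrDr /Si [W i w + _]addrC subrK.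
  ring.
have mac : measurable_fun setT (fun w => a (W i w) * c (Si i w)).
  by apply: measurable_funM; apply: measurableT_comp.
have Lr : L1 P (fun w => a (W i w) * c (Si i w) * rho w) by rewrite eqf; exact: L1Z.
split; first exact: (density_L1 rho0 QE).
rewrite (density_Ex mrho rho0 QE)// eqf ExZ// E (Z_split i).
have l0 := Lh_ge1 i; have := Z0; rewrite (Z_split i) => p0.
have z1 : Zi i != 0 by apply: contraTneq p0 => ->; rewrite mulr0 ltxx.
by field; rewrite z1 gt_eqF; lra.
Qed.

Let Zi0 i : 0 < Zi i.
Proof. by have := Z0; rewrite (Z_split i) pmulr_rgt0//; have := Lh_ge1 i; lra. Qed.

Let tilt_Ex i (a : R -> R) : measurable_fun setT a ->
  L1 P (fun w => a (W i w) * expR (h * W i w)) ->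
  L1 Q (fun w => a (W i w)) /\
  Ex Q (fun w => a (W i w)) = Ex P (fun w => a (W i w) * expR (h * W i w)) / Lh i.
Proof.
move=> ma La.
have e1 : (fun w => 1 * expR (h * Si i w)) = (fun w => expR (h * Si i w)).
  by apply/funext => w; rewrite mul1r.
have e2 : (fun w => a (W i w) * 1) = (fun w => a (W i w)).
  by apply/funext => w; rewrite mulr1.
have Lc : L1 P (fun w => 1 * expR (h * Si i w)) by rewrite e1.
have [L E] := @tilt_pair i a (fun=> 1) ma (measurable_cst _) La Lc.
by move: L E; rewrite e1 e2 -/(Zi i) divff ?mulr1// gt_eqF.
Qed.

(** [tilt_pair] on two indicators, compared with the same identity when either indicator is replaced
    by 1. *)
Let indQ i : independent2 Q (W i) (Si i).
Proof.
move=> B C mB mC.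
have mWB : measurable (W i @^-1` B) by rewrite -[X in measurable X]setTI; exact: mW.
have mSC : measurable (Si i @^-1` C) by rewrite -[X in measurable X]setTI; exact: mSi.
have mi (D : set R) : measurable D -> measurable_fun setT (\1_D : R -> R).
  exact: measurable_indic.
have ind1 (D : set R) (x : R) : `|(\1_D : R -> R) x| <= 1.
  by rewrite indicE ger0_norm// lern1 leq_b1.
have LB : L1 P (fun w => (\1_B : R -> R) (W i w) * expR (h * W i w)).
  apply: (L1_le _ _ (L1Lh i)).
    by apply: measurable_funM => //; apply: measurableT_comp => //; exact: mi.
  by move=> w; rewrite normrM (ger0_norm (expR_ge0 _)) ler_piMl// expR_ge0.
have LC : L1 P (fun w => (\1_C : R -> R) (Si i w) * expR (h * Si i w)).
  apply: (L1_le _ _ (L1Zi i)).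
    apply: measurable_funM => //; first by apply: measurableT_comp => //; exact: mi.
    exact: (measurableT_comp (mea h) (mSi i)).
  by move=> w; rewrite normrM (ger0_norm (expR_ge0 _)) ler_piMl// expR_ge0.
have LT1 (Y : T -> R) (y : R) : (fun w => (fun=> 1) (Y w) * expR (y * Y w)) = (fun w => expR (y * Y w)).
  by apply/funext => w; rewrite mul1r.
have [_ E1] := tilt_pair (mi _ mB) (mi _ mC) LB LC.
have [_ E2] := @tilt_pair i (\1_B) (fun=> 1) (mi _ mB) (measurable_cst _) LB (ltac:(rewrite LT1; exact: L1Zi)).
have [_ E3] := @tilt_pair i (fun=> 1) (\1_C) (measurable_cst _) (mi _ mC) (ltac:(rewrite LT1; exact: L1Lh)) LC.
rewrite -!Ex_indic//; last exact: measurableI.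
rewrite -EFinM; congr EFin.
transitivity (Ex Q (fun w => (\1_B : R -> R) (W i w) * (\1_C : R -> R) (Si i w))).
  by congr Ex; apply/funext => w; rewrite indicI.
rewrite E1; move: E2 E3; under eq_fun do rewrite mulr1.
under [X in _ -> Ex Q X = _ -> _]eq_fun do rewrite mul1r.
rewrite !LT1 -/(Lh i) -/(Zi i) !divff ?mulr1 ?mul1r.
- by move=> <- <-.
- by rewrite gt_eqF//; have := Lh_ge1 i; lra.
- by rewrite gt_eqF.
Qed.

Let X i w := b / theta * W i w.
Let D := cramer_D theta t1 M.
Let K0 := 4 / (theta * t1).
Let r := 1 + theta^-1.
Let A' := A * (1 + t1 + A * t1 + A * t1 ^+ 2).

Let r1 : 1 <= r. Proof. by rewrite /r lerDl invr_ge0 ltW. Qed.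
Let A'1 : A <= A'.
Proof.
have a0 : 0 <= A by have := A1; lra.
have p1 : 0 <= A * t1 by rewrite mulr_ge0// ltW.
have p2 : 0 <= A * t1 ^+ 2 by rewrite mulr_ge0// exprn_ge0// ltW.
by rewrite /A' ler_peMr//; have := t10; lra.
Qed.
Let DE : D = A' * r ^+ 3. Proof. by []. Qed.

Let thr k : (k <= 3)%N -> theta^-1 ^+ k <= r ^+ 3.
Proof.
move=> k3; apply: (@le_trans _ _ (r ^+ k)).
  by rewrite lerXn2r ?nnegrE ?invr_ge0 ?(ltW th0)//; [have := r1; lra|rewrite /r lerDr].
by rewrite ler_weXn2l.
Qed.

Let D1 : 1 <= D.
Proof.
rewrite DE; have := A1; have := A'1; have : 1 <= r ^+ 3 by rewrite exprn_ege1.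
nra.
Qed.

Let h1 : h <= t1. Proof. by have := ht; have := t10; lra. Qed.

Let bt0 : 0 < b / theta. Proof. by rewrite divr_gt0. Qed.

Let A0 : 0 <= A. Proof. by have := A1; lra. Qed.
Let hA0 : 0 <= h * A. Proof. exact: mulr_ge0. Qed.
Let hAt0 : 0 <= h * A * t1. Proof. by apply: mulr_ge0 => //; exact: ltW. Qed.
Let t11 : 0 <= 1 + t1. Proof. by have := t10; lra. Qed.
Let hAtt0 : 0 <= h * A * t1 * (1 + t1). Proof. exact: mulr_ge0. Qed.

(** With L >= 1, 1 - 1/L <= L - 1. The Taylor bound has no term of first order in h, and [h <= t1]
    trades the surplus powers of h for t1. *)
Let inv_Lh i : 0 <= 1 - (Lh i)^-1 <= h * A * t1 * (1 + t1).
Proof.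
have l1 := Lh_ge1 i; have l0 : 0 < Lh i by lra.
have i0 : 0 < (Lh i)^-1 by rewrite invr_gt0.
have li : Lh i * (Lh i)^-1 = 1 by rewrite divff// gt_eqF.
apply/andP; split; first by nra.
apply: (@le_trans _ _ (Lh i - 1)); first by nra.
have /andP[v0 vA] := var0 i; have := Lh_taylor i.
have H2 : h ^+ 2 * var i / 2 <= h * A * t1.
  have : h ^+ 2 * var i <= h * t1 * A.
    by rewrite ler_pM ?exprn_ge0// expr2 ler_wpM2l.
  have := hAt0; lra.
have H3 : h ^+ 3 * A <= h * A * t1 * t1.
  have -> : h ^+ 3 * A = h * A * (h * h) by ring.
  have -> : h * A * t1 * t1 = h * A * (t1 * t1) by ring.
  by rewrite (ler_wpM2l hA0)// ler_pM.
have -> : h * A * t1 * (1 + t1) = h * A * t1 + h * A * t1 * t1 by ring.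
lra.
Qed.

Let div_Lh i x y c : `|x - y| <= c -> `|x / Lh i - y| <= c + `|y| * (h * A * t1 * (1 + t1)).
Proof.
move=> xy; have /andP[l0 l1] := inv_Lh i.
have i0 : 0 <= (Lh i)^-1 by rewrite invr_ge0; have := Lh_ge1 i; lra.
have i1 : (Lh i)^-1 <= 1 by lra.
have -> : x / Lh i - y = (x - y) / Lh i - y * (1 - (Lh i)^-1) by ring.
apply: le_trans (ler_normB _ _) _; rewrite lerD//.
  rewrite normrM (ger0_norm i0); apply: le_trans xy.
  by rewrite ler_piMr.
by rewrite normrM (ger0_norm l0) ler_wpM2l.
Qed.

Let ExQW i : L1 Q (W i) /\ `|Ex Q (W i) - h * var i| <= h ^+ 2 * A'.
Proof.
have [L E] := @tilt_Ex i id (@measurable_id _ _ setT) (@L1hW i 1 isT).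
have E' : Ex Q (W i) = Ex P (fun w => W i w * expR (h * W i w)) / Lh i by exact: E.
split=> //; rewrite E'.
apply: le_trans (div_Lh i (E1_taylor i)) _.
have /andP[v0 vA] := var0 i.
rewrite (ger0_norm (mulr_ge0 h0 v0)) /A'.
have : h * var i * (h * A * t1 * (1 + t1)) <= h * A * (h * A * t1 * (1 + t1)).
  by rewrite (ler_wpM2r hAtt0) ?ler_wpM2l.
have : 0 <= h ^+ 2 * A * t1.
  have -> : h ^+ 2 * A * t1 = h * (h * A * t1) by ring.
  by rewrite mulr_ge0// hAt0.
have -> : h ^+ 2 * (A * (1 + t1 + A * t1 + A * t1 ^+ 2)) =
  h ^+ 2 * A + h ^+ 2 * A * t1 + h * A * (h * A * t1 * (1 + t1)) by ring.
lra.
Qed.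

Let ExQW2 i : L1 Q (fun w => W i w ^+ 2) /\
  `|Ex Q (fun w => W i w ^+ 2) - var i| <= h * A'.
Proof.
have [L E] := @tilt_Ex i (fun x => x ^+ 2) (ltac:(exact: measurable_funX)) (@L1hW i 2 isT).
split=> //; rewrite E.
apply: le_trans (div_Lh i (E2_taylor i)) _.
have /andP[v0 vA] := var0 i.
rewrite (ger0_norm v0) /A'.
have : var i * (h * A * t1 * (1 + t1)) <= A * (h * A * t1 * (1 + t1)).
  by rewrite (ler_wpM2r hAtt0).
have := hAt0.
have -> : h * (A * (1 + t1 + A * t1 + A * t1 ^+ 2)) =
  h * A + h * A * t1 + A * (h * A * t1 * (1 + t1)) by ring.
lra.
Qed.

(** Tilt and weight each cost at most exp(t1 |W_i| / 4), together the exponent t1 / 2 allowed by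
    [L1dom]; the division by [Lh i >= 1] only helps. *)
Let ExQpow i k : (k <= 3)%N ->
  L1 Q (fun w => `|X i w| ^+ k * expR (`|X i w| / (K0 * b))) /\
  Ex Q (fun w => `|X i w| ^+ k * expR (`|X i w| / (K0 * b))) <= D * b ^+ k.
Proof.
move=> k3; pose a x := `|b / theta * x| ^+ k * expR (`|b / theta * x| / (K0 * b)).
have aE x : a x = (b / theta) ^+ k * (`|x| ^+ k * expR (t1 / 4 * `|x|)).
  rewrite /a normrM (gtr0_norm bt0) exprMn mulrA; congr (_ * expR _).
  by rewrite /K0; field; rewrite !gt_eqF.
have ma0 : measurable_fun setT (fun x : R => `|x| ^+ k * expR (t1 / 4 * `|x|)).
  have mn : measurable_fun setT (fun t : R => `|t|) by exact: measurableT_comp.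
  apply: measurable_funM; first exact: measurable_funX.
  by apply: measurableT_comp => //; exact: measurable_funM.
have ma : measurable_fun setT a.
  rewrite (_ : a = fun x => (b / theta) ^+ k * (`|x| ^+ k * expR (t1 / 4 * `|x|))).
    exact: measurable_funM.
  by apply/funext => x.
have mf : measurable_fun setT (fun w => (`|W i w| ^+ k * expR (t1 / 4 * `|W i w|)) * expR (h * W i w)).
  by apply: measurable_funM => //; exact: (measurableT_comp ma0 (mW i)).
have fk w : `|(`|W i w| ^+ k * expR (t1 / 4 * `|W i w|)) * expR (h * W i w)| <=
    `|W i w| ^+ k * expR (t1 / 2 * `|W i w|).
  rewrite ger0_norm ?mulr_ge0 ?exprn_ge0 ?expR_ge0// -mulrA ler_wpM2l ?exprn_ge0//.
  by rewrite -e44 ler_wpM2l ?expR_ge0.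
have [Lf _] := L1dom k3 mf fk; have Ef := Exdom k3 mf fk.
have ahE : (fun w => a (W i w) * expR (h * W i w)) = (fun w => (b / theta) ^+ k *
    ((`|W i w| ^+ k * expR (t1 / 4 * `|W i w|)) * expR (h * W i w))).
  by apply/funext => w; rewrite aE; ring.
have La : L1 P (fun w => a (W i w) * expR (h * W i w)) by rewrite ahE; exact: L1Z.
have [L E] := tilt_Ex ma La; split=> //.
rewrite E ahE ExZ//; set e := Ex P _ in Ef *.
have l1 := Lh_ge1 i.
apply: (@le_trans _ _ ((b / theta) ^+ k * A)).
  rewrite -mulrA ler_wpM2l ?exprn_ge0 ?(ltW bt0)//.
  rewrite ler_pdivrMr; last lra.
  apply: le_trans (ler_norm _) _; apply: le_trans Ef _.
  by rewrite ler_peMr//; have := A1; lra.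
rewrite exprMn DE.
have -> : b ^+ k * theta^-1 ^+ k * A = A * theta^-1 ^+ k * b ^+ k by ring.
rewrite ler_wpM2r ?exprn_ge0 ?(ltW b0)// ler_pM ?exprn_ge0 ?invr_ge0 ?(ltW th0)//.
exact: thr.
Qed.

Let tilted : tilted_sum Q X z b D K0.
Proof.
have mX i : measurable_fun setT (X i) by exact: measurable_funM.
have XS w : \sum_(i < n) X i w = b / theta * S w by rewrite mulr_sumr.
have ExX i : Ex Q (X i) = b / theta * Ex Q (W i) by rewrite ExZ//; have [] := ExQW i.
have a'0 : 0 <= A' by have := A'1; have := A1; lra.
have tA0 k : 0 <= theta^-1 ^+ k * A'.
  by apply: (mulr_ge0 _ a'0); rewrite exprn_ge0// invr_ge0 ltW.
have tA k : (k <= 3)%N -> theta^-1 ^+ k * A' <= r ^+ 3 * A'.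
  by move=> k3; rewrite ler_wpM2r// thr.
have zb2 : (1 + z) ^+ 2 * b <= 1.
  apply: le_trans zb3; rewrite ler_wpM2r ?(ltW b0)// ler_weXn2l//; have := z0; lra.
have zz : z <= (1 + z) ^+ 2 by have := z0; nra.
have zz2 : z ^+ 2 <= (1 + z) ^+ 2 by have := z0; nra.
split => //.
- move=> i; have := independent2_comp (a := fun x => b / theta * x) (b := fun x => b / theta * x - z) _ _ (indQ i).
  have -> : (fun w => b / theta * Si i w - z) = (fun w => \sum_(j < n) X j w - z - X i w).
    by apply/funext => w; rewrite XS /Si /X; ring.
  apply; first exact: measurable_funM.
  by apply: measurable_funB => //; exact: measurable_funM.
- by rewrite divr_gt0// mulr_gt0.
- by move=> i k k3; have [] := ExQpow i k3.
- by move=> i k /andP[_ k3]; have [] := ExQpow i k3.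
- move=> i; rewrite ExX normrM (gtr0_norm bt0).
  have [_ H] := ExQW i; have /andP[v0 vA] := var0 i.
  have H1 : `|Ex Q (W i)| <= h * A'.
    have l1 := Lh_ge1 i.
    have [L E] := @tilt_Ex i id (@measurable_id _ _ setT) (@L1hW i 1 isT).
    have E' : Ex Q (W i) = Ex P (fun w => W i w * expR (h * W i w)) / Lh i by exact: E.
    rewrite E'.
    rewrite normrM normfV (ger0_norm (_ : 0 <= Lh i)); last lra.
    rewrite ler_pdivrMr; last lra.
    apply: (@le_trans _ _ (h * A')); last first.
      by rewrite ler_peMr// mulr_ge0.
    have := E1_taylor i; set e := Ex P _ => He.
    have : `|e| <= h ^+ 2 * A + h * var i.
      have -> : e = (e - h * var i) + h * var i by ring.
      apply: le_trans (ler_normD _ _) _.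
      by rewrite lerD// ger0_norm// mulr_ge0.
    have : h * var i <= h * A by rewrite ler_wpM2l.
    have : h ^+ 2 * A <= h * A * t1.
      have -> : h ^+ 2 * A = h * A * h by ring.
      by rewrite (ler_wpM2l hA0).
    have : h * A * (1 + t1) <= h * A'.
      rewrite -mulrA ler_wpM2l// /A' (ler_wpM2l A0)//.
      have : 0 <= A * t1 by exact: (mulr_ge0 A0 (ltW t10)).
      have : 0 <= A * t1 ^+ 2 by exact: (mulr_ge0 A0 (exprn_ge0 2 (ltW t10))).
      lra.
    lra.
  apply: (@le_trans _ _ (b / theta * (h * A'))); first by rewrite ler_wpM2l// ltW.
  have -> : b / theta * (h * A') = (theta^-1 ^+ 2 * A' * z) * b ^+ 2.
    by rewrite /h; field; rewrite gt_eqF.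
  rewrite ler_wpM2r ?exprn_ge0 ?(ltW b0)// DE [A' * _]mulrC.
  apply: ler_pM => //; [exact: tA|by have := z0; lra].
- under eq_bigr do rewrite ExX.
  rewrite -mulr_sumr.
  (* By the choice of [h], the first-order parts of the tilted means add up to exactly z; only terms
     of order h^2 are left to estimate. *)
  have zE : z = b / theta * \sum_(i < n) h * var i.
    rewrite -mulr_sumr (sm_var HW).
    have -> : b / theta * (h * (n%:R * theta ^+ 2)) = z * (n%:R * b ^+ 2).
      by rewrite /h; field; rewrite gt_eqF.
    by rewrite nb mulr1.
  rewrite [X in `|_ - X|]zE -mulrBr -sumrB normrM (gtr0_norm bt0).
  apply: (@le_trans _ _ (b / theta * \sum_(i < n) h ^+ 2 * A')).
    rewrite ler_wpM2l ?(ltW bt0)//; apply: le_trans (ler_norm_sum _ _ _) _.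
    by apply: ler_sum => i _; have [] := ExQW i.
  rewrite sumr_const card_ord -[_ *+ n]mulr_natl.
  have -> : b / theta * (n%:R * (h ^+ 2 * A')) = theta^-1 ^+ 3 * A' * z ^+ 2 * b * (n%:R * b ^+ 2).
    by rewrite /h; field; rewrite gt_eqF.
  rewrite nb mulr1 ler_wpM2r ?(ltW b0)// DE [A' * _]mulrC.
  by apply: ler_pM; [exact: tA0|rewrite ?exprn_ge0|exact: tA|].
- have XX i : Ex Q (fun w => X i w ^+ 2) = (b / theta) ^+ 2 * Ex Q (fun w => W i w ^+ 2).
    rewrite -ExZ; last by have [] := ExQW2 i.
    by congr Ex; apply/funext => w; rewrite /X exprMn.
  under eq_bigr do rewrite XX.
  rewrite -mulr_sumr.
  (* The untilted second moments of the X_i add up to exactly 1, and tilting perturbs each moment of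
     W_i by order h. *)
  have oneE : 1 = (b / theta) ^+ 2 * \sum_(i < n) var i.
    rewrite (sm_var HW).
    have -> : (b / theta) ^+ 2 * (n%:R * theta ^+ 2) = n%:R * b ^+ 2.
      by field; rewrite gt_eqF.
    by rewrite nb.
  rewrite [X in `|_ - X|]oneE -mulrBr -sumrB normrM (ger0_norm (sqr_ge0 _)).
  apply: (@le_trans _ _ ((b / theta) ^+ 2 * \sum_(i < n) h * A')).
    rewrite ler_wpM2l ?sqr_ge0//; apply: le_trans (ler_norm_sum _ _ _) _.
    by apply: ler_sum => i _; have [] := ExQW2 i.
  rewrite sumr_const card_ord -[_ *+ n]mulr_natl.
  have -> : (b / theta) ^+ 2 * (n%:R * (h * A')) = theta^-1 ^+ 3 * A' * z * b * (n%:R * b ^+ 2).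
    by rewrite /h; field; rewrite gt_eqF.
  rewrite nb mulr1 ler_wpM2r ?(ltW b0)// DE [A' * _]mulrC.
  by apply: ler_pM; [exact: tA0|rewrite ?exprn_ge0|exact: tA|].
Qed.

Let cK := cramer_K theta t1 M.

Lemma tilted_laplace : Ex Q (fun w => laplace_test z (cK * b) (\sum_(i < n) X i w - z)) <=
  expR (z ^+ 2 / 2) * gauss_tail z + (3 * cK + 2 * stein_rate D) * (1 + z) ^+ 2 * b.
Proof.
apply: (laplace_bound tilted).
- by rewrite /cK /cramer_K lerDl mulr_ge0 ?sqr_ge0.
- by rewrite /cK /cramer_K lerDr divr_ge0// mulr_ge0// ltW.
Qed.

Let cK0 : 0 < cK.
Proof.
rewrite /cK /cramer_K; apply: ltr_wpDr; last by rewrite divr_gt0// mulr_gt0.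
by apply: mulr_ge0 => //; exact: sqr_ge0.
Qed.

(** Undoing the tilt, P(B) = E_Q[1_B Z exp(-h S)]. With V = sum X_i - z one has h S = z V + z^2, and
    B is the event V > 0, where the test function equals exp(-z V). *)
Lemma tilted_tail : (P [set w | (theta * z / b < S w)%R] <=
  (Z * expR (- z ^+ 2) * (expR (z ^+ 2 / 2) * gauss_tail z +
    (3 * cK + 2 * stein_rate D) * (1 + z) ^+ 2 * b))%:E)%E.
Proof.
set B := [set w | _].
have mB : measurable B.
  rewrite -[X in measurable X]setTI.
  rewrite (_ : B = S @^-1` `]theta * z / b, +oo[); last first.
    by apply/seteqP; split => w; rewrite /B /= in_itv/= andbT.
  exact: mS.
have Zn0 : Z != 0 by rewrite gt_eqF.
have mg : measurable_fun setT (fun w => (\1_B : T -> R) w * (Z * expR (- h * S w))).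
  apply: measurable_funM; first exact: measurable_indic.
  by apply: measurable_funM => //; exact: (measurableT_comp (mea (- h)) mS).
have gE : (fun w => (\1_B : T -> R) w * (Z * expR (- h * S w)) * rho w) = (\1_B : T -> R).
  apply/funext => w; rewrite /rho.
  have e : expR (- h * S w) * expR (h * S w) = 1 by rewrite -expRD mulNr addNr expR0.
  transitivity ((\1_B : T -> R) w * (expR (- h * S w) * expR (h * S w)) * (Z / Z)).
    ring.
  by rewrite e divff// !mulr1.
have Lg : L1 P (fun w => (\1_B : T -> R) w * (Z * expR (- h * S w)) * rho w).
  by rewrite gE; exact: L1_indic.
rewrite -Ex_indic// -[X in Ex P X]gE -(density_Ex mrho rho0 QE)// lee_fin.
have LL : L1 Q (fun w => laplace_test z (cK * b) (\sum_(i < n) X i w - z)).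
  apply: (@L1_bounded _ _ _ _ _ 1).
    apply: measurableT_comp.
      exact: (continuous_measurable_fun (@continuous_laplace_test _ z (cK * b))).
    apply: measurable_funB => //; apply: measurable_sum => i; exact: measurable_funM.
  move=> w; have := laplace_test01 (\sum_(i < n) X i w - z) z0 (mulr_gt0 cK0 b0).
  by move=> /andP[l0 l1]; rewrite ger0_norm.
have Ze0 : 0 <= Z * expR (- z ^+ 2) by rewrite mulr_ge0 ?expR_ge0// ltW.
apply: le_trans (ler_wpM2l Ze0 tilted_laplace).
rewrite -ExZ//; apply: le_Ex; [exact: (density_L1 rho0 QE)|exact: L1Z|].
move=> w; rewrite indicE; case: (boolP (w \in B)) => [|_]; last first.
  by rewrite mul0r mulr_ge0// expR_ge0.
rewrite inE /B /= => Sw; rewrite mul1r -mulrA ler_wpM2l ?(ltW Z0)//.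
have XS : \sum_(i < n) X i w = b / theta * S w by rewrite mulr_sumr.
have V0 : 0 <= \sum_(i < n) X i w - z.
  rewrite XS subr_ge0 ltW//.
  have -> : z = b / theta * (theta * z / b) by field; rewrite !gt_eqF.
  by rewrite ltr_pM2l.
rewrite laplace_test_ge0// -expRD ler_expR XS /h le_eqVlt; apply/orP; left; apply/eqP.
by field; rewrite gt_eqF.
Qed.

End tilted.

Theorem cramer : (P [set w | (theta * z / b < S w)%R] <=
  (gauss_tail z * (1 + cramer_rate theta t1 M * ((1 + z) ^+ 3 * b)))%:E)%E.
Proof.
have Zp : 0 < Z by have := Z_ge1; lra.
have [|||Q QE] := @density_probability _ _ _ P (fun w => expR (h * S w) / Z).
- by apply: measurable_funM => //; exact: (measurableT_comp (mea h) mS).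
- by move=> w; rewrite divr_ge0 ?expR_ge0// ltW.
- have Lz : L1 P (fun w => Z^-1 * expR (h * S w)) by apply: L1Z; exact: Zprod.1.
  transitivity (Ex P (fun w => Z^-1 * expR (h * S w)))%:E; last first.
    by rewrite ExZ ?mulVf ?gt_eqF//; exact: Zprod.1.
  rewrite /Ex /Rintegral fineK; last by apply: integrable_fin_num.
  by apply: eq_integral => w _; rewrite mulrC.
apply: le_trans (tilted_tail QE) _; rewrite lee_fin.
set c1 := 3 * _ + 2 * _; set y := (1 + z) ^+ 3 * b.
have y0 : 0 <= y by rewrite mulr_ge0 ?exprn_ge0 ?(ltW b0)//; have := z0; lra.
have p0 : 0 < normal_peak (1 : R) by exact: normal_peak1_gt0.
have c10 : 0 <= c1.
  have sc := @stein_const_ge1 R.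
  have d0 : 0 <= cramer_D theta t1 M ^+ 2 by exact: sqr_ge0.
  rewrite /c1 addr_ge0// mulr_ge0//.
    rewrite /cramer_K; apply: addr_ge0; last by apply: mulr_ge0.
    by rewrite divr_ge0// mulr_ge0// ltW.
  by rewrite /stein_rate; nra.
(* [Z_le] contributes exp(z^2/2), which halves the exponent -z^2; its cubic term becomes the factor
   in y. *)
have e1 : Z * expR (- z ^+ 2) <= expR (cramer_moment t1 M / theta ^+ 3 * y) * expR (- (z ^+ 2 / 2)).
  apply: (@le_trans _ _ (expR (z ^+ 2 / 2 + z ^+ 3 * b * A / theta ^+ 3) * expR (- z ^+ 2))).
    by rewrite ler_wpM2r ?expR_ge0// Z_le.
  rewrite -!expRD ler_expR.
  have : z ^+ 3 * b * A / theta ^+ 3 <= cramer_moment t1 M / theta ^+ 3 * y.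
    have -> : z ^+ 3 * b * A / theta ^+ 3 = A / theta ^+ 3 * (z ^+ 3 * b) by ring.
    rewrite ler_wpM2l//.
      by apply: divr_ge0; [have := A1; lra|rewrite exprn_ge0// ltW].
    by rewrite ler_wpM2r ?(ltW b0)// lerXn2r ?nnegrE//; have := z0; lra.
  lra.
have t0 := gauss_tail_ge0 z.
(* The Mills lower bound makes the error relative to the tail: exp(-z^2/2) is at most a constant
   times (1 + z) [gauss_tail z], which raises (1 + z)^2 to (1 + z)^3. *)
have e2 : expR (- (z ^+ 2 / 2)) * (expR (z ^+ 2 / 2) * gauss_tail z + c1 * (1 + z) ^+ 2 * b) <=
   gauss_tail z * (1 + c1 * (expR (3 / 2) / normal_peak 1) * y).
  rewrite mulrDr mulrA -expRD addNr expR0 mul1r mulrDr mulr1 lerD2l.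
  have := normal_pdf_le_gauss_tail z0; rewrite normal_pdf01E => H.
  have -> : gauss_tail z * (c1 * (expR (3 / 2) / normal_peak 1) * y) =
     (expR (3 / 2) * (1 + z) * gauss_tail z / normal_peak 1) * (c1 * (1 + z) ^+ 2 * b).
    by rewrite /y; ring.
  rewrite ler_wpM2r//; last by rewrite ler_pdivlMr// mulrC.
  by apply: mulr_ge0; [apply: mulr_ge0 => //; exact: sqr_ge0|exact: ltW].
apply: (@le_trans _ _ (expR (cramer_moment t1 M / theta ^+ 3 * y) *
   (gauss_tail z * (1 + c1 * (expR (3 / 2) / normal_peak 1) * y)))).
  apply: le_trans (ler_wpM2r _ e1) _.
    apply: addr_ge0; first by rewrite mulr_ge0 ?expR_ge0.
    by apply: mulr_ge0; [apply: mulr_ge0 => //; exact: sqr_ge0|exact: ltW].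
  by rewrite -[leLHS]mulrA ler_wpM2l ?expR_ge0.
set a := cramer_moment t1 M / theta ^+ 3.
have a0 : 0 <= a by apply: divr_ge0; [have := A1; rewrite /A; lra|rewrite exprn_ge0// ltW].
(* The hypothesis [zb3] says y <= 1; it linearizes the exponential here and the product of the two
   errors below. *)
have e3 : expR (a * y) <= 1 + a * expR a * y.
  have ay : a * y <= a by rewrite ler_piMr.
  have ay0 : 0 <= a * y by exact: mulr_ge0.
  have := norm_expRB1 (lexx `|a * y|); rewrite (ger0_norm ay0) ler_norml => /andP[_].
  have : a * y * expR (a * y) <= a * y * expR a by rewrite ler_wpM2l// ler_expR.
  lra.
rewrite /cramer_rate -/a -/c1; set c := c1 * _; rewrite mulrCA ler_wpM2l//.
have c0 : 0 <= c by apply: mulr_ge0 => //; apply: divr_ge0; [exact: expR_ge0|exact: ltW].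
apply: (@le_trans _ _ ((1 + a * expR a * y) * (1 + c * y))).
  by rewrite ler_wpM2r// addr_ge0// mulr_ge0.
have -> : (1 + a * expR a * y) * (1 + c * y) = 1 + (a * expR a + c) * y + a * expR a * c * y * y by ring.
have ea : 0 <= a * expR a * c * y.
  by do 3 apply: mulr_ge0 => //; exact: expR_ge0.
have : a * expR a * c * y * y <= a * expR a * c * y by rewrite ler_piMr.
lra.
Qed.
End cramer.

(** * The score event *)

Section normal_quantile.
Context {R : realType}.
Local Notation mu := (@lebesgue_measure R).

Lemma continuous_Phi : continuous (@Phi R).
Proof.
move=> x.
have iu : mu.-integrable [set` `]-oo, x + 1]] (EFin \o normal_pdf (0 : R) 1).
  by apply: integrable_normal_pdf01.
have xu : x < x + 1 by rewrite ltrDl.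
have [|dF _] := continuous_FTC1 xu iu _ (@continuous_normal_pdf01 R x); first by rewrite ltNyr.
exact/differentiable_continuous/derivable1_diffP.
Qed.

Lemma Phi_tail (x : R) : Phi x = 1 - gauss_tail x.
Proof. by rewrite Phi_gauss_tail gauss_tailN. Qed.

(** [Phi_inv] is a partial inverse with default 0, so a preimage must be exhibited. The intermediate
    value theorem finds one between 0, where the tail is 1/2, and 1/u, where the Mills bound makes
    the tail at most u. *)
Lemma Phi_inv_tail (u : R) : 0 < u -> u < 1 / 2 ->
  gauss_tail (Phi_inv (1 - u)) = u /\ 0 <= Phi_inv (1 - u).
Proof.
move=> u0 u2.
have ui0 : 0 < u^-1 by rewrite invr_gt0.
have tX : gauss_tail u^-1 <= u.
  rewrite -[leRHS]mulr1 -ler_pdivrMl//; apply: le_trans (mills_mul (ltW ui0)) _.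
  exact: normal_pdf01_le1.
have [||c _ Pc] := @IVT R (@Phi R) 0 u^-1 (1 - u) (ltW ui0).
- by apply: continuous_subspaceT; exact: continuous_Phi.
- have P0 : Phi (0 : R) <= Phi u^-1.
    by rewrite !Phi_tail gauss_tail0; lra.
  rewrite (min_idPl P0) (max_idPr P0) !Phi_tail gauss_tail0; lra.
have PK : Phi (Phi_inv (1 - u)) = 1 - u.
  by rewrite /Phi_inv pinvK// inE; exists c.
have tE : gauss_tail (Phi_inv (1 - u)) = u.
  by move: PK; rewrite Phi_tail; lra.
split=> //; rewrite leNgt; apply/negP => /ltW/gauss_tail_nonincr.
rewrite tE gauss_tail0; lra.
Qed.

(** The bound tail(z) <= exp(1 - z^2/2), in logarithms. With tail alpha / 2p it yields z^2 = O(log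
    p). *)
Lemma tail_quantile_le (z : R) : 0 <= z -> 0 < gauss_tail z ->
  z ^+ 2 <= 2 + 2 * ln (gauss_tail z)^-1.
Proof.
move=> z0 t0; have := gauss_tail_le_pdf z0; rewrite normal_pdf01E.
have p0 := @normal_peak1_gt0 R.
have -> : expR 1 / normal_peak 1 * (normal_peak 1 * expR (- (z ^+ 2 / 2))) =
    expR (1 - z ^+ 2 / 2) :> R.
  by rewrite expRD; field; rewrite gt_eqF.
rewrite -ler_ln ?posrE ?expR_gt0// expRK lnV ?posrE//; lra.
Qed.

End normal_quantile.

Lemma measurable_coord (R : realType) (m n : nat) (i : 'I_m) (j : 'I_n) :
  measurable_fun setT (fun A : 'M[R]_(m, n) => A i j).
Proof.
apply: (measurability _ (RGenOpens.measurableE R)) => _ [_ [x [y ->]] <-].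
rewrite setTI; apply: sub_sigma_algebra.
by apply: open_comp => // A _; exact: coord_continuous.
Qed.

(** * The union bound and the case of zero variance *)

Section union_bound.
Context d (T : measurableType d) (R : realType) (P : probability T R).

Lemma measure_bigsetU_le (I : Type) (s : seq I) (A : I -> set T) (q : R) :
  (forall i, measurable (A i)) -> (forall i, (P (A i) <= q%:E)%E) ->
  measurable (\big[setU/set0]_(i <- s) A i) /\
  (P (\big[setU/set0]_(i <- s) A i) <= ((size s)%:R * q)%:E)%E.
Proof.
move=> mA Aq; elim: s => [|i s [mU IH]].
  by rewrite big_nil measure0 mul0r; split.
rewrite big_cons; split; first exact: measurableU.
apply: le_trans (measureU2 _ (mA i) mU) _.
by rewrite /= -natr1 mulrDl mul1r addrC EFinD leeD.
Qed.

(** The case theta = 0: all summands vanish almost surely, so the strict inequality has probability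
    0. *)
Lemma sum_eq0_tail (n : nat) (W : 'I_n -> T -> R) :
  (forall i, measurable_fun setT (W i)) ->
  (forall i, L1 P (fun w => W i w ^+ 2)) ->
  \sum_(i < n) Ex P (fun w => W i w ^+ 2) = 0 ->
  P [set w | 0 < \sum_(i < n) W i w] = 0%E.
Proof.
move=> mW L2 E0; pose f w := \sum_(i < n) W i w ^+ 2.
have Lf : L1 P f by exact: L1_sum.
have f0 w : 0 <= f w by apply: sumr_ge0 => i _; exact: sqr_ge0.
have Ef : Ex P f = 0 by rewrite Ex_sum.
have : (\int[P]_w `|(f w)%:E| = 0)%E.
  under eq_integral do rewrite gee0_abs ?lee_fin//.
  by rewrite -[LHS]fineK ?[fine _]Ef//; exact: integrable_fin_num.
move=> /ae_eq_integral_abs => /(_ measurableT (measurable_int _ Lf)) [N [mN PN NS]].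
apply: measure_negligible; last first.
  exists N; split => // w /=; rewrite ltNge => /negP Sw; apply: NS => /= /(_ I) [fw].
  apply: Sw; rewrite big1// => i _.
  have /eqP := fw; rewrite psumr_eq0 => [/allP/(_ i)|j _]; last exact: sqr_ge0.
  by rewrite mem_index_enum sqrf_eq0 => /(_ isT)/eqP.
rewrite -[X in measurable X]setTI.
rewrite (_ : [set w | _] = (fun w => \sum_(i < n) W i w) @^-1` `]0, +oo[); last first.
  by apply/seteqP; split => w /=; rewrite in_itv/= andbT.
by apply: measurable_sum.
Qed.
End union_bound.

Section score_bound.
Variables (R : realType) (theta t1 M c : R).
Hypotheses (theta0 : 0 <= theta) (t10 : 0 < t1) (c0 : 0 < c).
Variables (n p : nat) (G : glm R n p) (f : 'rV[R]_p -> R -> 'rV[R]_p).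
Hypotheses (n0 : (0 < n)%N) (Hs : score_assumptions G theta t1 M f).
Let P := glm_prob G.
Let W (j : 'I_p) i w := score_term G f i w 0 j.
Let b : R := (Num.sqrt n%:R)^-1.

Let b0 : 0 < b. Proof. by rewrite invr_gt0 sqrtr_gt0 ltr0n. Qed.
Let nb : n%:R * b ^+ 2 = 1.
Proof. by rewrite /b exprVn sqr_sqrtr// mulfV// pnatr_eq0 -lt0n. Qed.

Let mW j i : measurable_fun setT (W j i).
Proof. exact: (measurableT_comp (measurable_coord _ _) (score_measurable Hs i)). Qed.

Let indW j : mutually_independent P (W j).
Proof.
move=> J B mB; have := score_indep Hs J (B := fun i => (fun v : 'rV[R]_p => v 0 j) @^-1` B i).
apply => i; rewrite -[X in measurable X]setTI; exact: measurable_coord.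
Qed.

Let L1_moment_expRxp j i : L1 P (fun w => expR (t1 * `|W j i w|)).
Proof.
apply/integrableP; split.
  apply/measurable_EFinP; apply: measurableT_comp => //.
  by apply: measurable_funM => //; exact: measurableT_comp.
under eq_integral do rewrite gee0_abs ?lee_fin ?expR_ge0//.
have := score_exp_moment Hs i j; rewrite unlock => /le_lt_trans; apply.
exact: ltry.
Qed.

Let L1pow j i k : (k <= 3)%N -> L1 P (fun w => W j i w ^+ k).
Proof.
move=> k3; apply: (L1_le _ _ (L1Z (moment_const t1) (L1_moment_expRxp j i))).
  exact: measurable_funX.
move=> w; rewrite normrX; apply: le_trans (power_le_expR _ t10 k3) _.
rewrite ler_wpM2l ?ler_expR//; first by have := moment_const_ge1 t10; lra.
by have : 0 <= t1 * `|W j i w| by [rewrite mulr_ge0// ltW]; lra.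
Qed.

Let meanW j i : Ex P (W j i) = 0.
Proof. by have := score_centered Hs i j; rewrite unlock /Ex /Rintegral => ->. Qed.

Let ExE (g : glm_space G -> R) : L1 P g -> ('E_P[g] = (Ex P g)%:E)%E.
Proof. by move=> Lg; rewrite unlock /Ex /Rintegral fineK//; exact: integrable_fin_num. Qed.

Let varW j : \sum_(i < n) Ex P (fun w => W j i w ^+ 2) = n%:R * theta ^+ 2.
Proof.
have := score_variance Hs j.
under eq_bigr do rewrite (ExE (L1pow j _ (isT : (2 <= 3)%N))).
rewrite sumEFin -EFinM => -[] <-.
by rewrite mulrA mulfV ?mul1r// pnatr_eq0 -lt0n.
Qed.

Let summandsW j : 0 < theta -> summands P (W j) theta t1 M.
Proof.
move=> th0; split => // i.
by have := score_exp_moment Hs i j; rewrite (ExE (L1_moment_expRxp j i)) lee_fin.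
Qed.

(** The assumptions are invariant under a change of sign, which makes the lower tail an upper
    tail. *)
Let summandsN j : 0 < theta -> summands P (fun i w => - W j i w) theta t1 M.
Proof.
move=> th0; have LW i : L1 P (W j i) by exact: (@L1pow j i 1 isT).
split => //.
- by move=> i; exact: measurableT_comp.
- move=> J B mB; have := @indW j J (fun i => -%R @^-1` B i); apply.
  move=> i; rewrite -[X in measurable X]setTI; exact: oppr_measurable.
- move=> i; have -> : (fun w => - W j i w) = (fun w => (-1) * W j i w).
    by apply/funext => w; rewrite mulN1r.
  by rewrite ExZ// meanW mulr0.
- by rewrite -(varW j); apply: eq_bigr => i _; congr Ex; apply/funext => w; rewrite sqrrN.
- by move=> i; under eq_fun do rewrite normrN.
- move=> i; under [X in Ex P X]eq_fun do rewrite normrN.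
  by have := score_exp_moment Hs i j; rewrite (ExE (L1_moment_expRxp j i)) lee_fin.
Qed.

Section threshold.
Variables (z q : R).
Hypothesis z0 : 0 <= z.
Let upper j := [set w | theta * z / b < \sum_(i < n) W j i w].
Let lower j := [set w | theta * z / b < \sum_(i < n) - W j i w].
Hypotheses (Uq : forall j, (P (upper j) <= q%:E)%E) (Lq : forall j, (P (lower j) <= q%:E)%E).

Let score_coord w j : score G w 0 j = b ^+ 2 * \sum_(i < n) W j i w.
Proof.
rewrite (score_mean_form Hs) mxE summxE; congr (_ * _).
by rewrite /b exprVn sqr_sqrtr.
Qed.

Let norm_score_le w : (`|score G w| <= theta * z * b) =
  [forall j, `|score G w 0 j| <= theta * z * b].
Proof.
(* The maximum norm is a maximum started at 0, so comparison by coordinates requires a nonnegative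
   bound. *)
have B0 : 0 <= theta * z * b by rewrite !mulr_ge0// ltW.
rewrite [X in X <= _]/Num.norm/= mx_normrE; apply/idP/forallP => [/bigmax_leP[_ H] j|H].
  exact: (H (0, j)).
by apply/bigmax_leP; split => // -[i j] _ /=; rewrite ord1.
Qed.

Let mS j (h : R -> R) : measurable_fun setT h ->
  measurable_fun setT (fun w => \sum_(i < n) h (W j i w)).
Proof. by move=> mh; apply: measurable_sum => i; exact: measurableT_comp. Qed.

Let measurable_gt (g : glm_space G -> R) (a : R) : measurable_fun setT g ->
  measurable [set w | a < g w].
Proof.
move=> mg; rewrite -[X in measurable X]setTI.
rewrite (_ : [set w | _] = g @^-1` `]a, +oo[); first exact: mg.
by apply/seteqP; split => w /=; rewrite in_itv/= andbT.
Qed.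

(** The factor [c] cancels on both sides, and the complement of the event is the union over the p
    coordinates of an upper and a lower tail event. *)
Lemma score_event_ge :
  ((1 - 2 * p%:R * q)%:E <= P (score_event G c (c * theta / Num.sqrt n%:R * z)))%E.
Proof.
have mU j : measurable (upper j).
  by apply: measurable_gt; exact: (@mS j id).
have mL j : measurable (lower j).
  by apply: measurable_gt; exact: (@mS j -%R).
have mUL j : measurable (upper j `|` lower j) by exact: measurableU.
have ULq j : (P (upper j `|` lower j) <= (2 * q)%:E)%E.
  apply: le_trans (measureU2 _ (mU j) (mL j)) _.
  have -> : (2 * q)%:E = (q%:E + q%:E)%E by rewrite -EFinD; congr EFin; ring.
  exact: (leeD (Uq j) (Lq j)).
have [mB Bq] := measure_bigsetU_le (enum 'I_p) mUL ULq.
set B := \big[_/_]_(j <- _) _ in mB Bq.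
have bE : b * (theta * z / b) = theta * z by field; rewrite gt_eqF.
have tailE x : (theta * z * b < b ^+ 2 * x) = (theta * z / b < x).
  by rewrite -[RHS](ltr_pM2l b0) bE mulrC expr2 -mulrA ltr_pM2l.
have -> : score_event G c (c * theta / Num.sqrt n%:R * z) = ~` B.
  rewrite /B -bigcup_seq; apply/seteqP; split => w /=.
    rewrite /score_event/= -/b.
    have -> : c * theta * b * z = c * (theta * z * b) by ring.
    rewrite ler_pM2l// norm_score_le => /forallP H [j _] [] /=; rewrite /upper /lower /=.
      move=> Hj; have := H j; rewrite score_coord ler_norml => /andP[_].
      by apply/negP; rewrite -ltNge tailE.
    rewrite sumrN => Hj; have := H j; rewrite score_coord ler_norml => /andP[+ _].
    by apply/negP; rewrite -ltNge ltrNr -mulrN tailE.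
  move=> HB; rewrite /score_event/= -/b.
  have -> : c * theta * b * z = c * (theta * z * b) by ring.
  rewrite ler_pM2l// norm_score_le; apply/forallP => j.
  rewrite score_coord leNgt; apply/negP; rewrite ltr_normr => /orP[] Hj; apply: HB.
    exists j; first by rewrite /= mem_enum.
    by left; rewrite /upper/= -tailE.
  exists j; first by rewrite /= mem_enum.
  by right; rewrite /lower/= sumrN -tailE mulrN.
rewrite probability_setC// EFinB leeB//.
by apply: le_trans Bq _; rewrite size_enum_ord lee_fin; lra.
Qed.
End threshold.

(** The absolute value keeps the error bound nonnegative whatever the sign of the rate; for theta =
    0 this is all that remains to be checked, both tails being null. *)
Lemma score_event_cramer (z : R) : 0 <= z -> (1 + z) ^+ 3 * b <= 1 ->
  (0 < theta -> z * b <= theta * t1 / 4) ->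
  ((1 - 2 * p%:R * (gauss_tail z * (1 + `|cramer_rate theta t1 M| * ((1 + z) ^+ 3 * b))))%:E
   <= P (score_event G c (c * theta / Num.sqrt n%:R * z)))%E.
Proof.
move=> z0 zb3 zb; have t0 := gauss_tail_ge0 z.
have y0 : 0 <= (1 + z) ^+ 3 * b by rewrite mulr_ge0 ?exprn_ge0 ?(ltW b0)//; lra.
have rle : gauss_tail z * (1 + cramer_rate theta t1 M * ((1 + z) ^+ 3 * b)) <=
    gauss_tail z * (1 + `|cramer_rate theta t1 M| * ((1 + z) ^+ 3 * b)).
  by rewrite ler_wpM2l// lerD2l ler_wpM2r// ler_norm.
have r0 : 0 <= gauss_tail z * (1 + `|cramer_rate theta t1 M| * ((1 + z) ^+ 3 * b)).
  by rewrite mulr_ge0// addr_ge0// mulr_ge0.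
have [th|th] := eqVneq theta 0.
  have E : theta * z / b = 0 by rewrite th !mul0r.
  apply: score_event_ge => // j; rewrite E.
    rewrite sum_eq0_tail ?lee_fin//; first by move=> i; exact: (@L1pow j i 2 isT).
    by rewrite varW th expr0n mulr0.
  rewrite sum_eq0_tail ?lee_fin//.
  - by move=> i; exact: measurableT_comp.
  - by move=> i; under eq_fun do rewrite sqrrN; exact: (@L1pow j i 2 isT).
  - transitivity (n%:R * theta ^+ 2); last by rewrite th expr0n mulr0.
    by rewrite -(varW j); apply: eq_bigr => i _; congr Ex; apply/funext => w; rewrite sqrrN.
have th0 : 0 < theta by rewrite lt_neqAle eq_sym th.
apply: score_event_ge => // j.
  apply: le_trans (cramer (summandsW j th0) b0 nb z0 zb3 (zb th0)) _.
  by rewrite lee_fin.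
apply: le_trans (cramer (summandsN j th0) b0 nb z0 zb3 (zb th0)) _.
by rewrite lee_fin.
Qed.
End score_bound.

(** * Uniform constants and the asymptotic statement *)

Lemma quantile_growth (R : realType) (alpha : R) : 0 < alpha -> alpha < 1 ->
  exists2 C : R, 0 < C & forall p : nat, (1 < p)%N ->
    let z := Phi_inv (1 - alpha / (2 * p%:R)) in
    [/\ gauss_tail z = alpha / (2 * p%:R), 0 <= z
      & (1 + z) ^+ 3 <= C * ln p%:R `^ (5 / 2)].
Proof.
move=> a0 a1; pose l2 := ln (2 : R).
have l20 : 0 < l2 by rewrite ln_gt0// ltr1n.
pose k := 2 + 2 * l2 + 2 * ln alpha^-1.
have k0 : 0 <= k.
  have : 0 <= ln alpha^-1 by rewrite ln_ge0// invf_ge1// ltW.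
  rewrite /k; lra.
(* From (1 + z)^2 <= 2 + 2 z^2 <= 2 (1 + k) + 4 ln p; since p >= 2, the constant part is at most a
   multiple of ln p. *)
pose C' := 2 * (1 + k) / l2 + 4.
have C'0 : 0 < C' by rewrite /C' ltr_wpDl// divr_ge0 ?(ltW l20)//; lra.
exists (C' `^ (5 / 2)); first by rewrite powR_gt0.
move=> p p1 z.
have p2 : 2 <= p%:R :> R by rewrite (ler_nat R 2 p).
have p0 : 0 < p%:R :> R by lra.
have u0 : 0 < alpha / (2 * p%:R) by rewrite divr_gt0// mulr_gt0.
have u2 : alpha / (2 * p%:R) < 1 / 2.
  rewrite ltr_pdivrMr ?mulr_gt0//; lra.
have [tz z0] := Phi_inv_tail u0 u2; rewrite -/z in tz z0.
split=> //.
have zz : z ^+ 2 <= k + 2 * ln p%:R.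
  have := tail_quantile_le z0; rewrite tz => /(_ u0).
  have -> : ln (alpha / (2 * p%:R))^-1 = ln alpha^-1 + l2 + ln p%:R.
    rewrite invf_div mulrC lnM ?posrE ?invr_gt0 ?mulr_gt0//.
    by rewrite lnM ?posrE// addrA.
  rewrite /k; lra.
have lp : l2 <= ln p%:R by rewrite ler_ln ?posrE.
have z2 : (1 + z) ^+ 2 <= C' * ln p%:R.
  have h1 : 2 * (1 + k) <= 2 * (1 + k) / l2 * ln p%:R.
    by rewrite mulrAC ler_pdivlMr// ler_wpM2l//; lra.
  have := sqr_ge0 (z - 1); rewrite /C' mulrDl; lra.
(* The exponent 5/2 comes from (1 + z)^5 = ((1 + z)^2)^(5/2), which dominates (1 + z)^3. *)
apply: (@le_trans _ _ ((1 + z) ^+ 5)); first by rewrite ler_weXn2l//; lra.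
have -> : (1 + z) ^+ 5 = ((1 + z) ^+ 2) `^ (5 / 2).
  rewrite -powR_mulrn; last lra.
  rewrite -[X in _ = X `^ _]powR_mulrn; last lra.
  by rewrite -powRrM; congr (_ `^ _); field.
rewrite -powRM ?(ltW C'0)//; last by lra.
by rewrite ge0_ler_powR// ?nnegrE ?sqr_ge0// mulr_ge0//; lra.
Qed.

Lemma score_event_moderate (R : realType) (theta t1 M c alpha : R) :
  0 <= theta -> 0 < t1 -> 1 < c -> 0 < alpha -> alpha < 1 ->
  exists K : R, 0 < K /\
    forall (n p : nat) (G : glm R n p) (f : 'rV[R]_p -> R -> 'rV[R]_p),
      (0 < n)%N -> (1 < p)%N -> score_assumptions G theta t1 M f ->
      ((1 - alpha *
          (1 + K * (ln p%:R `^ (5 / 2) / Num.sqrt n%:R)))%:E <=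
       glm_prob G (score_event G c (lambda1 c theta alpha n p)))%E.
Proof.
move=> th0 t0 c1 a0 a1; have [C C0 HC] := quantile_growth a0 a1.
(* The threshold on the rate below which both smallness conditions of the moderate deviation bound
   hold; for theta = 0 only the first is imposed. *)
pose e := (if theta == 0 then 1 else Num.min 1 (theta * t1 / 4)) / C.
have e0 : 0 < e.
  rewrite divr_gt0//; case: eqVneq => // th.
  by rewrite lt_min ltr01/= divr_gt0// mulr_gt0// lt_neqAle eq_sym th.
have ae0 : 0 < (alpha * e)^-1 by rewrite invr_gt0 mulr_gt0.
pose r := `|cramer_rate theta t1 M|.
exists (r * C + (alpha * e)^-1); split.
  by apply: ltr_wpDl => //; apply: mulr_ge0; [exact: normr_ge0|exact: ltW].
move=> n p G f n0 p1 Hs; have [tz z0 zC] := HC p p1.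
set z := Phi_inv _ in tz z0 zC.
set L := ln p%:R `^ (5 / 2) in zC *.
have b0 : 0 < (Num.sqrt n%:R)^-1 :> R by rewrite invr_gt0 sqrtr_gt0 ltr0n.
set b := (Num.sqrt n%:R)^-1 in b0 *.
have L0 : 0 <= L by exact: powR_ge0.
have Lb0 : 0 <= L * b by rewrite mulr_ge0// ltW.
(* Above the threshold, the summand 1 / (alpha e) of the constant makes the claimed lower bound at
   most 0. *)
have [eT|Te] := leP e (L * b).
  apply: (@le_trans _ _ 0%E); last exact: measure_ge0.
  rewrite lee_fin.
  have : 1 <= alpha * ((alpha * e)^-1 * (L * b)).
    have -> : alpha * ((alpha * e)^-1 * (L * b)) = L * b / e.
      by field; rewrite !gt_eqF.
    by rewrite ler_pdivlMr// mul1r.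
  have : 0 <= alpha * (r * C * (L * b)) by exact: (mulr_ge0 (ltW a0) (mulr_ge0 (mulr_ge0 (normr_ge0 _) (ltW C0)) Lb0)).
  lra.
have y_le : (1 + z) ^+ 3 * b <= C * (L * b) by rewrite mulrA ler_wpM2r// ltW.
have y_e : (1 + z) ^+ 3 * b <= C * e by apply: le_trans y_le _; rewrite ler_wpM2l// ltW.
have CeE : C * e = if theta == 0 then 1 else Num.min 1 (theta * t1 / 4).
  by rewrite /e mulrC divfK// gt_eqF.
have y1 : (1 + z) ^+ 3 * b <= 1.
  by apply: le_trans y_e _; rewrite CeE; case: ifP => // _; rewrite ge_min lexx.
have zb : 0 < theta -> z * b <= theta * t1 / 4.
  move=> thp; have zz : z <= (1 + z) ^+ 3.
    by rewrite (@le_trans _ _ (1 + z))//; [lra|rewrite exprSr ler_peMl// ?exprn_ege1//; lra].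
  apply: le_trans (_ : _ <= (1 + z) ^+ 3 * b) _; first by rewrite ler_wpM2r// ltW.
  by apply: le_trans y_e _; rewrite CeE gt_eqF// ge_min lexx orbT.
have H := score_event_cramer th0 t0 (lt_trans ltr01 c1) n0 Hs z0 y1 zb.
rewrite /lambda1 -/z; apply: le_trans H; rewrite lee_fin tz -/r lerD2l lerN2.
have p0 : p%:R != 0 :> R by rewrite pnatr_eq0 -lt0n ltnW.
have -> : 2 * p%:R * (alpha / (2 * p%:R) * (1 + r * ((1 + z) ^+ 3 * b))) =
   alpha * (1 + r * ((1 + z) ^+ 3 * b)) by field.
rewrite ler_wpM2l ?(ltW a0)// lerD2l.
apply: (@le_trans _ _ (r * C * (L * b))).
  by rewrite -mulrA ler_wpM2l// normr_ge0.
by rewrite ler_wpM2r// lerDl ltW.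
Qed.

(** With x = a / n^(1/5), the rate is at most x^(5/2), because sqrt n = (n^(1/5))^(5/2); and x^(5/2)
    <= x for x <= 1. *)
Lemma rate_le (R : realType) (n p : nat) (a : R) : (0 < n)%N -> (1 < p)%N ->
  p%:R <= expR a -> a / n%:R `^ (1 / 5) <= 1 ->
  ln p%:R `^ (5 / 2) / Num.sqrt n%:R <= a / n%:R `^ (1 / 5).
Proof.
move=> n0 p1 pa x1.
have p0 : 0 < p%:R :> R by rewrite ltr0n ltnW.
have nn0 : 0 < n%:R :> R by rewrite ltr0n.
have lp0 : 0 < ln p%:R :> R by rewrite ln_gt0// ltr1n.
have lpa : ln p%:R <= a by rewrite -[a]expRK ler_ln ?posrE ?expR_gt0.
have a0 : 0 < a by exact: lt_le_trans lpa.
have N0 : 0 < n%:R `^ (1 / 5) :> R by rewrite powR_gt0.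
set x := a / _ in x1 *; have x0 : 0 < x by rewrite divr_gt0.
apply: (@le_trans _ _ (x `^ (5 / 2))); last first.
  rewrite -[leRHS]powRr1 ?(ltW x0)//; apply: ger_powR; [by rewrite x0 x1|lra].
rewrite ler_pdivrMr ?sqrtr_gt0//.
have -> : Num.sqrt n%:R = (n%:R `^ (1 / 5)) `^ (5 / 2) :> R.
  rewrite -powRrM -powR12_sqrt ?(ltW nn0)//; congr (_ `^ _); by field.
rewrite -powRM ?(ltW x0) ?(ltW N0)// /x divfK ?gt_eqF//.
by rewrite ge0_ler_powR ?nnegrE ?(ltW lp0) ?(ltW a0).
Qed.

(** [K] is chosen before [n], [p], [G] and [f], so the first bound is uniform over models. The
    condition p <= exp(o(n^(1/5))) is expressed along arbitrary sequences by a majorant exp(a_k)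
    with a_k / n_k^(1/5) -> 0. *)
Theorem corollary2p4 (R : realType) (theta t1 M c alpha : R) :
  0 <= theta -> 0 < t1 -> 1 < c -> 0 < alpha -> alpha < 1 ->
  (exists K : R, 0 < K /\
    forall (n p : nat) (G : glm R n p) (f : 'rV[R]_p -> R -> 'rV[R]_p),
      (0 < n)%N -> (1 < p)%N -> score_assumptions G theta t1 M f ->
      ((1 - alpha *
          (1 + K * (ln p%:R `^ (5 / 2) / Num.sqrt n%:R)))%:E <=
       glm_prob G (score_event G c (lambda1 c theta alpha n p)))%E) /\
  (forall (n p : nat -> nat) (a : nat -> R)
      (G : forall k, glm R (n k) (p k))
      (f : forall k, 'rV[R]_(p k) -> R -> 'rV[R]_(p k)),
    n k @[k --> \oo] --> \oo -> p k @[k --> \oo] --> \oo ->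
    a k / (n k)%:R `^ (1 / 5) @[k --> \oo] --> (0 : R) ->
    (forall k, (p k)%:R <= expR (a k)) ->
    (forall k, score_assumptions (G k) theta t1 M (f k)) ->
    exists eps : nat -> R, eps k @[k --> \oo] --> (0 : R) /\
      forall k,
        ((1 - alpha * (1 + eps k))%:E <=
         glm_prob (G k)
           (score_event (G k) c (lambda1 c theta alpha (n k) (p k))))%E).
Proof.
move=> th0 t10 c1 a0 a1.
have HK := score_event_moderate M th0 t10 c1 a0 a1.
split=> //; have {HK} [K [K0 HK]] := HK.
move=> n p a G f noo poo aoo pa Hs.
pose rate k : R := ln (p k)%:R `^ (5 / 2) / Num.sqrt (n k)%:R.
(* The default alpha^-1 makes the lower bound equal to -alpha, hence trivial, at the finitely many k
   where n_k = 0 or p_k <= 1. *)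
exists (fun k => if (0 < n k)%N && (1 < p k)%N then K * rate k else alpha^-1).
split; last first.
  move=> k; case: ifP => [/andP[n0 p1]|_]; first exact: (HK _ _ _ (f k)).
  apply: (@le_trans _ _ 0%E); last exact: measure_ge0.
  by rewrite lee_fin mulrDr divff ?gt_eqF//; lra.
have near_np : \forall k \near \oo, (0 < n k)%N && (1 < p k)%N.
  have n0 : \forall k \near \oo, (0 < n k)%N by move/cvgnyPgt : noo; exact.
  have p1 : \forall k \near \oo, (1 < p k)%N by move/cvgnyPgt : poo; exact.
  by near=> k; apply/andP; split; near: k.
have rate0 : rate k @[k --> \oo] --> (0 : R).
  apply: (@squeeze_cvgr _ _ _ _ (fun=> 0) _ _ _ _ (cvg_cst _) aoo).
  have small : \forall k \near \oo, a k / (n k)%:R `^ (1 / 5) < 1.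
    exact: (cvgr_lt 0 aoo).
  near=> k.
  have /andP[n0 p1] : (0 < n k)%N && (1 < p k)%N by near: k.
  rewrite divr_ge0 ?powR_ge0 ?sqrtr_ge0//=.
  by apply: (rate_le n0 p1 (pa k)); apply: ltW; near: k.
have KR : K * rate k @[k --> \oo] --> (0 : R).
  by rewrite -(mulr0 K); apply: cvgM => //; exact: cvg_cst.
apply: cvg_trans KR; apply: near_eq_cvg; near=> k.
by have -> : (0 < n k)%N && (1 < p k)%N by near: k.
Unshelve. all: by end_near.
Qed.
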